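(* Let $f$ be any probability density function on $\mathbb{R}^d$, let $x\in\mathbb{R}^d$ be a Lebesgue point of $f$ such that $f(x)>0$, and let $Z$ be a random variable with the distribution $\mathscr{D}$ on $\mathbb{R}^+$ (defined in the context). For each $n\ge1$ let $L_n(x)$ be the cell that contains $x$ in the Voronoi diagram generated by $\{X_1,\dots,X_n\}$, where $X_1,\dots,X_n$ are i.i.d. with density $f$. Then, as $n\to\infty$, $$nf(x)\,\lambda(L_n(x))\to Z\quad\text{in distribution}.$$
   Context: $d\ge1$ is an integer, $\|\cdot\|$ is the Euclidean norm on $\mathbb{R}^d$, $\lambda$ is Lebesgue measure, $B_{z,r}$ is the open ball with center $z$ and radius $r$, and $\mathbb{I}_A$ is the indicator of the event $A$. A point $x\in\mathbb{R}^d$ is a Lebesgue point of $f$ if $\lim_{r\to0}\frac{1}{\lambda(B_{x,r})}\int_{B_{x,r}}|f(u)-f(x)|\,du=0$. The Voronoi diagram generated by $\{X_1,\dots,X_n\}$ is the collection of the cells $\{p\in\mathbb{R}^d:\ \|p-X_i\|\le\|p-X_j\|\ \text{for all } j\ne i\}$, $i=1,\dots,n$; the cell indexed by $i$ has nucleus $X_i$. For a fixed point $x$, $L_n(x)$ denotes the cell that contains $x$; it is almost surely unique, and its nucleus is the point among $X_1,\dots,X_n$ nearest to $x$. Definition of $\mathscr{D}$. For every positive integer $k$, let $W$ be Bernoulli$\left(\frac{k}{k+1}\right)$ and $U_1,\dots,U_k$ be i.i.d. uniform on $B_{0,1}\subset\mathbb{R}^d$, independent of $W$. With $\bar1:=(1,0,\dots,0)\in\mathbb{R}^d$,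 put $$\begin{aligned}D_k:=\ &\frac{\lambda\left(B_{U_1,\|\bar1-U_1\|}\cup\dots\cup B_{U_k,\|\bar1-U_k\|}\cup B_{0,1}\right)}{\lambda(B_{0,1})}\,\mathbb{I}_{\{W=0\}}\\&+\frac{\lambda\left(B_{\bar1,\|\bar1-U_1\|}\cup B_{U_2,\|U_1-U_2\|}\cup\dots\cup B_{U_k,\|U_1-U_k\|}\cup B_{0,\|U_1\|}\right)}{\lambda(B_{0,1})}\,\mathbb{I}_{\{W=1\}}.\end{aligned}$$ $\mathscr{D}$ is the unique probability distribution on $\mathbb{R}^+$ whose $k$-th moment equals $\mathbb{E}\left[(k+1)!/D_k^{k+1}\right]$ for every $k\ge1$. (The paper shows that $\mathscr{D}$ exists, is unique, and is the weak limit of the distribution of $n\mu_f(L_n(x))$ for every such $f$ and $x$, where $\mu_f$ is the measure with density $f$.) *)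

(* Defs.v *)
From HB Require Import structures.
From mathcomp Require Import all_boot all_order all_algebra.
From mathcomp Require Import all_classical all_reals all_analysis.
From mathcomp Require Import measurable_realfun.

Set Implicit Arguments.
Unset Strict Implicit.
Unset Printing Implicit Defensive.

Import Order.TTheory GRing.Theory Num.Theory.
Import numFieldNormedType.Exports.

Local Open Scope classical_set_scope.
Local Open Scope ring_scope.

Section tuple_product_measure.
Context {dT} {T : measurableType dT} {R : realType}.
Local Open Scope ereal_scope.

Definition tcons n (p : T * n.-tuple T) : n.+1.-tuple T :=
  [tuple of p.1 :: p.2].

Lemma measurable_tcons n : measurable_fun [set: T * n.-tuple T] (@tcons n).
Proof.
by apply: measurable_cons; [exact: measurable_fst|exact: measurable_snd].
Qed.

Section tcons_measure.
Context (m1 : {sigma_finite_measure set T -> \bar R}) (n : nat)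
  (m2 : {sigma_finite_measure set (n.-tuple T) -> \bar R}).

Definition tcons_measure : set (n.+1.-tuple T) -> \bar R :=
  pushforward (m1 \x m2) (@tcons n).

Let tcons_measure0 : tcons_measure set0 = 0.
Proof. by rewrite /tcons_measure /pushforward preimage_set0 measure0. Qed.

Let tcons_measure_ge0 A : 0 <= tcons_measure A.
Proof. by rewrite /tcons_measure /pushforward. Qed.

Let tcons_measure_sigma_additive : semi_sigma_additive tcons_measure.
Proof.
have mtcons B : measurable B -> measurable (@tcons n @^-1` B).
  by move=> mB; rewrite -[X in measurable X]setTI; exact: measurable_tcons.
move=> F mF tF mUF; rewrite /tcons_measure /pushforward preimage_bigcup.
apply: measure_semi_sigma_additive.
- by move=> i; exact: mtcons.
- apply/trivIsetP => /= i j _ _ ij; rewrite -preimage_setI.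
  by move/trivIsetP : tF => /(_ _ _ _ _ ij) ->//; rewrite preimage_set0.
- by rewrite -preimage_bigcup; exact: mtcons.
Qed.

HB.instance Definition _ := isMeasure.Build _ _ _ tcons_measure
  tcons_measure0 tcons_measure_ge0 tcons_measure_sigma_additive.

Let tcons_measure_sigma_finite : sigma_finite setT tcons_measure.
Proof.
have /sigma_finiteP[F [TF ndF Foo]] := sigma_finiteT m1.
have /sigma_finiteP[G [TG ndG Goo]] := sigma_finiteT m2.
pose g (t : n.+1.-tuple T) := (thead t, [tuple of behead t]).
have Kg p : g (tcons p) = p.
  by case: p => a b; congr pair => //; exact/val_inj.
have mg : measurable_fun setT g.
  apply/measurable_fun_pair => /=; first exact: measurable_tnth.
  exact: measurable_behead.
exists (fun i => g @^-1` (F i `*` G i)).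
  rewrite -preimage_bigcup; apply/esym/seteqP; split => // t _.
  have [i _ Fi] : (\bigcup_i F i) (thead t) by rewrite -TF.
  have [j _ Gj] : (\bigcup_i G i) [tuple of behead t] by rewrite -TG.
  exists (maxn i j) => //; split.
    by move: Fi; exact/subsetPset/ndF/leq_maxl.
  by move: Gj; exact/subsetPset/ndG/leq_maxr.
move=> i; have [mFi Fioo] := Foo i; have [mGi Gioo] := Goo i; split.
  by rewrite -[X in measurable X]setTI; apply: mg => //; exact: measurableX.
rewrite /tcons_measure /pushforward.
rewrite [X in (_ \x _) X](_ : _ = F i `*` G i).
  by rewrite product_measure1E// lte_mul_pinfty// ge0_fin_numE.
by rewrite -comp_preimage (_ : g \o _ = id) ?preimage_id//; exact/funext.
Qed.

HB.instance Definition _ := Measure_isSigmaFinite.Build _ _ _ tcons_measure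
  tcons_measure_sigma_finite.

End tcons_measure.

Fixpoint tuple_product (m : {sigma_finite_measure set T -> \bar R}) (n : nat) :
    {sigma_finite_measure set (n.-tuple T) -> \bar R} :=
  match n with
  | 0 => \d_([tuple] : 0.-tuple T)
  | n'.+1 => tcons_measure m (tuple_product m n')
  end.

Lemma measurable_box n (A : 'I_n -> set T) : (forall i, measurable (A i)) ->
  measurable [set t : n.-tuple T | forall i, A i (tnth t i)].
Proof.
move=> mA; rewrite (_ : [set _ | _] =
    \bigcap_(i in [set: 'I_n]) (fun t => tnth t i) @^-1` A i).
  apply: fin_bigcap_measurable => // i _.
  by rewrite -[X in measurable X]setTI; exact: measurable_tnth.
by apply/seteqP; split => t /= At => [i _|i]; exact: At.
Qed.

Lemma tuple_product_box (m : {sigma_finite_measure set T -> \bar R}) (n : nat)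
    (A : 'I_n -> set T) : (forall i, measurable (A i)) ->
  tuple_product m n [set t | forall i, A i (tnth t i)] = \prod_(i < n) m (A i).
Proof.
elim: n A => [|n IH] A mA /=.
  by rewrite big_ord0 diracE mem_set//= => -[].
rewrite big_ord_recl -(IH (fun i => A (lift ord0 i)))//.
rewrite -product_measure1E//; last first.
  exact: (@measurable_box n (fun i => A (lift ord0 i))).
rewrite /tcons_measure /pushforward; congr ((_ \x _) _).
apply/seteqP; split => -[a t] /=.
  move=> At; split; first exact: (At ord0).
  by move=> i; move: (At (lift ord0 i)); rewrite tnthS.
move=> [Aa At] i; case: (unliftP ord0 i) => [j|] -> //.
by rewrite tnthS; exact: At.
Qed.

End tuple_product_measure.

Section lebesgue_measure_realType.
Context {R : realType}.

(* [lebesgue_measure] lives on [measurableTypeR R]; this is the same function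
   on [R] with its own (identical) sigma-algebra, as used by [{RV P >-> R}]
   and by the measurable structure of [d.-tuple R]. *)
Definition lebesgueR : set R -> \bar R := @lebesgue_measure R.

Let lebesgueR0 : lebesgueR set0 = 0%E.
Proof. exact: measure0. Qed.

Let lebesgueR_ge0 A : (0 <= lebesgueR A)%E.
Proof. exact: measure_ge0. Qed.

Let lebesgueR_sigma_additive : semi_sigma_additive lebesgueR.
Proof. exact: (@measure_semi_sigma_additive _ _ _ (@lebesgue_measure R)). Qed.

HB.instance Definition _ := isMeasure.Build _ _ _ lebesgueR
  lebesgueR0 lebesgueR_ge0 lebesgueR_sigma_additive.

Let lebesgueR_sigma_finite : sigma_finite setT lebesgueR.
Proof. exact: (@sigma_finiteT _ _ _ (@lebesgue_measure R)). Qed.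

HB.instance Definition _ := Measure_isSigmaFinite.Build _ _ _ lebesgueR
  lebesgueR_sigma_finite.

End lebesgue_measure_realType.

Section euclidean.
Context {R : realType} (d : nat).
Implicit Types (x y : d.-tuple R) (r : R).

Definition lebesgue : {sigma_finite_measure set (d.-tuple R) -> \bar R} :=
  tuple_product lebesgueR d.

Definition edist x y : R :=
  Num.sqrt (\sum_(i < d) (tnth x i - tnth y i) ^+ 2).

Definition eball x r : set (d.-tuple R) := [set y | edist x y < r].

Definition origin : d.-tuple R := [tuple 0 | _ < d].

Definition e1 : d.-tuple R := [tuple (i == 0%N :> nat)%:R | i < d].

Lemma measurable_edist x : measurable_fun setT (edist x).
Proof.
have msqrt : measurable_fun [set: R] (@Num.sqrt R).
  by apply: continuous_measurable_fun; exact: sqrt_continuous.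
apply: (measurableT_comp msqrt).
apply: (@measurable_sum _ _ _ setT _ _
  (fun i y => (tnth x i - tnth y i) ^+ 2)) => i.
apply: measurable_funX.
by apply: measurable_funB => //; exact: measurable_tnth.
Qed.

Lemma measurable_eball x r : measurable (eball x r).
Proof.
rewrite (_ : eball x r = edist x @^-1` `]-oo, r[).
  by rewrite -[X in measurable X]setTI; exact: measurable_edist.
by apply/seteqP; split => y; rewrite /= in_itv.
Qed.

Lemma lebesgue_unit_ball : (0 < lebesgue (eball origin 1) < +oo)%E.
Proof.
have mbox (a b : R) :
    measurable [set t : d.-tuple R | forall i, `[a, b]%classic (tnth t i)].
  apply: (@measurable_box _ _ _ (fun=> `[a, b]%classic)) => i.
  exact: measurable_itv.
have box_itv (a b : R) : a < b ->
    lebesgue [set t | forall i, `[a, b]%classic (tnth t i)] = ((b - a) ^+ d)%:E.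
  move=> ab; rewrite (@tuple_product_box _ _ _ _ _ (fun=> `[a, b]%classic)).
    rewrite -[in RHS](card_ord d) -prodr_const (big_morph EFin EFinM erefl).
    apply: eq_bigr => i _; rewrite /= /lebesgueR lebesgue_measure_itv/=.
    by rewrite lte_fin ab.
  by move=> i; exact: measurable_itv.
have edistE y : edist origin y = Num.sqrt (\sum_(i < d) tnth y i ^+ 2).
  congr Num.sqrt; apply: eq_bigr => i _.
  by rewrite tnth_mktuple sub0r sqrrN.
apply/andP; split.
- pose c : R := d.+1%:R^-1.
  have c0 : 0 < c by rewrite invr_gt0.
  apply: (@lt_le_trans _ _
    (lebesgue [set t | forall i, `[- c, c]%classic (tnth t i)])).
    by rewrite box_itv ?gtrN// lte_fin exprn_gt0// subr_gt0 gtrN.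
  apply: le_measure; rewrite ?inE//; first exact: measurable_eball.
  move=> t /= tc; rewrite /eball/= edistE -[ltRHS]sqrtr1 ltr_sqrt//.
  apply: (@le_lt_trans _ _ (\sum_(i < d) c)).
    apply: ler_sum => i _; have := tc i; rewrite in_itv/= -ler_norml => tic.
    rewrite -real_normK ?num_real//.
    apply: (@le_trans _ _ (c ^+ 2)); first by rewrite lerXn2r// nnegrE// ltW.
    by rewrite expr2 ger_pMl// invf_le1// ler1n.
  rewrite sumr_const card_ord -mulr_natl /c ltr_pdivrMr// mul1r ltr_nat.
  exact: ltnSn.
- apply: (@le_lt_trans _ _
    (lebesgue [set t | forall i, `[- 1, 1]%classic (tnth t i)])); last first.
    by rewrite box_itv ?ltry// gtrN.
  apply: le_measure; rewrite ?inE//; first exact: measurable_eball.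
  move=> t /= + i; rewrite /eball/= edistE in_itv/= -ler_norml => t1.
  rewrite -sqrtr_sqr ltW// (le_lt_trans _ t1)// ler_wsqrtr//.
  rewrite (bigD1 i)//= lerDl sumr_ge0// => j _; exact: sqr_ge0.
Qed.

Definition lebesgue_point (f : d.-tuple R -> R) x :=
  ((lebesgue (eball x r))^-1 *
    \int[lebesgue]_(u in eball x r) `|f u - f x|%:E)%E @[r --> (0 : R)^'+]
    --> 0%E.

Definition is_density (f : d.-tuple R -> R) :=
  [/\ measurable_fun setT f, forall u, 0 <= f u &
      (\int[lebesgue]_u (f u)%:E = 1)%E].

(* [\d_origin] is only the default that [mnormalize] requires, see
   [unif_ballE]. *)
Definition unif_ball : probability (d.-tuple R) R :=
  mnormalize (mrestr lebesgue (measurable_eball origin 1)) \d_origin.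

Lemma unif_ballE A : unif_ball A =
  (lebesgue (A `&` eball origin 1) *
    (fine (lebesgue (eball origin 1)))^-1%:E)%E.
Proof.
have /andP[B0 Boo] := lebesgue_unit_ball.
have BE : mrestr lebesgue (measurable_eball origin 1) setT =
    lebesgue (eball origin 1) by rewrite /mrestr setTI.
by rewrite /unif_ball/= /mnormalize/= BE gt_eqF// lt_eqF.
Qed.

(* [u] lists U_1, ..., U_k, and [w] is the value of W (true for 1). *)
Definition D_var (w : bool) (u : seq (d.-tuple R)) : R :=
  let u1 := head origin u in
  let vol (A : set (d.-tuple R)) := fine (lebesgue A) in
  vol (\bigcup_(v in [set` u]) eball v (edist e1 v) `|` eball origin 1)
    / vol (eball origin 1) * (~~ w)%:R +
  vol (eball e1 (edist e1 u1)
       `|` \bigcup_(v in [set` behead u]) eball v (edist u1 v)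
       `|` eball origin (edist origin u1))
    / vol (eball origin 1) * w%:R.

(* E[(k+1)! / D_k^(k+1)]: W and (U_1, ..., U_k) are the coordinates of the product probability. *)
Definition D_moment (k : nat) : \bar R :=
  (\int[bernoulli_prob (k%:R / k.+1%:R) \x tuple_product unif_ball k]_p
    ((k.+1)`!%:R / D_var p.1 p.2 ^+ k.+1)%:E)%E.

(* No uniqueness clause: these moments determine [nu]. *)
Definition is_scrD (nu : probability R R) :=
  nu [set z | z < 0] = 0%E /\
  forall k, (0 < k)%N -> (\int[nu]_z (z ^+ k)%:E = D_moment k)%E.

Definition voronoi_cell n (y : 'I_n -> d.-tuple R) (i : 'I_n) :=
  [set p | forall j, j != i -> edist p (y i) <= edist p (y j)].

(* If several cells contain [x] (a null event for i.i.d. generators with a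
   density), [pick] selects one of them. *)
Definition cell_at n (y : 'I_n -> d.-tuple R) x : set (d.-tuple R) :=
  if [pick i | x \in voronoi_cell y i] is Some i then voronoi_cell y i
  else set0.

End euclidean.

Section probability.
Context {R : realType}.

Definition mutually_independent dO (O : measurableType dO)
    (P : probability O R) dT (T : measurableType dT) (I : finType)
    (X : I -> {RV P >-> T}) :=
  forall (J : {set I}) (A : I -> set T), (forall i, measurable (A i)) ->
    P (\bigcap_(i in [set` J]) X i @^-1` A i) =
    (\prod_(i in J) P (X i @^-1` A i))%E.

Definition has_density dO (O : measurableType dO) (P : probability O R)
    d (f : d.-tuple R -> R) (X : {RV P >-> d.-tuple R}) :=
  forall A, measurable A ->
    distribution P X A = (\int[lebesgue d]_(u in A) (f u)%:E)%E.

Definition iid_density dO (O : measurableType dO) (P : probability O R)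
    d (f : d.-tuple R -> R) n (X : 'I_n -> {RV P >-> d.-tuple R}) :=
  mutually_independent X /\ forall i, has_density f (X i).

(* Convergence of the distribution functions at the continuity points of the
   limit. The Y_n are extended real since an unbounded Voronoi cell has
   infinite volume; each Y_n may live on its own probability space. *)
Definition cvg_in_distribution (dO : nat -> measure_display)
    (O : forall n, measurableType (dO n)) (P : forall n, probability (O n) R)
    (Y : forall n, O n -> \bar R)
    dQ (O' : measurableType dQ) (Q : probability O' R) (Z : {RV Q >-> R}) :=
  forall t : R, {for t, continuous (cdf Z)} ->
    P n [set w | (Y n w <= t%:E)%E] @[n --> \oo] --> cdf Z t.

End probability.

(* Main.v *)
(** Let [r] be such that [n f(x) lambda(B(x, r)) = c], and let [T] be [c] times
    the fraction of [B(x, r)] covered by the cell containing [x], set to [0] if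
    the nucleus is outside [B(x, r)]. The [k]-th moment of [T] is an integral,
    over the nucleus and [k] independent uniform points of [B(x, r)], of the
    probability that no other data point is closer to [x] or to one of the [k]
    points than the nucleus is. Since [x] is a Lebesgue point, it converges as
    [n] grows to the corresponding void probability [exp (- c |A|)] of a Poisson
    process, where [A] is a union of balls of normalized volume [|A|]. As [c]
    grows this tends to [E ((k+1)! / D_k^(k+1))]: one splits according to which
    of the [k + 1] points is farthest from [x], moves that one to [e1] by a
    similarity, and integrates over its distance to [x]. The case of the nucleus
    is [W = 0], the other [k] cases are alike and make up [W = 1].

    The limit moments are at most [(k+1)! (2^d)^(k+1)], so they determine the
    law. Moment convergence yields [E (T^j exp (- s T))] for small [s] by a
    Taylor expansion, then for all [s] step by step, then [E (phi (exp (- s T)))]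
    for Lipschitz [phi] by Bernstein polynomials, and the distribution functions
    by taking ramps for [phi].

    Finally, [T = n f(x) lambda(L_n(x))] as soon as finitely many small balls,
    centered at [x] and at a net of the sphere of radius [r], all contain a data
    point. The limit as [n] grows of the probability that one of them is empty
    tends to [0] as [c] grows, so the convergence is taken first in [n] and then
    in [c]. *)
Require Import Defs.
From HB Require Import structures.
From mathcomp Require Import all_boot all_order all_algebra.
From mathcomp Require Import all_classical all_reals all_analysis.
From mathcomp Require Import measurable_realfun perm.
From mathcomp Require Import ring lra.
(* The libraries have another [edist]. *)
Import Defs.

Set Implicit Arguments.
Unset Strict Implicit.
Unset Printing Implicit Defensive.

Import Order.TTheory GRing.Theory Num.Theory.
Import numFieldNormedType.Exports.

Local Open Scope classical_set_scope.
Local Open Scope ring_scope.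

(** * Finite product measures *)

Section tuple_product_theory.
Context {dT} {T : measurableType dT} {R : realType}.
Local Open Scope ereal_scope.

(** The cell can be unbounded, so the moments of its volume can be infinite. This is why moments are
    computed for [T], which lies between 0 and [c]. Requiring the nucleus in [B(x, r)] keeps every
    region in the moment integrals inside a ball of radius proportional to [r], the scale at which
    the Lebesgue point controls the density. Rescaled by [r], these regions do not depend on [n],
    which enters only through the measure of shrinking sets.

    The price is a double limit without rates. It is packed into a filter on pairs, and the method
    of moments is proved for an arbitrary filter, so that no diagonal sequence is built.

    The bound [(k+1)! C^(k+1)] makes the exponential series converge for small [s] only, hence the
    steps. A step multiplies by [exp (- h z)] with a fixed [h]: the factors already present are at
    most 1 on the half-line, so they do not enlarge the Taylor remainder and the same [h] serves
    again. The constant [C = 2^d] comes from [D_k >= 2^(-d)]: the nucleus cannot be closer than 1/2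
    to both the origin and [e1]. *)

Definition tuple_box n (A : 'I_n -> set T) : set (n.-tuple T) :=
  [set t | forall i, A i (tnth t i)].

Lemma measurable_tuple_box n (A : 'I_n -> set T) :
  (forall i, measurable (A i)) -> measurable (tuple_box A).
Proof. exact: measurable_box. Qed.

Lemma measurable_preimage d1 d2 (T1 : measurableType d1)
    (T2 : measurableType d2) (g : T1 -> T2) (A : set T2) :
  measurable_fun setT g -> measurable A -> measurable (g @^-1` A).
Proof. by move=> mg mA; rewrite -[X in measurable X]setTI; exact: mg. Qed.

Lemma tuple_box_tcons n (A : 'I_n.+1 -> set T) a t :
  tuple_box A (tcons (a, t)) <->
  A ord0 a /\ tuple_box (fun i => A (lift ord0 i)) t.
Proof.
split=> [At|[Aa At] i].
  split; first exact: (At ord0).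
  by move=> i; move: (At (lift ord0 i)); rewrite tnthS.
by case: (unliftP ord0 i) => [j|] -> //; rewrite tnthS; exact: At.
Qed.

Lemma measurable_fun_tcons d1 (T1 : measurableType d1) n (f : T1 -> T)
    (g : T1 -> n.-tuple T) :
  measurable_fun setT f -> measurable_fun setT g ->
  measurable_fun setT (fun x => tcons (f x, g x)).
Proof. by move=> mf mg; exact: measurable_cons. Qed.

Section tonelli.
Variable m : {sigma_finite_measure set T -> \bar R}.

Lemma ge0_integral_tuple_productS n (g : n.+1.-tuple T -> \bar R) :
  measurable_fun setT g -> (forall t, 0 <= g t) ->
  \int[tuple_product m n.+1]_t g t =
  \int[m]_a \int[tuple_product m n]_t g (tcons (a, t)).
Proof.
move=> mg g0.
rewrite [LHS](@ge0_integral_pushforward _ _ _ _ R _ (@measurable_tcons _ T n))//.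
rewrite preimage_setT fubini_tonelli1//=.
by apply: measurableT_comp => //; exact: measurable_tcons.
Qed.

Lemma measurable_tuple_productS n (g : n.+1.-tuple T -> \bar R) :
  measurable_fun setT g -> (forall t, 0 <= g t) ->
  measurable_fun setT (fun a => \int[tuple_product m n]_t g (tcons (a, t))).
Proof.
move=> mg g0.
have mgt : measurable_fun setT (g \o @tcons _ T n).
  by apply: measurableT_comp => //; exact: measurable_tcons.
exact: (@measurable_fun_fubini_tonelli_F _ _ _ _ R (tuple_product m n) _ mgt
  (fun x => g0 _)).
Qed.

Lemma tuple_productT : m setT = 1 -> forall n, tuple_product m n setT = 1.
Proof.
move=> m1 n; have := @tuple_product_box _ T R m n (fun=> setT) (fun=> measurableT).
rewrite (_ : [set _ | _] = setT); last by apply/seteqP; split.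
by move=> ->; rewrite big1.
Qed.

End tonelli.

(** Boxes are stable under intersection, unlike the preimages under single coordinates that define
    this sigma-algebra. Uniqueness of measures requires such a generator. *)
Lemma measurable_tuple_generated n :
  (@measurable _ (n.-tuple T)) =
  <<s [set B | exists2 A : 'I_n -> set T,
         (forall i, measurable (A i)) & B = tuple_box A] >>.
Proof.
apply/seteqP; split; last first.
  apply: smallest_sub; first exact: sigma_algebra_measurable.
  by move=> _ [A mA ->]; exact: measurable_tuple_box.
rewrite {1}/measurable/=; apply: sub_smallest2r.
  exact: smallest_sigma_algebra.
case: n => [|n]; first by rewrite big_ord0.
rewrite -bigcup_mkord_ord => C [i iltn [A mA <-]].
exists (fun j => if j == inord i then A else setT).
  by move=> j; case: ifPn.
rewrite setTI; apply/seteqP; split => t /=.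
  by move=> At j; case: ifPn => // /eqP ->.
by move=> /(_ (inord i)); rewrite eqxx.
Qed.

Lemma tuple_product_unique (m : {sigma_finite_measure set T -> \bar R}) n
    (m' : {measure set (n.-tuple T) -> \bar R}) :
  m setT = 1 ->
  (forall A : 'I_n -> set T, (forall i, measurable (A i)) ->
     m' (tuple_box A) = \prod_(i < n) m (A i)) ->
  forall A, measurable A -> m' A = tuple_product m n A.
Proof.
move=> m1 m'E; have boxT : setT = @tuple_box n (fun=> setT).
  by apply/seteqP; split.
(* Total mass 1 makes the whole space a box of finite mass, so a constant sequence exhausts it. *)
apply: (measure_unique _ (fun=> setT) (measurable_tuple_generated n)).
- move=> _ _ [A mA ->] [B mB ->]; exists (fun i => A i `&` B i).
    by move=> i; exact: measurableI.
  apply/seteqP; split => t /= => [[At Bt] i|ABt]; first by split.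
  by split => i; have [] := ABt i.
- by move=> i; exists (fun=> setT).
- by rewrite bigcup_const.
- by move=> _ [A mA ->]; rewrite m'E//; apply/esym; exact: tuple_product_box.
- by move=> k; rewrite boxT m'E// big1// ltry.
Qed.

Definition tuple_perm n (s : 'S_n) (t : n.-tuple T) : n.-tuple T :=
  [tuple tnth t (s i) | i < n].

Lemma measurable_tuple_perm n (s : 'S_n) :
  measurable_fun setT (@tuple_perm n s).
Proof.
apply/measurable_fun_tnthP => i; rewrite (_ : _ \o _ = fun t => tnth t (s i)).
  exact: measurable_tnth.
by apply/funext => t /=; rewrite tnth_mktuple.
Qed.

(** Serves to bring any chosen point of a sample to position 0. The permuted law agrees with the
    product on boxes because the factors commute. *)
Lemma ge0_integral_tuple_perm (m : {sigma_finite_measure set T -> \bar R}) n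
    (s : 'S_n) (g : n.-tuple T -> \bar R) :
  m setT = 1 -> measurable_fun setT g -> (forall t, 0 <= g t) ->
  \int[tuple_product m n]_t g (tuple_perm s t) = \int[tuple_product m n]_t g t.
Proof.
move=> m1 mg g0.
have ms := @measurable_tuple_perm n s.
pose phi : {mfun n.-tuple T >-> n.-tuple T} :=
  HB.pack (@tuple_perm n s) (isMeasurableFun.Build _ _ _ _ _ ms).
have := @ge0_integral_pushforward _ _ _ _ R _ ms (tuple_product m n) setT g
  measurableT mg (fun t _ => g0 t).
rewrite preimage_setT => <-; apply: eq_measure_integral => A mA _.
apply: (tuple_product_unique (m' := pushforward (tuple_product m n) phi)) => //.
move=> B mB.
transitivity (tuple_product m n (tuple_box (fun i => B ((s^-1)%g i)))).
  rewrite /= /pushforward; congr (tuple_product m n _).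
  apply/seteqP; split => t /= Bt i.
    by have := Bt ((s^-1)%g i); rewrite tnth_mktuple permKV.
  by have := Bt (s i); rewrite permK tnth_mktuple.
rewrite tuple_product_box//.
rewrite (reindex_inj (@perm_inj _ s)); apply: eq_bigr => i _.
by rewrite permK.
Qed.

Definition tuple_mapi n (phi : nat -> T -> T) (t : n.-tuple T) : n.-tuple T :=
  [tuple phi i (tnth t i) | i < n].

Lemma measurable_tuple_mapi n (phi : nat -> T -> T) :
  (forall i, measurable_fun setT (phi i)) ->
  measurable_fun setT (@tuple_mapi n phi).
Proof.
move=> mphi; apply/measurable_fun_tnthP => i.
rewrite (_ : _ \o _ = fun t => phi i (tnth t i)).
  by apply: measurableT_comp => //; exact: measurable_tnth.
by apply/funext => t /=; rewrite tnth_mktuple.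
Qed.

Lemma tuple_mapi_tcons n (phi : nat -> T -> T) a (t : n.-tuple T) :
  tuple_mapi phi (tcons (a, t)) =
  tcons (phi 0%N a, tuple_mapi (fun i => phi i.+1) t).
Proof.
apply: eq_from_tnth => i; rewrite tnth_mktuple.
case: (unliftP ord0 i) => [j|] -> //=.
by rewrite !tnthS tnth_mktuple.
Qed.

(** Change of variables one factor at a time, by Tonelli. It is used at two levels: with [T] the
    line, where [phi i] depends on [i] because it translates by a component of [x]; and with [T] the
    space of points, where one similarity acts on all points and [B] is a ball. *)
Lemma ge0_integral_tuple_mapi (m m' : {sigma_finite_measure set T -> \bar R})
    n (B : set T) (c : R) (phi : nat -> T -> T) (g : n.-tuple T -> \bar R) :
  measurable B -> (0 <= c)%R -> (forall i, measurable_fun setT (phi i)) ->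
  (forall i h, measurable_fun setT h -> (forall a, 0 <= h a) ->
     \int[m]_(a in B) h a = c%:E * \int[m']_a h (phi i a)) ->
  measurable_fun setT g -> (forall t, 0 <= g t) ->
  \int[tuple_product m n]_(t in tuple_box (fun=> B)) g t =
  (c ^+ n)%:E * \int[tuple_product m' n]_t g (tuple_mapi phi t).
Proof.
move=> mB c0; elim: n phi g => [|n IH] phi g mphi phiE mg g0.
  rewrite expr0 mul1e /= (_ : tuple_box _ = setT); last first.
    by apply/seteqP; split => // t _ [].
  apply: eq_integral => t _; congr g.
  by apply: eq_from_tnth => -[].
have mbox k : measurable (tuple_box (fun=> B) : set (k.-tuple T)).
  exact: measurable_tuple_box.
rewrite integral_mkcond [LHS]ge0_integral_tuple_productS; last 2 first.
- by apply/(measurable_restrictT g (mbox _)); exact: measurable_funTS.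
- by move=> t; rewrite patchE; case: ifPn.
transitivity (\int[m]_(a in B) ((c ^+ n)%:E *
    \int[tuple_product m' n]_t g (tcons (a,
      tuple_mapi (fun i => phi i.+1) t)))).
  rewrite [RHS]integral_mkcond; apply: eq_integral => a _.
  rewrite patchE; case: ifPn => Ba; last first.
    rewrite integral0_eq// => t _; rewrite patchE ifF//.
    apply: contraNF Ba => /set_mem/tuple_box_tcons[+ _].
    by rewrite inE.
  have mga : measurable_fun setT (fun t : n.-tuple T => g (tcons (a, t))).
    by apply: measurableT_comp => //; exact: measurable_fun_tcons.
  rewrite -(IH (fun i => phi i.+1) (fun t => g (tcons (a, t))))//; last first.
    by move=> i; exact: phiE.
  rewrite [RHS]integral_mkcond; apply: eq_integral => t _.
  rewrite !patchE; congr (if _ then _ else _).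
  apply/idP/idP => /set_mem.
    by move=> /tuple_box_tcons[_ Bt]; rewrite inE.
  by move=> Bt; rewrite inE; apply/tuple_box_tcons; split => //; exact: set_mem Ba.
pose G a := \int[tuple_product m' n]_t g (tcons (a,
  tuple_mapi (fun i => phi i.+1) t)).
have mG : measurable_fun setT G.
  have mt : measurable_fun setT (@tuple_mapi n (fun i => phi i.+1)).
    exact: (measurable_tuple_mapi (fun i => mphi i.+1)).
  have mt2 : measurable_fun setT
      (fun z : T * n.-tuple T => tuple_mapi (fun i => phi i.+1) z.2).
    exact: measurableT_comp.
  have mgt : measurable_fun setT
      (fun z : T * n.-tuple T =>
         g (tcons (z.1, tuple_mapi (fun i => phi i.+1) z.2))).
    by apply: measurableT_comp => //; exact: measurable_fun_tcons.
  exact: (@measurable_fun_fubini_tonelli_F _ _ _ _ R (tuple_product m' n) _ mgt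
    (fun x => g0 _)).
have G0 a : 0 <= G a by apply: integral_ge0.
have -> : \int[m]_(a in B) ((c ^+ n)%:E * G a) =
    (c ^+ n)%:E * \int[m]_(a in B) G a.
  apply: ge0_integralZl => //; first exact: measurable_funTS.
  by rewrite lee_fin exprn_ge0.
rewrite (phiE 0%N)//; rewrite muleA -EFinM exprSr; congr (_ * _).
have mgp : measurable_fun setT (fun t : n.+1.-tuple T => g (tuple_mapi phi t)).
  by apply: measurableT_comp => //; apply: measurable_tuple_mapi.
rewrite [RHS](ge0_integral_tuple_productS m' mgp (fun t => g0 _)).
apply: eq_integral => a _; apply: eq_integral => t _.
by rewrite tuple_mapi_tcons.
Qed.

End tuple_product_theory.

(** * Integration against a measure with a density *)

Section density_integral.
Context {d} {T : measurableType d} {R : realType}.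
Variables (m nu : {measure set T -> \bar R}).
Local Open Scope ereal_scope.
Import HBNNSimple.

Lemma ge0_integral_density (f : T -> R) (g : T -> \bar R) :
  measurable_fun setT f -> (forall u, (0 <= f u)%R) ->
  (forall A, measurable A -> nu A = \int[m]_(u in A) (f u)%:E) ->
  measurable_fun setT g -> (forall u, 0 <= g u) ->
  \int[nu]_u g u = \int[m]_u (g u * (f u)%:E).
Proof.
move=> mf f0 nuE mg g0.
have mfE : measurable_fun setT (EFin \o f) by exact/measurable_EFinP.
pose h := nnsfun_approx measurableT mg.
have hg u : (EFin \o h ^~ u) @ \oo --> g u by exact: cvg_nnsfun_approx.
have nd_h u a b : (a <= b)%N -> (h a u <= h b u)%R.
  by move=> ab; exact/lefP/nd_nnsfun_approx.
transitivity (limn (fun n => \int[nu]_u (h n u)%:E)).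
  rewrite -monotone_convergence//.
  - by apply: eq_integral => u _; apply/esym/cvg_lim => //; exact: hg.
  - by move=> n; exact/measurable_EFinP.
  - by move=> n u _; rewrite lee_fin.
  - by move=> u _ a b ab; rewrite lee_fin nd_h.
transitivity (limn (fun n => \int[m]_u ((h n u)%:E * (f u)%:E))); last first.
  rewrite -monotone_convergence//.
  - apply: eq_integral => u _; apply/cvg_lim => //.
    by apply: cvgeZr => //; exact: hg.
  - by move=> n; apply: emeasurable_funM => //; exact/measurable_EFinP.
  - by move=> n u _; rewrite mule_ge0// lee_fin.
  - by move=> u _ a b ab; rewrite lee_wpmul2r ?lee_fin// nd_h.
congr (limn _); apply/funext => n.
pose I k : T -> \bar R := fun u => (k * \1_(h n @^-1` [set k]) u)%:E.
have hE u : (h n u)%:E = \sum_(k \in range (h n)) I k u.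
  by rewrite fsumEFin// -fimfunE.
have mI k : measurable_fun setT (I k).
  by apply/measurable_EFinP; exact: measurable_funM.
have I0 k u : 0 <= I k u by rewrite /I EFinM nnfun_muleindic_ge0.
under eq_integral do rewrite hE.
under [RHS]eq_integral do rewrite hE ge0_mule_fsuml//.
rewrite !ge0_integral_fsum//; last 2 first.
- by move=> k; exact: emeasurable_funM.
- by move=> k u _; rewrite mule_ge0// lee_fin.
apply: eq_fsbigr => k /[!inE] -[u _ <-].
rewrite integralZl_indic_nnsfun// integral_indic// setIT nuE//.
rewrite integral_mkcond -ge0_integralZl//; last 3 first.
- apply/(measurable_restrictT (EFin \o f) (measurable_sfunP (h n) (measurable_set1 _))).
  exact: measurable_funTS.
- by move=> v _; rewrite patchE; case: ifPn => // _; rewrite lee_fin.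
- by rewrite lee_fin.
apply: eq_integral => v _; rewrite /I patchE indicE.
by case: ifPn => _; rewrite ?mulr1 ?mulr0 ?mule0 ?mul0e.
Qed.

End density_integral.

(** * Euclidean geometry *)

Section euclidean_geometry.
Context {R : realType} {d : nat}.
Implicit Types (u v w x y z : d.-tuple R) (r : R).

Definition sumsq (a : 'I_d -> R) : R := \sum_(i < d) a i ^+ 2.

Lemma sumsq_ge0 a : 0 <= sumsq a.
Proof. by apply: sumr_ge0 => i _; exact: sqr_ge0. Qed.

Lemma cauchy_schwarz (a b : 'I_d -> R) :
  (\sum_(i < d) a i * b i) ^+ 2 <= sumsq a * sumsq b.
Proof.
set A := sumsq a; set B := sumsq b; set C := \sum_(i < d) _.
(* This vector is [B] times the component of [a] orthogonal to [b]. Its squared norm factors through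
   [A * B - C ^+ 2]. *)
have : 0 <= sumsq (fun i => B * a i - C * b i) by exact: sumsq_ge0.
have -> : sumsq (fun i => B * a i - C * b i) = B * (A * B - C ^+ 2).
  rewrite /sumsq (eq_bigr (fun i => B ^+ 2 * a i ^+ 2 +
    (- (2 * B * C) * (a i * b i) + C ^+ 2 * b i ^+ 2))); last first.
    by move=> i _; ring.
  rewrite !big_split/= -!mulr_sumr -/(sumsq a) -/(sumsq b) -/A -/B -/C.
  by ring.
have : 0 <= B by exact: sumsq_ge0.
rewrite le_eqVlt => /predU1P[B0 _|B0]; last first.
  by rewrite pmulr_rge0// subr_ge0.
have b0 i : b i = 0.
  apply/eqP; rewrite -sqrf_eq0; apply/eqP.
  apply/(psumr_eq0P (P := xpredT) (F := fun i => b i ^+ 2)) => //.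
  by move=> j _; exact: sqr_ge0.
rewrite /C big1 ?expr0n/= -?B0 ?mulr0// => i _.
by rewrite b0 mulr0.
Qed.

Lemma edist_ge0 x y : 0 <= edist x y.
Proof. exact: sqrtr_ge0. Qed.

Lemma edistC x y : edist x y = edist y x.
Proof.
by congr Num.sqrt; apply: eq_bigr => i _; rewrite -sqrrN opprB.
Qed.

Lemma edistxx x : edist x x = 0.
Proof.
by rewrite /edist big1 ?sqrtr0// => i _; rewrite subrr expr0n.
Qed.

Lemma sqr_edist x y : edist x y ^+ 2 = sumsq (fun i => tnth x i - tnth y i).
Proof. by rewrite sqr_sqrtr// sumsq_ge0. Qed.

Lemma edist_triangle x y z : edist x z <= edist x y + edist y z.
Proof.
rewrite -(@ler_pXn2r _ 2)// ?nnegrE ?addr_ge0 ?edist_ge0//.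
rewrite sqrrD !sqr_edist.
set a := fun i => tnth x i - tnth y i; set b := fun i => tnth y i - tnth z i.
have -> : sumsq (fun i => tnth x i - tnth z i) =
    sumsq a + (\sum_(i < d) a i * b i) *+ 2 + sumsq b.
  rewrite /sumsq -sumrMnl -!big_split/=; apply: eq_bigr => i _.
  by rewrite /a /b; ring.
rewrite lerD2r lerD2l ler_wMn2r// (le_trans (ler_norm _))//.
rewrite -(@ler_pXn2r _ 2)// ?nnegrE ?mulr_ge0 ?edist_ge0//.
rewrite exprMn !sqr_edist real_normK ?num_real//; exact: cauchy_schwarz.
Qed.

Definition aff x r u : d.-tuple R := [tuple tnth x i + r * tnth u i | i < d].

Definition tdot u v : R := \sum_(i < d) tnth u i * tnth v i.

(* The reflection in the hyperplane orthogonal to [w]; the identity for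
   [w = 0], where the quotient is [0]. *)
Definition householder w u : d.-tuple R :=
  [tuple tnth u i - 2 * tdot u w / tdot w w * tnth w i | i < d].

Definition sim x r w u := aff x r (householder w u).

Lemma tnth_aff x r u i : tnth (aff x r u) i = tnth x i + r * tnth u i.
Proof. by rewrite tnth_mktuple. Qed.

Lemma edist_aff x r u v : 0 <= r ->
  edist (aff x r u) (aff x r v) = r * edist u v.
Proof.
move=> r0; rewrite /edist -[X in X * _](ger0_norm r0) -sqrtr_sqr -sqrtrM ?sqr_ge0//.
rewrite mulr_sumr; congr Num.sqrt; apply: eq_bigr => i _.
by rewrite !tnth_aff; ring.
Qed.

Lemma aff_origin x r : aff x r (@origin R d) = x.
Proof.
by apply: eq_from_tnth => i; rewrite tnth_aff tnth_mktuple mulr0 addr0.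
Qed.

Lemma affK x r u : r != 0 ->
  aff x r (aff (aff (@origin R d) (- r^-1) x) r^-1 u) = u.
Proof.
by move=> r0; apply: eq_from_tnth => i; rewrite !tnth_aff tnth_mktuple; field.
Qed.

Lemma edist_householder w u v :
  edist (householder w u) (householder w v) = edist u v.
Proof.
rewrite /edist; congr Num.sqrt.
pose a i := tnth u i - tnth v i.
pose c := tdot u w - tdot v w.
have cE : c = \sum_(i < d) a i * tnth w i.
  by rewrite /c /tdot -sumrB; apply: eq_bigr => i _; rewrite mulrBl.
have [w0|w0] := eqVneq (tdot w w) 0.
  by apply: eq_bigr => i _; rewrite !tnth_mktuple w0 invr0; ring.
transitivity (\sum_(i < d) (a i ^+ 2 + (- (4 * c / tdot w w) *
    (a i * tnth w i) + 4 * c ^+ 2 / tdot w w ^+ 2 * (tnth w i * tnth w i)))).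
  apply: eq_bigr => i _; rewrite !tnth_mktuple /a /c; field.
  exact: w0.
rewrite !big_split/= -!mulr_sumr -cE -/(tdot w w).
rewrite [X in _ + X](_ : _ = 0) ?addr0//.
by field; exact: w0.
Qed.

Lemma tdot_householder w u : tdot (householder w u) w = - tdot u w.
Proof.
rewrite {1}/tdot (eq_bigr (fun i => tnth u i * tnth w i -
    2 * tdot u w / tdot w w * (tnth w i * tnth w i))); last first.
  by move=> i _; rewrite tnth_mktuple; ring.
rewrite sumrB -mulr_sumr -/(tdot u w) -/(tdot w w).
have [w0|w0] := eqVneq (tdot w w) 0; last by field.
rewrite w0 invr0 !(mulr0, mul0r) subr0.
have wz i : tnth w i = 0.
  apply/eqP; rewrite -sqrf_eq0; apply/eqP.
  apply/(psumr_eq0P (P := xpredT) (F := fun i => tnth w i ^+ 2)) => //.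
  by move=> j _; exact: sqr_ge0.
by rewrite /tdot big1 ?oppr0// => i _; rewrite wz mulr0.
Qed.

Lemma householderK w : involutive (householder w).
Proof.
move=> u; apply: eq_from_tnth => i.
by rewrite tnth_mktuple tdot_householder tnth_mktuple; ring.
Qed.

(** With factor 1, [aff] is vector addition, and with center the origin it is scaling. This lemma
    and the next are thus the linearity of the reflection. *)
Lemma householder_aff w u v :
  householder w (aff u 1 v) = aff (householder w u) 1 (householder w v).
Proof.
apply: eq_from_tnth => i; rewrite !tnth_mktuple /tdot.
have -> : \sum_(j < d) tnth (aff u 1 v) j * tnth w j = tdot u w + tdot v w.
  by rewrite /tdot -big_split/=; apply: eq_bigr => j _; rewrite tnth_aff; ring.
by rewrite /tdot; ring.
Qed.

Lemma householder_scale w r u :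
  householder w (aff (@origin R d) r u) = aff (@origin R d) r (householder w u).
Proof.
apply: eq_from_tnth => i; rewrite !tnth_mktuple.
have -> : tdot (aff (@origin R d) r u) w = r * tdot u w.
  rewrite /tdot mulr_sumr; apply: eq_bigr => j _.
  by rewrite tnth_aff tnth_mktuple; ring.
by ring.
Qed.

Lemma householder_origin w : householder w (@origin R d) = @origin R d.
Proof.
apply: eq_from_tnth => i; rewrite !tnth_mktuple /tdot big1; first by ring.
by move=> j _; rewrite tnth_mktuple mul0r.
Qed.

Lemma edist_sim x r w u v : 0 <= r ->
  edist (sim x r w u) (sim x r w v) = r * edist u v.
Proof. by move=> r0; rewrite edist_aff// edist_householder. Qed.

Lemma sim_origin x r w : sim x r w (@origin R d) = x.
Proof. by rewrite /sim householder_origin aff_origin. Qed.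

Lemma sim0 x r u : sim x r (@origin R d) u = aff x r u.
Proof.
congr aff; apply: eq_from_tnth => i; rewrite !tnth_mktuple.
by rewrite mulr0 subr0.
Qed.

Lemma edist_e1 : (0 < d)%N -> edist (@origin R d) (@e1 R d) = 1.
Proof.
move=> d0; rewrite /edist (bigD1 (Ordinal d0))//= big1 => [|i].
  by rewrite !tnth_mktuple/= sub0r sqrrN addr0 expr1n sqrtr1.
rewrite !tnth_mktuple -val_eqE/= => /negbTE ->.
by rewrite subr0 expr0n.
Qed.

(* [|w|^2 = 2 <e1, w>] for [w = e1 - q/|q|], because both are unit vectors. *)
Lemma sim_e1 (q : d.-tuple R) : (0 < d)%N -> edist (@origin R d) q != 0 ->
  exists w, sim (@origin R d) (edist (@origin R d) q) w (@e1 R d) = q.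
Proof.
move=> d0; set r := edist _ _ => r0.
pose w := aff (@e1 R d) (- r^-1) q; exists w.
have ww : tdot w w = 2 * tdot (@e1 R d) w.
  have e11 : \sum_(i < d) tnth (@e1 R d) i ^+ 2 = 1.
    have := sqr_edist (@origin R d) (@e1 R d); rewrite edist_e1// expr1n => ->.
    by apply: eq_bigr => i _; rewrite tnth_mktuple [in RHS]tnth_mktuple; ring.
  have qq : \sum_(i < d) tnth q i ^+ 2 = r ^+ 2.
    by rewrite sqr_edist; apply: eq_bigr => i _; rewrite tnth_mktuple; ring.
  transitivity (\sum_(i < d) (2 * (tnth (@e1 R d) i * tnth w i) +
      (- (tnth (@e1 R d) i ^+ 2) + r ^- 2 * tnth q i ^+ 2))).
    by apply: eq_bigr => i _; rewrite /w tnth_aff; field.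
  rewrite !big_split/= -!mulr_sumr sumrN e11 qq -/(tdot _ _).
  by field.
apply: eq_from_tnth => i; rewrite tnth_aff tnth_mktuple add0r tnth_mktuple.
(* [w = 0] when [q] is already a positive multiple of [e1]; the reflection is then the identity. *)
have [w0|w0] := eqVneq (tdot w w) 0; last first.
  rewrite -ww divff// mul1r /w tnth_aff; field.
  exact: r0.
have wz : tnth w i = 0.
  apply/eqP; rewrite -sqrf_eq0; apply/eqP.
  apply/(psumr_eq0P (P := xpredT) (F := fun i => tnth w i ^+ 2)) => //.
  by move=> j _; exact: sqr_ge0.
rewrite wz mulr0 subr0.
move: wz; rewrite /w tnth_aff => /eqP; rewrite addr_eq0 => /eqP ->.
by field.
Qed.

Lemma measurable_edist2 d1 (T : measurableType d1) (f g : T -> d.-tuple R) :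
  measurable_fun setT f -> measurable_fun setT g ->
  measurable_fun setT (fun t => edist (f t) (g t)).
Proof.
move=> mf mg.
have msqrt : measurable_fun [set: R] (@Num.sqrt R).
  by apply: continuous_measurable_fun; exact: sqrt_continuous.
apply: (measurableT_comp msqrt).
apply: (@measurable_sum _ _ _ setT _ _
  (fun i t => (tnth (f t) i - tnth (g t) i) ^+ 2)) => i.
apply: measurable_funX; apply: measurable_funB.
- exact: (measurableT_comp (measurable_tnth i)).
- exact: (measurableT_comp (measurable_tnth i)).
Qed.

Lemma measurable_aff x r : measurable_fun setT (aff x r).
Proof.
apply/measurable_fun_tnthP => i.
rewrite (_ : _ \o _ = fun u => tnth x i + r * tnth u i).
  apply: measurable_funD => //; apply: measurable_funM => //.
  exact: measurable_tnth.
by apply/funext => u /=; rewrite tnth_aff.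
Qed.

Lemma measurable_aff2 d1 (T : measurableType d1) (f g : T -> d.-tuple R) r :
  measurable_fun setT f -> measurable_fun setT g ->
  measurable_fun setT (fun t => aff (f t) r (g t)).
Proof.
move=> mf mg; apply/measurable_fun_tnthP => i.
rewrite (_ : _ \o _ = fun t => tnth (f t) i + r * tnth (g t) i).
  apply: measurable_funD; last apply: measurable_funM => //.
  - exact: (measurableT_comp (measurable_tnth i)).
  - exact: (measurableT_comp (measurable_tnth i)).
by apply/funext => u /=; rewrite tnth_aff.
Qed.

Lemma measurable_householder w : measurable_fun setT (householder w).
Proof.
apply/measurable_fun_tnthP => i.
rewrite (_ : _ \o _ =
    fun u => tnth u i - 2 * tdot u w / tdot w w * tnth w i).
  apply: measurable_funB; first exact: measurable_tnth.
  do 3 (apply: measurable_funM => //).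
  apply: (@measurable_sum _ _ _ setT _ _
    (fun i u => tnth u i * tnth w i)) => j.
  by apply: measurable_funM => //; exact: measurable_tnth.
by apply/funext => u /=; rewrite tnth_mktuple.
Qed.

Lemma measurable_sim x r w : measurable_fun setT (sim x r w).
Proof.
exact: (measurableT_comp (measurable_aff x r) (measurable_householder w)).
Qed.

End euclidean_geometry.

(** * Lebesgue measure and similarities *)

Section lebesgue_affine1.
Context {R : realType}.
Local Open Scope ereal_scope.

Lemma lebesgueR_affine (b r : R) (A : set R) : (0 < r)%R -> measurable A ->
  lebesgueR A = r%:E * lebesgueR ((fun a => b + r * a)%R @^-1` A).
Proof.
move=> r0 mA.
pose phi : measurableTypeR R -> measurableTypeR R := fun a => (b + r * a)%R.
have mphi : measurable_fun setT phi.
  have : measurable_fun [set: R] (fun a => b + r * a)%R.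
    by apply: measurable_funD => //; exact: measurable_funM.
  by [].
pose phi' : {mfun measurableTypeR R >-> measurableTypeR R} :=
  HB.pack phi (isMeasurableFun.Build _ _ _ _ _ mphi).
apply: (lebesgue_measure_unique (mu := mscale (NngNum (ltW r0))
  (pushforward (@lebesgue_measure R) phi'))) => // _ [[a c]] _ <-.
transitivity (r%:E * lebesgue_measure (phi @^-1` `]a, c]%classic)); last by [].
rewrite (_ : _ @^-1` _ = `]((a - b) / r)%R, ((c - b) / r)%R]%classic);
    last first.
  by apply/seteqP; split => t; rewrite /= !in_itv/= /phi ltr_pdivrMr//
    ler_pdivlMr// ltrBlDl lerBrDl (mulrC t).
rewrite !lebesgue_measure_itv/= !lte_fin ltr_pM2r ?invr_gt0// ltrD2r.
case: ifPn => _; last by rewrite mule0.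
by rewrite -!EFinB -EFinM; congr EFin; field; rewrite gt_eqF.
Qed.

Lemma ge0_integral_lebesgueR_affine (b r : R) (h : R -> \bar R) : (0 < r)%R ->
  measurable_fun setT h -> (forall a, 0 <= h a) ->
  \int[lebesgueR]_a h a = r%:E * \int[lebesgueR]_a h (b + r * a)%R.
Proof.
move=> r0 mh h0.
pose phi := fun a : R => (b + r * a)%R.
have mphi : measurable_fun setT phi.
  by apply: measurable_funD => //; exact: measurable_funM.
have := ge0_integral_pushforward mphi lebesgueR measurableT mh (fun a _ => h0 a).
rewrite preimage_setT => <-.
pose pm : {measure set R -> \bar R} :=
  pushforward (lebesgueR : {measure set R -> \bar R}) phi.
transitivity (\int[mscale (NngNum (ltW r0)) (pm mphi)]_a h a).
  by apply: eq_measure_integral => A mA _; exact: lebesgueR_affine.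
by rewrite ge0_integral_mscale.
Qed.

End lebesgue_affine1.

Section lebesgue_similarity.
Context {R : realType} {d : nat}.
Implicit Types (u v w x y z : d.-tuple R) (r : R) (A : set (d.-tuple R)).
Local Open Scope ereal_scope.

Notation lambda := (lebesgue d).
Notation o := (@origin R d).

Lemma pmuleI (r : R) : (0 < r)%R -> injective (fun a : \bar R => r%:E * a).
Proof.
move=> r0 a b /(congr1 (mule r^-1%:E)).
by rewrite !muleA -EFinM mulVf ?gt_eqF// !mul1e.
Qed.

Lemma affE x r u : aff x r u = tuple_mapi (fun i a => nth 0 x i + r * a)%R u.
Proof.
by apply: eq_from_tnth => i; rewrite !tnth_mktuple -tnth_nth.
Qed.

Lemma ge0_integral_lebesgue_aff x r (g : d.-tuple R -> \bar R) : (0 < r)%R ->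
  measurable_fun setT g -> (forall u, 0 <= g u) ->
  \int[lambda]_u g u = (r ^+ d)%:E * \int[lambda]_u g (aff x r u).
Proof.
move=> r0 mg g0.
have := @ge0_integral_tuple_mapi _ _ R lebesgueR lebesgueR d setT r
  (fun i a => nth 0 x i + r * a)%R g measurableT (ltW r0).
rewrite (_ : tuple_box _ = setT); last by apply/seteqP; split.
move=> ->//.
- by congr (_ * _); apply: eq_integral => u _; rewrite affE.
- by move=> i; apply: measurable_funD => //; exact: measurable_funM.
- by move=> i h mh h0; exact: ge0_integral_lebesgueR_affine.
Qed.

Lemma indic_preimage T1 T2 (phi : T1 -> T2) (A : set T2) t :
  \1_A (phi t) = \1_(phi @^-1` A) t :> R.
Proof. by []. Qed.

Lemma eq_indic T1 T2 (A : set T1) (B : set T2) t s :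
  (A t <-> B s) -> \1_A t = \1_B s :> R.
Proof.
move=> AB; rewrite !indicE; congr (nat_of_bool _)%:R.
by apply/idP/idP => /set_mem/AB; rewrite inE.
Qed.

Lemma lebesgue_aff x r A : (0 < r)%R -> measurable A ->
  lambda A = (r ^+ d)%:E * lambda (aff x r @^-1` A).
Proof.
move=> r0 mA.
have := @ge0_integral_lebesgue_aff x r (EFin \o \1_A) r0.
rewrite /= integral_indic// setIT => ->.
- under eq_integral do rewrite indic_preimage.
  rewrite integral_indic// ?setIT//; apply: measurable_preimage => //.
  exact: measurable_aff.
- by apply/measurable_EFinP; exact: measurable_indic.
- by move=> u; rewrite lee_fin.
Qed.

Lemma preimage_aff_ball x r y s : (0 < r)%R ->
  aff x r @^-1` eball (aff x r y) (r * s) = eball y s.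
Proof.
move=> r0; apply/seteqP; split => u; rewrite /eball/= edist_aff ?ltW//.
  by rewrite ltr_pM2l.
by rewrite ltr_pM2l.
Qed.

Definition ball_vol : R := fine (lambda (eball o 1)).

Lemma ball_vol_gt0 : (0 < ball_vol)%R.
Proof.
have /andP[B0 Boo] := @lebesgue_unit_ball R d.
by rewrite fine_gt0// B0.
Qed.

Lemma lebesgue_ball1 x : lambda (eball x 1) = ball_vol%:E.
Proof.
have /andP[B0 Boo] := @lebesgue_unit_ball R d.
rewrite fineK ?ge0_fin_numE//.
rewrite (lebesgue_aff x (@ltr01 R)); last exact: measurable_eball.
rewrite expr1n mul1e; congr (lambda _).
by rewrite -(preimage_aff_ball x o 1 (@ltr01 R)) mul1r aff_origin.
Qed.

Lemma lebesgue_ball x r : (0 < r)%R ->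
  lambda (eball x r) = (ball_vol * r ^+ d)%:E.
Proof.
move=> r0; rewrite (lebesgue_aff x r0); last exact: measurable_eball.
have := preimage_aff_ball x o 1 r0; rewrite mulr1 aff_origin => ->.
by rewrite lebesgue_ball1 mulrC EFinM.
Qed.

(* The isometry [L := householder w] satisfies [L (L u) = u], so Tonelli and
   translation invariance give [lambda A * lambda B = lambda (L @^-1` A) *
   lambda B] with [B] the unit ball, through the integral of the indicator of
   [{(u, v) | v \in B /\ u + L v \in A}]. *)
Lemma lebesgue_householder w A : measurable A ->
  lambda (householder w @^-1` A) = lambda A.
Proof.
move=> mA; set L := householder w; set B := eball o 1.
have mL : measurable_fun setT L by exact: measurable_householder.
have mLA : measurable (L @^-1` A) by exact: measurable_preimage.
have mB v s : measurable (@eball R d v s) by exact: measurable_eball.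
pose E1 := [set p : d.-tuple R * d.-tuple R |
  (edist o p.2 < 1)%R /\ A (aff (L p.2) 1 p.1)].
pose E2 := [set p : d.-tuple R * d.-tuple R |
  (edist (L p.2) p.1 < 1)%R /\ A (L p.2)].
have mL2 : measurable_fun setT (fun p : d.-tuple R * d.-tuple R => L p.2).
  exact: measurableT_comp.
have mlt (g : d.-tuple R * d.-tuple R -> R) : measurable_fun setT g ->
    measurable [set p | (g p < 1)%R].
  move=> mg; rewrite (_ : [set _ | _] = g @^-1` `]-oo, 1%R[%classic).
    exact: measurable_preimage.
  by apply/seteqP; split => p; rewrite /= in_itv.
have mE1 : measurable E1.
  apply: measurableI; first by apply: mlt; exact: measurable_edist2.
  apply: (@measurable_preimage _ _ _ _ (fun p => aff (L p.2) 1 p.1)) => //.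
  exact: measurable_aff2.
have mE2 : measurable E2.
  apply: measurableI; first by apply: mlt; exact: measurable_edist2.
  exact: (@measurable_preimage _ _ _ _ (fun p => L p.2)).
have mx (E : set (d.-tuple R * d.-tuple R)) u : measurable E ->
    measurable_fun setT (fun v => (\1_E (u, v))%:E : \bar R).
  move=> mE; apply/measurable_EFinP.
  by apply: (measurableT_comp (measurable_indic mE)).
have my (E : set (d.-tuple R * d.-tuple R)) v : measurable E ->
    measurable_fun setT (fun u => (\1_E (u, v))%:E : \bar R).
  move=> mE; apply/measurable_EFinP.
  by apply: (measurableT_comp (measurable_indic mE)).
have mi (E : set (d.-tuple R * d.-tuple R)) : measurable E ->
    measurable_fun setT (fun p => (\1_E p)%:E : \bar R).
  by move=> mE; apply/measurable_EFinP; exact: measurable_indic.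
have : \int[lambda]_u \int[lambda]_v (\1_E1 (u, v))%:E =
       \int[lambda]_u \int[lambda]_v (\1_E2 (u, v))%:E.
  apply: eq_integral => u _.
  (* Translating [v] by [- L u] turns [u + L v] into [L v], and, [L] being an isometry, [|v - L u|]
     into [|L v - u|]. *)
  rewrite (@ge0_integral_lebesgue_aff (aff o (-1) (L u)) 1)//; last exact: mx.
  rewrite expr1n mul1e; apply: eq_integral => v _; congr EFin; apply: eq_indic.
  have e1 : aff (L (aff (aff o (-1) (L u)) 1 v)) 1 u = L v.
    rewrite /L householder_aff householder_scale householderK.
    by apply: eq_from_tnth => i; rewrite !tnth_aff !tnth_mktuple; ring.
  have e2 : edist o (aff (aff o (-1) (L u)) 1 v) = edist (L v) u.
    rewrite -[u in RHS](householderK w) edist_householder edistC.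
    rewrite /edist; congr Num.sqrt; apply: eq_bigr => i _.
    by rewrite !tnth_aff !tnth_mktuple; ring.
  by rewrite /E1 /E2/= e1 e2.
rewrite (fubini_tonelli (fun p => (\1_E1 p)%:E)); last 2 first.
- exact: mi.
- by move=> p; rewrite lee_fin.
rewrite (fubini_tonelli (fun p => (\1_E2 p)%:E)); last 2 first.
- exact: mi.
- by move=> p; rewrite lee_fin.
have -> : \int[lambda]_v \int[lambda]_u (\1_E1 (u, v))%:E =
    \int[lambda]_v (lambda A * (\1_B v)%:E).
  apply: eq_integral => v _; rewrite indicE.
  case: (boolP (v \in B)) => [vB|vB]; last first.
    rewrite mule0 integral0_eq// => u _; rewrite indicE memNset// => -[vB1 _].
    by move: vB; rewrite notin_setE; exact.
  rewrite mule1 (lebesgue_aff (L v) (@ltr01 R) mA) expr1n mul1e.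
  transitivity (\int[lambda]_u (\1_(aff (L v) 1 @^-1` A) u)%:E).
    apply: eq_integral => u _; congr EFin; apply: eq_indic.
    by split => [[]|] //; split => //; move/set_mem : vB.
  rewrite integral_indic ?setIT//.
  by apply: measurable_preimage => //; exact: measurable_aff.
have -> : \int[lambda]_v \int[lambda]_u (\1_E2 (u, v))%:E =
    \int[lambda]_v (ball_vol%:E * (\1_(L @^-1` A) v)%:E).
  apply: eq_integral => v _; rewrite indicE.
  case: (boolP (v \in L @^-1` A)) => [vA|vA]; last first.
    rewrite mule0 integral0_eq// => u _; rewrite indicE memNset// => -[_ vA1].
    by move: vA; rewrite notin_setE; exact.
  rewrite mule1 -(lebesgue_ball1 (L v)).
  rewrite -[X in lambda X]setIT -integral_indic//.
  apply: eq_integral => u _; congr EFin; apply: eq_indic.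
  by split => [[]|] //; split => //; move/set_mem : vA.
have Zi (c : \bar R) (C : set (d.-tuple R)) : 0 <= c -> measurable C ->
    \int[lambda]_v (c * (\1_C v)%:E) = c * lambda C.
  move=> c0 mC; rewrite ge0_integralZl//.
  - by rewrite integral_indic// setIT.
  by apply/measurable_EFinP; exact: measurable_indic.
have V0 : 0 <= ball_vol%:E by rewrite lee_fin ltW// ball_vol_gt0.
rewrite (Zi _ _ (measure_ge0 _ _) (mB _ _)) (Zi _ _ V0 mLA).
rewrite /B lebesgue_ball1 muleC => /esym.
exact: (pmuleI ball_vol_gt0).
Qed.

Lemma ge0_integral_lebesgue_sim x r w (g : d.-tuple R -> \bar R) : (0 < r)%R ->
  measurable_fun setT g -> (forall u, 0 <= g u) ->
  \int[lambda]_u g u = (r ^+ d)%:E * \int[lambda]_u g (sim x r w u).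
Proof.
move=> r0 mg g0; rewrite (ge0_integral_lebesgue_aff x r0)//; congr (_ * _).
have mh := @measurable_householder R d w.
pose h' : {mfun d.-tuple R >-> d.-tuple R} :=
  HB.pack (householder w) (isMeasurableFun.Build _ _ _ _ _ mh).
have mga : measurable_fun setT (g \o aff x r).
  by apply: measurableT_comp => //; exact: measurable_aff.
have := ge0_integral_pushforward mh lambda measurableT mga (fun a _ => g0 _).
rewrite preimage_setT => <-.
apply: (eq_measure_integral (pushforward lambda h')) => A mA _.
by rewrite /= /pushforward lebesgue_householder.
Qed.

Lemma unif_ball_density A : measurable A ->
  unif_ball d A = \int[lambda]_(u in A) (ball_vol^-1 * \1_(eball o 1) u)%:E.
Proof.
move=> mA; rewrite unif_ballE.
under eq_integral do rewrite EFinM.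
rewrite ge0_integralZl//; last 2 first.
- apply/measurable_EFinP; apply: measurable_indic; exact: measurable_eball.
- by rewrite lee_fin invr_ge0 ltW// ball_vol_gt0.
rewrite integral_indic//; last exact: measurable_eball.
by rewrite -/ball_vol [LHS]muleC [in LHS]setIC.
Qed.

Lemma ge0_integral_unif_ball (g : d.-tuple R -> \bar R) :
  measurable_fun setT g -> (forall u, 0 <= g u) ->
  ball_vol%:E * \int[unif_ball d]_u g u = \int[lambda]_(u in eball o 1) g u.
Proof.
move=> mg g0; have V0 := ball_vol_gt0.
have mB : measurable (@eball R d o 1) by exact: measurable_eball.
rewrite (ge0_integral_density
  (f := fun u => (ball_vol^-1 * \1_(eball o 1) u)%R) _ _ unif_ball_density)//.
- rewrite -ge0_integralZl//; last 3 first.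
  + apply: emeasurable_funM => //; apply/measurable_EFinP.
    by apply: measurable_funM => //; exact: measurable_indic.
  + by move=> u _; rewrite mule_ge0// lee_fin mulr_ge0// invr_ge0 ltW.
  + by rewrite lee_fin ltW.
  rewrite [RHS]integral_mkcond; apply: eq_integral => u _.
  rewrite muleCA -EFinM mulrA divff ?gt_eqF// mul1r patchE indicE.
  by case: ifPn => _; rewrite ?mule1 ?mule0.
- by apply: measurable_funM => //; exact: measurable_indic.
- by move=> u; rewrite mulr_ge0// invr_ge0 ltW.
Qed.

Lemma ge0_integral_ball_sim x r w (g : d.-tuple R -> \bar R) : (0 < r)%R ->
  measurable_fun setT g -> (forall u, 0 <= g u) ->
  \int[lambda]_(u in eball x r) g u =
  (ball_vol * r ^+ d)%:E * \int[unif_ball d]_u g (sim x r w u).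
Proof.
move=> r0 mg g0.
have mB y s : measurable (@eball R d y s) by exact: measurable_eball.
rewrite integral_mkcond (ge0_integral_lebesgue_sim x w r0); last 2 first.
- by apply/(measurable_restrictT g (mB _ _)); exact: measurable_funTS.
- by move=> u; rewrite patchE; case: ifPn.
rewrite mulrC EFinM -muleA ge0_integral_unif_ball; last 2 first.
- by apply: measurableT_comp => //; exact: measurable_sim.
- by [].
congr (_ * _); rewrite [RHS]integral_mkcond; apply: eq_integral => u _.
rewrite !patchE; congr (if _ then _ else _).
have eE : edist x (sim x r w u) = (r * edist o u)%R.
  by rewrite -[X in edist X _](sim_origin x r w) edist_sim// ltW.
by apply/idP/idP => /set_mem; rewrite /eball/= inE/= eE -ltr_pdivlMl// mulVf
  ?gt_eqF.
Qed.

(** Given that it falls in a smaller concentric ball, a uniform point is distributed like the image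
    of a uniform point under any similarity of that ratio fixing the origin. The factor [r ^+ d] is
    the probability of the smaller ball, which must lie inside the unit ball. *)
Lemma ge0_integral_unif_ball_sim r w (g : d.-tuple R -> \bar R) :
  (0 < r <= 1)%R -> measurable_fun setT g -> (forall u, 0 <= g u) ->
  \int[unif_ball d]_(u in eball o r) g u =
  (r ^+ d)%:E * \int[unif_ball d]_u g (sim o r w u).
Proof.
move=> /andP[r0 r1] mg g0.
have V0 := ball_vol_gt0.
have mB y s : measurable (@eball R d y s) by exact: measurable_eball.
apply: (pmuleI ball_vol_gt0); rewrite integral_mkcond.
rewrite ge0_integral_unif_ball; last 2 first.
- by apply/(measurable_restrictT g (mB _ _)); exact: measurable_funTS.
- by move=> u; rewrite patchE; case: ifPn.
rewrite muleA -EFinM -ge0_integral_ball_sim// -integral_mkcondr.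
congr integral; rewrite setIidr// => u; rewrite /eball/= => /lt_le_trans.
exact.
Qed.

End lebesgue_similarity.

(** * The method of moments *)

Section exp_remainder.
Context {R : realType}.
Implicit Types y : R.

Lemma derive_ge0_ge0 (f df : R -> R) : (forall y, is_derive y 1 f (df y)) ->
  f 0 = 0 -> (forall y, 0 <= y -> 0 <= df y) -> forall y, 0 <= y -> 0 <= f y.
Proof.
move=> fdf f0 df0 y; rewrite le_eqVlt => /predU1P[<-|y0]; first by rewrite f0.
have cf : {within `[0, y], continuous f}.
  apply: continuous_subspaceT => z; apply: differentiable_continuous.
  by apply/derivable1_diffP; apply: ex_derive.
have [c /[!in_itv]/= /andP[c0 _]] := MVT y0 (fun z _ => fdf z) cf.
by rewrite f0 !subr0 => ->; rewrite mulr_ge0 ?df0// ltW.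
Qed.

(** [K] counts the terms, not the degree: [exp_poly 0] is the zero polynomial, the base case of the
    remainder estimate, and differentiation lowers [K] by one. *)
Definition exp_poly (K : nat) : {poly R} := \poly_(l < K) l`!%:R^-1.

Lemma invr_factS l : l.+1`!%:R^-1 *+ l.+1 = l`!%:R^-1 :> R.
Proof.
by rewrite -[LHS]mulr_natr factS natrM invfM mulrAC mulVf ?mul1r.
Qed.

Lemma deriv_exp_poly K : (exp_poly K.+1)^`() = exp_poly K.
Proof.
apply/polyP => l; rewrite coef_deriv !coef_poly ltnS.
case: ifPn => _; last by rewrite mul0rn.
by rewrite invr_factS.
Qed.

Lemma exp_poly0 K : (exp_poly K.+1).[0] = 1.
Proof. by rewrite horner_coef0 coef_poly/= fact0 invr1. Qed.

(* Both [(-1)^K (exp (-y) - T_K(-y))] and its difference from [y^K / K!] have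
   as derivative the same expression with [K - 1] in place of [K]. *)
Lemma exp_remainder K y : 0 <= y ->
  `|expR (- y) - (exp_poly K \Po - 'X).[y]| <= y ^+ K / K`!%:R.
Proof.
pose T K := exp_poly K \Po - 'X : {poly R}.
have T0 : T 0%N = 0 by rewrite /T /exp_poly poly_def big_ord0 comp_poly0.
have TS0 K' : (T K'.+1).[0] = 1.
  by rewrite /T horner_comp hornerN hornerX oppr0 exp_poly0.
have dT K' : (T K'.+1)^`() = - T K'.
  by rewrite /T deriv_comp deriv_exp_poly derivN derivX mulrN1.
have dE (z : R) : is_derive z 1 (fun z => expR (- z)) (- expR (- z)).
  rewrite -(mulrN1 (expR (- z))).
  exact: (@is_derive1_comp _ expR (fun z => - z)).
pose G K z := (-1) ^+ K * (expR (- z) - (T K).[z]) : R.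
pose Q K : {poly R} := K`!%:R^-1 *: 'X^K.
have dQ K' : (Q K'.+1)^`() = Q K'.
  by rewrite /Q derivZ derivXn -scalerMnr scalerMnl invr_factS.
have dG K' (z : R) : is_derive z 1 (G K'.+1) (G K' z).
  have -> : G K' z = (-1) ^+ K'.+1 *: (- expR (- z) - (T K'.+1)^`().[z]).
    by rewrite /G dT hornerN exprS/GRing.scale/=; ring.
  exact: is_deriveZ.
have G_ge0 : forall y, 0 <= y -> 0 <= G K y.
  elim: K => [z z0|K' IH]; first by rewrite /G T0 horner0 expr0 mul1r subr0 expR_ge0.
  apply: (derive_ge0_ge0 (dG K')) => //.
  by rewrite /G TS0 oppr0 expR0 subrr mulr0.
have r_ge0 : forall y, 0 <= y -> 0 <= (Q K).[y] - G K y.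
  elim: K {G_ge0} => [z z0|K' IH].
    rewrite /G T0 horner0 expr0 mul1r subr0 /Q expr0 fact0 invr1 scale1r hornerC.
    by rewrite subr_ge0 expR_le1 oppr_le0.
  apply: (derive_ge0_ge0 (df := fun z => (Q K').[z] - G K' z)) => //.
    by move=> z; have := is_deriveB (is_derive_poly (Q K'.+1) z) (dG K' z); rewrite dQ.
  by rewrite /G TS0 oppr0 expR0 subrr mulr0 /Q hornerZ hornerXn expr0n/= mulr0 subr0.
move=> y0; have : `|G K y| <= (Q K).[y].
  by rewrite ger0_norm ?G_ge0// -subr_ge0 r_ge0.
by rewrite /G normrM normrX normrN1 expr1n mul1r /Q hornerZ hornerXn mulrC.
Qed.

End exp_remainder.

(* [(bern n f).[u]] is the mean of [f] under the binomial law with parameters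
   [n] and [u], whose variance is [n u (1 - u)]. *)
Section bernstein.
Context {R : realType}.
Implicit Types (f g : nat -> R) (u : R).

Fixpoint bern n f : {poly R} :=
  if n is n'.+1 then (1 - 'X) * bern n' f + 'X * bern n' (fun k => f k.+1)
  else (f 0%N)%:P.

Lemma bernS n f u :
  (bern n.+1 f).[u] = (1 - u) * (bern n f).[u] + u * (bern n (fun k => f k.+1)).[u].
Proof. by rewrite /= hornerD !hornerM hornerD hornerN hornerX hornerC. Qed.

Lemma le_bern n f g u : 0 <= u <= 1 -> (forall k, f k <= g k) ->
  (bern n f).[u] <= (bern n g).[u].
Proof.
move=> /andP[u0 u1]; elim: n f g => [|n IH] f g fg; first by rewrite !hornerC.
by rewrite !bernS lerD// ler_wpM2l ?subr_ge0// IH.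
Qed.

(** Squared bias plus binomial variance. The center [c] is arbitrary because the recursion of [bern]
    shifts it by 1. *)
Lemma bern_quad n u (a b c : R) :
  (bern n (fun k => a * (k%:R - c) ^+ 2 + b)).[u] =
  a * ((n%:R * u - c) ^+ 2 + n%:R * u * (1 - u)) + b.
Proof.
elim: n c => [|n IH] c; first by rewrite hornerC; ring.
rewrite bernS IH.
have -> : (fun k => a * (k.+1%:R - c) ^+ 2 + b) =
    (fun k => a * (k%:R - (c - 1)) ^+ 2 + b).
  by apply/funext => k; rewrite -addn1 natrD; ring.
by rewrite IH -[in RHS]addn1 natrD; ring.
Qed.

Lemma bern_approx (phi : R -> R) (L e : R) : 0 <= L -> 0 < e ->
  (forall u v, `|phi u - phi v| <= L * `|u - v|) ->
  exists p : {poly R}, forall u, 0 <= u <= 1 -> `|phi u - p.[u]| <= e.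
Proof.
move=> L0 e0 phiL.
(* Once [n >= D ^- 2], the error [L * (D + u * (1 - u) / (D * n))] is at most [2 * L * D]. Dividing
   by [L + 1] rather than [L] covers [L = 0]. *)
pose D := e / (2 * (L + 1)).
have L10 : 0 < L + 1 by rewrite ltr_pwDr.
have D0 : 0 < D by rewrite divr_gt0// mulr_gt0.
pose n := (Num.truncn (D ^- 2)).+1.
have n0 : 0 < n%:R :> R by rewrite ltr0n.
have nD : D ^- 2 <= n%:R.
  by rewrite ltW// truncnS_gt.
exists (bern n (fun k => phi (k%:R / n%:R))) => u u01.
have /andP[u0 u1] := u01.
(* [q 1] and [q (-1)] bound [phi (k / n)] from above and below by quadratic functions of [k], whose
   binomial means are explicit. *)
pose q s k : R := s * L / (D * n%:R ^+ 2) * (k%:R - n%:R * u) ^+ 2 + (phi u + s * L * D).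
have qE s : (bern n (q s)).[u] = phi u + s * (L * (D + u * (1 - u) / (D * n%:R))).
  rewrite bern_quad; field.
  by rewrite !gt_eqF.
have q1 k : `|phi (k%:R / n%:R) - phi u| <=
    L / (D * n%:R ^+ 2) * (k%:R - n%:R * u) ^+ 2 + L * D.
  apply: (le_trans (phiL _ _)).
  rewrite -mulrA -mulrDr ler_wpM2l//.
  set a := `| _ |; have -> : (k%:R - n%:R * u) ^+ 2 = n%:R ^+ 2 * a ^+ 2.
    rewrite /a real_normK ?num_real//; field; exact: lt0r_neq0.
  (* This is [a <= a ^+ 2 / D + D] with the slack written out. It trades the absolute deviation for
     the variance. *)
  have -> : (D * n%:R ^+ 2)^-1 * (n%:R ^+ 2 * a ^+ 2) + D =
      a + ((a - D) ^+ 2 + a * D) / D by field; rewrite !gt_eqF.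
  have a0 : 0 <= a by exact: normr_ge0.
  by rewrite lerDl divr_ge0 ?(ltW D0)// addr_ge0 ?sqr_ge0// mulr_ge0// ltW.
have bound : L * (D + u * (1 - u) / (D * n%:R)) <= e.
  apply: (@le_trans _ _ ((L + 1) * (D + D))); last first.
    by rewrite /D le_eqVlt; apply/orP; left; apply/eqP; field; rewrite gt_eqF.
  apply: ler_pM => //.
  - rewrite addr_ge0 ?(ltW D0)// divr_ge0// mulr_ge0 ?subr_ge0 ?(ltW D0)//.
  - by rewrite lerDl.
  - have Dn0 : 0 < D * n%:R by rewrite mulr_gt0.
    rewrite lerD2l (ler_pdivrMr _ _ Dn0) mulrA -expr2.
    apply: (@le_trans _ _ 1).
      by rewrite mulr_ile1// ?subr_ge0// gerBl.
    by rewrite -ler_pdivrMl ?exprn_gt0// mulr1.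
have up : (bern n (fun k => phi (k%:R / n%:R))).[u] <= (bern n (q 1)).[u].
  apply: le_bern => // k; have := q1 k; rewrite ler_norml => /andP[_].
  by rewrite lerBlDr /q !mul1r => /le_trans; apply; rewrite -addrA (addrC (L * D)).
have lo : (bern n (q (-1))).[u] <= (bern n (fun k => phi (k%:R / n%:R))).[u].
  apply: le_bern => // k; have := q1 k; rewrite ler_norml => /andP[+ _].
  rewrite lerBrDr; set X := - _ + _; suff -> : q (-1) k = X by [].
  by rewrite /X /q; ring.
rewrite ler_norml; move: up lo; rewrite !qE mul1r mulN1r.
by move: bound; set X := L * _ => *; apply/andP; split; lra.
Qed.

End bernstein.

Section real_inequalities.
Context {R : realDomainType}.
Implicit Types a b p q e : R.

Lemma clamp_lip p q :
  `|Num.min 1 (Num.max 0 p) - Num.min 1 (Num.max 0 q)| <= `|p - q|.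
Proof.
have clamp (x : R) : (Num.min 1 (Num.max 0 x) =
    if x <= 0 then 0 else if 1 <= x then 1 else x).
  have [x0|x0] := leP x 0; first by rewrite min_r.
  by have [x1|x1] := leP 1 x; rewrite ?(min_l x1)// min_r// ltW.
have pq := ler_norm (p - q).
have pq' : - (p - q) <= `|p - q| by rewrite -normrN ler_norm.
rewrite !clamp ler_norml; move: `|p - q| pq pq' => n.
by have [p0|p0] := leP p 0; have [q0|q0] := leP q 0;
  have [p1|p1] := leP 1 p; have [q1|q1] := leP 1 q; move=> *; apply/andP; split; lra.
Qed.

Lemma ltr_dist_sandwich a b a1 a2 p1 p2 q1 q2 e :
  a1 <= p1 -> p2 <= a2 -> q1 <= b -> b <= q2 ->
  `|p1 - q1| < e -> `|p2 - q2| < e -> `|a - a1| < e -> `|a - a2| < e ->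
  `|a - b| < e + e.
Proof.
rewrite !ltr_norml => ? ? ? ? /andP[? ?] /andP[? ?] /andP[? ?] /andP[? ?].
by apply/andP; split; lra.
Qed.

End real_inequalities.

Section method_of_moments.
Context {R : realType} {I : Type} (F : set_system I) {FF : Filter F}.
Variables (mu : I -> probability R R) (nu : probability R R) (C : R).
Let D : set R := `[0, +oo[%classic.
Hypothesis mu_neg : forall i, mu i `]-oo, 0[%classic = 0%E.
Hypothesis nu_neg : nu `]-oo, 0[%classic = 0%E.
Hypothesis mu_fin : forall i k, (\int[mu i]_(z in D) (z ^+ k)%:E < +oo)%E.
Hypothesis C_ge1 : 1 <= C.
Hypothesis nu_bound : forall k,
  (\int[nu]_(z in D) (z ^+ k)%:E <= (k.+1`!%:R * C ^+ k.+1)%:E)%E.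
Hypothesis moment_cvg : forall k,
  (\int[mu i]_(z in D) (z ^+ k)%:E)%E @[i --> F] -->
  (\int[nu]_(z in D) (z ^+ k)%:E)%E.

Let E i (g : R -> R) : R := \int[mu i]_(z in D) g z.
Let E0 (g : R -> R) : R := \int[nu]_(z in D) g z.

Let mD : measurable D. Proof. exact: measurable_itv. Qed.

Let D_ge0 z : D z -> 0 <= z. Proof. by rewrite /D/= in_itv/= andbT. Qed.

Let moments_finite (m : probability R R) :=
  forall k, (\int[m]_(z in D) (z ^+ k)%:E < +oo)%E.

Let nu_fin : moments_finite nu.
Proof. by move=> k; rewrite (le_lt_trans (nu_bound k))// ltry. Qed.

(** Polynomial growth on the half-line ensures integrability under every law with finite moments.
    Such functions form an algebra, so each integrability condition below reduces to closure under
    the operations. *)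
Let tame (g : R -> R) := measurable_fun setT g /\
  exists K j, 0 <= K /\ forall z, 0 <= z -> `|g z| <= K * (1 + z ^+ j).

Let tame_integrable (m : probability R R) g : moments_finite m -> tame g ->
  m.-integrable D (EFin \o g).
Proof.
move=> mfin [mg [K [j [K0 gK]]]].
have intX k : m.-integrable D (EFin \o (fun z : R => z ^+ k)).
  apply/integrableP; split.
    by apply/measurable_EFinP; apply: measurable_funTS; exact: measurable_funX.
  rewrite (eq_integral (fun z : R => (z ^+ k)%:E)) => [|z]; first exact: mfin.
  by rewrite inE => /D_ge0 z0; rewrite /= ger0_norm// exprn_ge0.
apply: (@le_integrable _ _ _ m D mD _ (EFin \o (fun z : R => K * (z ^+ 0 + z ^+ j)))).
- by apply/measurable_EFinP; exact: measurable_funTS.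
- move=> z /D_ge0 z0; rewrite /= lee_fin (le_trans (gK _ z0))// expr0.
  exact: ler_norm.
- have := integrableZl mD K (integrableD mD (intX 0%N) (intX j)).
  by congr (integrable _ _); apply/funext => z; rewrite /= EFinM EFinD.
Qed.

Let tameM (g1 g2 : R -> R) : tame g1 -> tame g2 -> tame (fun z => g1 z * g2 z).
Proof.
move=> [m1 [K1 [j1 [K10 g1K]]]] [m2 [K2 [j2 [K20 g2K]]]]; split.
  exact: measurable_funM.
(* [z ^+ j1] and [z ^+ j2] are on the same side of 1, and then
   [(1 + a) * (1 + b) <= 4 * (1 + a * b)]. *)
exists (4 * (K1 * K2)), (j1 + j2)%N; split; first by rewrite !mulr_ge0.
move=> z z0; rewrite normrM.
apply: (le_trans (ler_pM _ _ (g1K _ z0) (g2K _ z0))) => //.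
rewrite mulrACA [leRHS](_ : _ = K1 * K2 * (4 * (1 + z ^+ (j1 + j2)))); last by ring.
rewrite ler_wpM2l ?mulr_ge0//.
set a := z ^+ j1; set b := z ^+ j2.
have -> : z ^+ (j1 + j2) = a * b by rewrite exprD.
have [z1|z1] := leP z 1.
  have a0 : 0 <= a <= 1 by rewrite exprn_ge0//= exprn_ile1.
  have b0 : 0 <= b <= 1 by rewrite exprn_ge0//= exprn_ile1.
  nra.
have a1 : 1 <= a by rewrite exprn_ege1// ltW.
have b1 : 1 <= b by rewrite exprn_ege1// ltW.
nra.
Qed.

Let tame_bounded (g : R -> R) K : measurable_fun setT g -> 0 <= K ->
  (forall z, 0 <= z -> `|g z| <= K) -> tame g.
Proof.
move=> mg K0 gK; split => //; exists K, 0%N; split=> // z z0.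
by rewrite (le_trans (gK _ z0))// ler_peMr// lerDl exprn_ge0.
Qed.

Let tame_poly (p : {poly R}) : tame (fun z => p.[z]).
Proof.
elim/poly_ind: p => [|p c [mp [K [j [K0 pK]]]]].
  by apply: (@tame_bounded _ 0) => // [|z _]; rewrite ?horner0 ?normr0//;
    under eq_fun do rewrite horner0; exact: measurable_cst.
have tX : tame id.
  split; first exact: measurable_id.
  by exists 1, 1%N; split => // z z0; rewrite mul1r expr1 ger0_norm// lerDr.
have [m1 [K1 [j1 [K10 pK1]]]] := tameM (conj mp (ex_intro _ K (ex_intro _ j (conj K0 pK)))) tX.
rewrite (_ : (fun _ => _) = (fun z => p.[z] * z + c)); last first.
  by apply/funext => z; rewrite hornerMXaddC.
split; first exact: measurable_funD.
exists (K1 + `|c|), j1; split; first by rewrite addr_ge0.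
move=> z z0; rewrite (le_trans (ler_normD _ _))// mulrDl lerD//.
  exact: pK1.
by rewrite ler_peMr// lerDl exprn_ge0.
Qed.

Let tameD (g1 g2 : R -> R) : tame g1 -> tame g2 -> tame (fun z => g1 z + g2 z).
Proof.
move=> [m1 [K1 [j1 [K10 g1K]]]] [m2 [K2 [j2 [K20 g2K]]]]; split.
  exact: measurable_funD.
exists (2 * (K1 + K2)), (j1 + j2)%N; split; first by rewrite mulr_ge0// addr_ge0.
move=> z z0; rewrite (le_trans (ler_normD _ _))//.
apply: (le_trans (lerD (g1K _ z0) (g2K _ z0))).
have H a b : 1 + z ^+ a <= 2 * (1 + z ^+ (a + b)).
  have [z1|z1] := leP z 1.
    have : z ^+ a <= 1 by rewrite exprn_ile1.
    by have := exprn_ge0 (a + b) z0; lra.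
  have : z ^+ a <= z ^+ (a + b) by rewrite ler_weXn2l ?leq_addr// ltW.
  by have := exprn_ge0 (a + b) z0; lra.
rewrite [leRHS](_ : _ = K1 * (2 * (1 + z ^+ (j1 + j2))) +
  K2 * (2 * (1 + z ^+ (j1 + j2)))); last by ring.
by rewrite lerD// ler_wpM2l// addnC.
Qed.

Let tameN g : tame g -> tame (fun z => - g z).
Proof.
move=> tg; rewrite (_ : (fun _ => _) = (fun z => (- 1)%:P.[z] * g z)).
  by apply: tameM => //; exact: tame_poly.
by apply/funext => z; rewrite hornerC mulN1r.
Qed.

Let cvE g := E i g @[i --> F] --> E0 g.

Let cvEX k : cvE (fun z => z ^+ k).
Proof.
have fk : (\int[nu]_(z in D) (z ^+ k)%:E)%E \is a fin_num.
  rewrite ge0_fin_numE ?nu_fin//; apply: integral_ge0 => z /D_ge0 z0.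
  by rewrite lee_fin exprn_ge0.
by have := @moment_cvg k; rewrite -(fineK fk) => /fine_cvgP[].
Qed.

Let RintD (m : probability R R) g1 g2 : moments_finite m -> tame g1 -> tame g2 ->
  (\int[m]_(z in D) (g1 z + g2 z) =
   \int[m]_(z in D) g1 z + \int[m]_(z in D) g2 z)%R.
Proof. by move=> mf t1 t2; rewrite RintegralD//; exact: tame_integrable. Qed.

Let RintZ (m : probability R R) c g : moments_finite m -> tame g ->
  (\int[m]_(z in D) (c * g z) = c * \int[m]_(z in D) g z)%R.
Proof. by move=> mf t1; rewrite RintegralZl//; exact: tame_integrable. Qed.

Let Rint_dist (m : probability R R) g1 g2 g3 : moments_finite m ->
  tame g1 -> tame g2 -> tame g3 ->
  (forall z, 0 <= z -> `|g1 z - g2 z| <= g3 z) ->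
  `|\int[m]_(z in D) g1 z - \int[m]_(z in D) g2 z| <= \int[m]_(z in D) g3 z.
Proof.
move=> mf t1 t2 t3 H.
have tB : tame (fun z => g1 z - g2 z) by apply: tameD => //; exact: tameN.
have -> : \int[m]_(z in D) g1 z - \int[m]_(z in D) g2 z =
    \int[m]_(z in D) (g1 z - g2 z).
  by rewrite RintegralB//; exact: tame_integrable.
apply: (le_trans (le_normr_Rintegral _ _)) => //; first exact: tame_integrable.
apply: le_Rintegral => //.
- by apply: integrable_norm; exact: tame_integrable.
- exact: tame_integrable.
- by move=> z /D_ge0; exact: H.
Qed.

Let cvE0 : cvE (cst 0).
Proof.
rewrite /cvE /E /E0 (_ : (fun i => _) = cst 0); last first.
  by apply/funext => i; rewrite Rintegral_cst// mul0r.
by rewrite Rintegral_cst// mul0r; exact: cvg_cst.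
Qed.

Let cvE_lin g1 g2 c : tame g1 -> tame g2 -> cvE g1 -> cvE g2 ->
  cvE (fun z => g1 z + c * g2 z).
Proof.
move=> t1 t2 c1 c2.
have t3 : tame (fun z => c * g2 z).
  rewrite (_ : (fun z => _) = (fun z => (c%:P).[z] * g2 z)).
    by apply: tameM => //; exact: tame_poly.
  by apply/funext => z; rewrite hornerC.
rewrite /cvE /E /E0 RintD// RintZ//.
under eq_fun do rewrite RintD// RintZ//.
by apply: cvgD => //; apply: cvgM => //; exact: cvg_cst.
Qed.

Let cvE_approx g : (forall e, 0 < e -> exists g' : R -> R,
    [/\ cvE g', (\forall i \near F, `|E i g - E i g'| <= e) &
        `|E0 g - E0 g'| <= e]) -> cvE g.
Proof.
move=> H; apply/cvgrPdist_lt => e e0.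
have e4 : 0 < e / 4 by rewrite divr_gt0.
have [g' [/cvgrPdist_lt/(_ _ e4) cg' n1 n2]] := H _ e4.
apply: filterS2 cg' n1 => i c1 c2.
have -> : E0 g - E i g = (E0 g - E0 g') + (E0 g' - E i g') - (E i g - E i g').
  by ring.
rewrite (le_lt_trans (ler_normB _ _))// (le_lt_trans (lerD (ler_normD _ _) (lexx _)))//.
by lra.
Qed.

(** The invariant of the step by step extension in [s]. All powers [z ^+ j] are carried along
    because the Taylor polynomial of the next factor brings in further powers. *)
Let damped (g : R -> R) := [/\ measurable_fun setT g,
  (forall z, 0 <= z -> `|g z| <= 1) & forall j, cvE (fun z => z ^+ j * g z)].

Let damped_tame g j : damped g -> tame (fun z => z ^+ j * g z).
Proof.
move=> [mg g1 _]; apply: tameM; last exact: (@tame_bounded _ 1).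
rewrite (_ : (fun _ => _) = (fun z => ('X^j).[z])); first exact: tame_poly.
by apply/funext => z; rewrite hornerXn.
Qed.

Let damped_poly g (p : {poly R}) j : damped g ->
  cvE (fun z => z ^+ j * g z * p.[z]).
Proof.
move=> dg; elim/poly_ind: p j => [|p c IH] j.
  rewrite (_ : (fun z => _) = cst 0); first exact: cvE0.
  by apply/funext => z; rewrite horner0 mulr0.
rewrite (_ : (fun z => _) =
    (fun z => z ^+ j.+1 * g z * p.[z] + c * (z ^+ j * g z))); last first.
  by apply/funext => z; rewrite hornerMXaddC exprS; ring.
apply: cvE_lin => //.
- by apply: tameM; [exact: damped_tame|exact: tame_poly].
- exact: damped_tame.
- by case: dg.
Qed.

(** By the moment bound, the moment of order [j + K] divided by [K!] grows at most like
    [(2 * C) ^+ K], the 2 coming from a binomial coefficient. With [h * C = 1/4] a factor [2 ^- K]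
    remains. *)
Let h := (4 * C)^-1.

Let h_gt0 : 0 < h.
Proof. by rewrite invr_gt0 mulr_gt0// (lt_le_trans ltr01). Qed.

Let moment k := E0 (fun z => z ^+ k).

Let moment_le k : moment k <= k.+1`!%:R * C ^+ k.+1.
Proof.
rewrite /moment /E0 /Rintegral -lee_fin fineK ?nu_bound//.
rewrite ge0_fin_numE ?nu_fin//; apply: integral_ge0 => z /D_ge0 z0.
by rewrite lee_fin exprn_ge0.
Qed.

Let bin_le2 n k : ('C(n, k) <= 2 ^ n)%N.
Proof.
elim: n k => [|n IH] [|k]//; first by rewrite bin0 expn_gt0.
by rewrite binS expnS mul2n -addnn leq_add.
Qed.

(** The summand 1 leaves room for the approximating laws: once [K] is fixed from the limit law
    alone, their moment of order [j + K] eventually exceeds the limit by less than 1. Hence a growth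
    bound is required of the limit law only. *)
Let remainder_small j e : 0 < e ->
  exists K, h ^+ K / K`!%:R * (moment (j + K) + 1) <= e.
Proof.
move=> e0.
have C0 : 0 < C by exact: lt_le_trans C_ge1.
pose B := j.+1`!%:R * 2 ^+ j.+1 * C ^+ j.+1 + 1 : R.
have B0 : 0 < B.
  by rewrite ltr_wpDl// !mulr_ge0// exprn_ge0// ltW.
pose K := (Num.truncn (B / e)).+1.
exists K.
have H1 : h ^+ K * (C ^+ K * 2 ^+ K) = 2 ^- K.
  rewrite -!exprMn -exprVn; congr (_ ^+ K); rewrite /h; field.
  by rewrite gt_eqF.
have H2 : h ^+ K <= 2 ^- K.
  have h2 : h <= 2^-1.
    by rewrite /h lef_pV2 ?posrE ?mulr_gt0//; move: C_ge1; lra.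
  by rewrite -exprVn lerXn2r// nnegrE ltW.
apply: (@le_trans _ _ (2 ^- K * B)).
  rewrite mulrDr mulr1 /B mulrDr mulr1 lerD//; last first.
    rewrite (le_trans _ H2)// ler_pdivrMr ?ltr0n ?fact_gt0//.
    by rewrite ler_peMr ?exprn_ge0 ?(ltW h_gt0)// ler1n fact_gt0.
  apply: (@le_trans _ _ (h ^+ K / K`!%:R * ((j + K).+1`!%:R * C ^+ (j + K).+1))).
    by rewrite ler_wpM2l ?moment_le// divr_ge0// exprn_ge0// ltW.
  have fle : ((j + K).+1`!%:R : R) <=
      2 ^+ j.+1 * 2 ^+ K * K`!%:R * j.+1`!%:R.
    have := bin_le2 (j.+1 + K) K.
    rewrite -(@leq_pmul2r (K`! * j.+1`!)); last by rewrite muln_gt0 !fact_gt0.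
    rewrite -{2}(addnK K j.+1) bin_fact ?leq_addl// -addSn.
    rewrite -(@ler_nat R) !natrM natrX exprD => /le_trans; apply.
    by rewrite mulrA.
  rewrite -H1 -addSn exprD.
  apply: (@le_trans _ _ (h ^+ K / K`!%:R *
      ((2 ^+ j.+1 * 2 ^+ K * K`!%:R * j.+1`!%:R) * (C ^+ j.+1 * C ^+ K)))).
    rewrite ler_wpM2l ?divr_ge0 ?exprn_ge0 ?(ltW h_gt0)//.
    by rewrite ler_wpM2r// mulr_ge0// exprn_ge0// ltW.
  rewrite le_eqVlt; apply/orP; left; apply/eqP; field.
  by rewrite pnatr_eq0 -lt0n fact_gt0.
rewrite mulrC ler_pdivrMr ?exprn_gt0// -ler_pdivrMl// mulrC.
apply: (@le_trans _ _ K%:R); first by rewrite ltW// truncnS_gt.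
by rewrite -natrX ler_nat ltnW// ltn_expl.
Qed.

(** The exponential is replaced by its Taylor polynomial with [K] terms, for which convergence is
    known. As [g] is bounded by 1, the error is at most [h ^+ K / K! * z ^+ (j + K)] whatever [g]
    is, so the step length never has to shrink. *)
Let damped_step g : damped g -> damped (fun z => g z * expR (- (h * z))).
Proof.
move=> dg; have [mg g1 cg] := dg.
have mexp : measurable_fun [set: R] (fun z => expR (- (h * z))).
  by apply: measurableT_comp => //; apply: measurable_funN => //;
    exact: measurable_funM.
have exp1 z : 0 <= z -> 0 <= expR (- (h * z)) <= 1.
  by move=> z0; rewrite expR_ge0/= expR_le1 oppr_le0 mulr_ge0// ltW.
have dge : measurable_fun setT (fun z => g z * expR (- (h * z))).
  exact: measurable_funM.
have ge1 z : 0 <= z -> `|g z * expR (- (h * z))| <= 1.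
  move=> z0; have /andP[x0 x1] := exp1 _ z0.
  by rewrite normrM mulr_ile1// ?g1// ger0_norm.
split=> // j.
apply: cvE_approx => e e0; have [K Ke] := remainder_small j e0.
pose p : {poly R} := (exp_poly K \Po - 'X) \Po (h *: 'X).
exists (fun z => z ^+ j * g z * p.[z]).
have tg1 : tame (fun z => z ^+ j * (g z * expR (- (h * z)))).
  apply: tameM; last exact: (@tame_bounded _ 1).
  rewrite (_ : (fun _ => _) = (fun z => ('X^j).[z])); first exact: tame_poly.
  by apply/funext => z; rewrite hornerXn.
have tg2 := tameM (damped_tame j dg) (tame_poly p).
have tX k : tame (fun z => z ^+ k).
  rewrite (_ : (fun _ => _) = (fun z => ('X^k).[z])); first exact: tame_poly.
  by apply/funext => z; rewrite hornerXn.
have tg3 : tame (fun z => h ^+ K / K`!%:R * z ^+ (j + K)).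
  rewrite (_ : (fun _ => _) = (fun z => (h ^+ K / K`!%:R)%:P.[z] * z ^+ (j + K))).
    by apply: tameM => //; exact: tame_poly.
  by apply/funext => z; rewrite hornerC.
have close z : 0 <= z -> `|z ^+ j * (g z * expR (- (h * z))) -
    z ^+ j * g z * p.[z]| <= h ^+ K / K`!%:R * z ^+ (j + K).
  move=> z0; rewrite mulrA -mulrBr !normrM (ger0_norm (exprn_ge0 _ z0)).
  rewrite exprD mulrCA -mulrA ler_wpM2l ?exprn_ge0//.
  apply: (@le_trans _ _ (1 * ((h * z) ^+ K / K`!%:R))); last first.
    by rewrite mul1r exprMn mulrAC.
  apply: ler_pM => //; first exact: g1.
  rewrite /p horner_comp hornerZ hornerX; apply: exp_remainder.
  by rewrite mulr_ge0// ltW.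
have cst_ge0 : 0 <= h ^+ K / K`!%:R by rewrite divr_ge0// exprn_ge0// ltW.
split.
- exact: damped_poly.
- have /cvgrPdist_lt/(_ _ ltr01) := @cvEX (j + K)%N.
  apply: filterS => i; rewrite -/(moment (j + K)) => Hi.
  apply: (le_trans (Rint_dist (mu_fin i) tg1 tg2 tg3 close)).
  rewrite RintZ//; apply: le_trans Ke; rewrite ler_wpM2l//.
  move: Hi; rewrite distrC ltr_norml => /andP[_].
  by rewrite ltrBlDl addrC => /ltW.
- apply: (le_trans (Rint_dist nu_fin tg1 tg2 tg3 close)).
  rewrite RintZ//; apply: le_trans Ke; rewrite ler_wpM2l//.
  by rewrite lerDl.
Qed.

Let u z := expR (- (h * z)).

Let damped_expX s : damped (fun z => u z ^+ s).
Proof.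
elim: s => [|s IH]; last first.
  by under eq_fun do rewrite exprSr; exact: damped_step.
split => // [z z0|j]; first by rewrite expr0 normr1.
rewrite /cvE (_ : (fun z => _) = (fun z => z ^+ j)); first exact: cvEX.
by apply/funext => z; rewrite expr0 mulr1.
Qed.

Let cvE_Lipschitz (phi : R -> R) L : 0 <= L ->
  (forall v w, `|phi v - phi w| <= L * `|v - w|) -> measurable_fun setT phi ->
  cvE (fun z => phi (u z)).
Proof.
move=> L0 phiL mphi.
have mu_ : measurable_fun [set: R] u.
  by apply: measurableT_comp => //; apply: measurable_funN => //;
    exact: measurable_funM.
have u01 z : 0 <= z -> 0 <= u z <= 1.
  by move=> z0; rewrite expR_ge0/= expR_le1 oppr_le0 mulr_ge0// ltW.
have tp (p : {poly R}) : tame (fun z => p.[u z]).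
  elim/poly_ind: p => [|p c IH].
    under eq_fun do rewrite horner0.
    by apply: (@tame_bounded _ 0) => // z _; rewrite normr0.
  under eq_fun do rewrite hornerMXaddC.
  apply: tameD; last by apply: (@tame_bounded _ `|c|).
  apply: tameM => //; apply: (@tame_bounded _ 1) => // z /u01/andP[z0 z1].
  by rewrite ger0_norm.
have cX s : cvE (fun z => u z ^+ s).
  have [_ _ /(_ 0%N)] := damped_expX s.
  by congr cvE; apply/funext => z; rewrite expr0 mul1r.
have tX s : tame (fun z => u z ^+ s).
  have := tp 'X^s; congr tame; apply/funext => z.
  by rewrite hornerXn.
have cp (p : {poly R}) s : cvE (fun z => u z ^+ s * p.[u z]).
  elim/poly_ind: p s => [|p c IH] s.
    rewrite (_ : (fun z => _) = cst 0); first exact: cvE0.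
    by apply/funext => z; rewrite horner0 mulr0.
  rewrite (_ : (fun z => _) =
      (fun z => u z ^+ s.+1 * p.[u z] + c * u z ^+ s)); last first.
    by apply/funext => z; rewrite hornerMXaddC exprS; ring.
  by apply: cvE_lin => //; apply: tameM.
have tphi : tame (fun z => phi (u z)).
  apply: (@tame_bounded _ (`|phi 0| + L)); first exact: measurableT_comp.
    by rewrite addr_ge0.
  move=> z /u01/andP[z0 z1].
  rewrite -[phi (u z)](subrK (phi 0)) addrC (le_trans (ler_normD _ _))//.
  rewrite lerD2l (le_trans (phiL _ _))// ler_piMr// subr0 ger0_norm//.
apply: cvE_approx => e e0; have [p pe] := bern_approx L0 e0 phiL.
have te : tame (cst e) by apply: (@tame_bounded _ `|e|).
have cste (m : probability R R) : \int[m]_(z in D) e <= e.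
  rewrite Rintegral_cst// ler_piMr ?(ltW e0)//.
  by rewrite -lee_fin fineK ?fin_num_measure// probability_le1.
exists (fun z => p.[u z]); split.
- by have := cp p 0%N; congr cvE; apply/funext => z; rewrite expr0 mul1r.
- apply: nearW => i; apply: le_trans (cste (mu i)).
  by apply: Rint_dist => // z /u01; exact: pe.
- apply: le_trans (cste nu).
  by apply: Rint_dist => // z /u01; exact: pe.
Qed.

(** A Lipschitz substitute for a step. Composed with the decreasing function [u], it lies between
    the indicators of two half-lines. *)
Let ramp a b v : R := Num.min 1 (Num.max 0 ((v - a) / (b - a))).

Let prob_D (m : probability R R) t : m `]-oo, 0[%classic = 0%E ->
  m `]-oo, t]%classic = m (`]-oo, t]%classic `&` D).
Proof.
move=> m0; apply/eqP; rewrite eq_le; apply/andP; split; last first.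
  by apply: le_measure; rewrite ?inE//; exact: measurableI.
have sub : `]-oo, t]%classic `<=` (`]-oo, t]%classic `&` D) `|` `]-oo, 0[%classic.
  move=> z /= zt; have [z0|z0] := ltP z 0; first by right; rewrite /= in_itv.
  by left; split => //; rewrite /D/= in_itv/= z0.
apply: (@le_trans _ _ (m ((`]-oo, t]%classic `&` D) `|` `]-oo, 0[%classic))).
  apply: le_measure => //; rewrite inE//.
  by apply: measurableU => //; exact: measurableI.
have m1 : measurable (`]-oo, t]%classic `&` D) by exact: measurableI.
have m2 : measurable (`]-oo, 0[%classic : set R) by exact: measurable_itv.
apply: (le_trans (measureU2 _ m1 m2)).
by rewrite [X in (_ + X)%E](_ : _ = 0%E) ?adde0.
Qed.

Let ramp01 a b v : 0 <= ramp a b v <= 1.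
Proof.
by rewrite /ramp le_min ler01 le_max lexx/= ge_min lexx.
Qed.

Let u_lt t t' : t < t' -> u t' < u t.
Proof. by move=> tt'; rewrite ltr_expR ltrN2 ltr_pM2l. Qed.

Let ramp1 t t' z : t < t' -> z <= t -> ramp (u t') (u t) (u z) = 1.
Proof.
move=> tt' zt; rewrite /ramp; apply/min_idPl.
rewrite le_max ler_pdivlMr ?subr_gt0 ?u_lt// mul1r lerD2r.
by rewrite ler_expR lerN2 ler_pM2l// zt orbT.
Qed.

Let ramp0 t t' z : t < t' -> t' < z -> ramp (u t') (u t) (u z) = 0.
Proof.
move=> tt' zt; rewrite /ramp (max_idPl _) ?min_r//.
rewrite pmulr_lle0 ?invr_gt0 ?subr_gt0 ?u_lt// subr_le0.
by rewrite ltW// u_lt.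
Qed.

Let ramp_lip a b : a < b -> forall v w,
  `|ramp a b v - ramp a b w| <= (b - a)^-1 * `|v - w|.
Proof.
move=> ab v w; rewrite /ramp.
have ba0 : 0 <= (b - a)^-1 by rewrite invr_ge0 subr_ge0 ltW.
have -> : (b - a)^-1 * `|v - w| = `|(v - a) / (b - a) - (w - a) / (b - a)|.
  by rewrite -mulrBl normrM (ger0_norm ba0) mulrC; congr (`| _ | * _); ring.
exact: clamp_lip.
Qed.

Let measurable_ramp a b : measurable_fun setT (ramp a b).
Proof.
apply: measurable_minr => //; apply: measurable_maxr => //.
by apply: measurable_funM => //; exact: measurable_funB.
Qed.

Let measurable_u : measurable_fun [set: R] u.
Proof.
by apply: measurableT_comp => //; apply: measurable_funN;
  exact: measurable_funM.
Qed.

Let ramp_int (m : probability R R) a b :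
  (\int[m]_(z in D) (ramp a b (u z))%:E =
   (\int[m]_(z in D) ramp a b (u z))%:E)%E.
Proof.
rewrite fineK// ge0_fin_numE.
  apply: (@le_lt_trans _ _ (\int[m]_(z in D) 1%:E)%E).
    apply: ge0_le_integral => //.
    - by move=> z _; rewrite lee_fin; case/andP : (ramp01 a b (u z)).
    - apply/measurable_EFinP; apply: measurable_funTS.
      exact: (measurableT_comp (measurable_ramp _ _) measurable_u).
    - by move=> z _; rewrite lee_fin; case/andP : (ramp01 a b (u z)).
  by rewrite integral_cst// mul1e (le_lt_trans (probability_le1 _ _))// ltry.
by apply: integral_ge0 => z _; rewrite lee_fin; case/andP : (ramp01 a b (u z)).
Qed.

Let ramp_bounds (m : probability R R) t t' : m `]-oo, 0[%classic = 0%E -> t < t' ->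
  (m `]-oo, t]%classic <= (\int[m]_(z in D) ramp (u t') (u t) (u z))%:E <=
   m `]-oo, t']%classic)%E.
Proof.
move=> m0 tt'.
have mA s : measurable (`]-oo, s]%classic : set R) by exact: measurable_itv.
have mr : measurable_fun D (fun z => (ramp (u t') (u t) (u z))%:E).
  apply/measurable_EFinP; apply: measurable_funTS.
  exact: (measurableT_comp (measurable_ramp _ _) measurable_u).
have mi s : measurable_fun D (fun z => (\1_(`]-oo, s]%classic : set R) z)%:E : \bar R).
  by apply/measurable_EFinP; apply: measurable_funTS; exact: measurable_indic.
rewrite !(prob_D _ m0) -!integral_indic// -ramp_int; apply/andP; split.
  apply: ge0_le_integral => // z _.
  rewrite lee_fin indicE; case: (boolP (z \in _)) => [|_].
    by rewrite inE/= in_itv/= => zt; rewrite ramp1.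
  by case/andP : (ramp01 (u t') (u t) (u z)).
apply: ge0_le_integral => //.
- by move=> z _; rewrite lee_fin; case/andP : (ramp01 (u t') (u t) (u z)).
- move=> z _; rewrite lee_fin indicE; case: (boolP (z \in _)) => [_|].
    by case/andP : (ramp01 (u t') (u t) (u z)).
  by rewrite notin_setE/= in_itv/= => /negP; rewrite -ltNge => zt; rewrite ramp0.
Qed.

Theorem method_of_moments t :
  {for t, continuous (fun s => nu `]-oo, s]%classic)} ->
  mu i `]-oo, t]%classic @[i --> F] --> nu `]-oo, t]%classic.
Proof.
move=> ct.
have finP (m : probability R R) s : m `]-oo, s]%classic \is a fin_num.
  by rewrite fin_num_measure.
pose f (m : probability R R) s := fine (m `]-oo, s]%classic).
have fE (m : probability R R) s : m `]-oo, s]%classic = (f m s)%:E.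
  by rewrite /f fineK.
rewrite fE; apply/fine_cvgP; split; first by apply: nearW => i; exact: finP.
have cf : f nu s @[s --> t] --> f nu t.
  have : nu `]-oo, s]%classic @[s --> t] --> (f nu t)%:E.
    by rewrite -fE; exact: ct.
  by move=> /fine_cvgP[].
apply/cvgrPdist_lt => e e0; have e2 : 0 < e / 2 by rewrite divr_gt0.
have /cvgrPdist_lt/(_ _ e2)/nbhs_ballP[dl /= dl0 H] := cf.
(* Half of [dl] stays inside the ball given by continuity at [t]. The ramps over [[t1, t]] and
   [[t, t2]] bracket the distribution functions at [t]. *)
pose t1 := t - dl / 2; pose t2 := t + dl / 2.
have near_t s : `|t - s| <= dl / 2 -> `|f nu t - f nu s| < e / 2.
  move=> ts; apply: H; rewrite /ball/=; lra.
have H1 : `|f nu t - f nu t1| < e / 2.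
  by apply: near_t; rewrite /t1 opprB addrC subrK ger0_norm; lra.
have H2 : `|f nu t - f nu t2| < e / 2.
  by apply: near_t; rewrite /t2 opprD addrA subrr add0r normrN ger0_norm; lra.
have t1t : t1 < t by rewrite /t1; lra.
have tt2 : t < t2 by rewrite /t2; lra.
have cr s s' : s < s' -> cvE (fun z => ramp (u s') (u s) (u z)).
  move=> ss'; apply: (@cvE_Lipschitz _ (u s - u s')^-1).
  - by rewrite invr_ge0 subr_ge0 ltW// u_lt.
  - by apply: ramp_lip; exact: u_lt.
  - exact: measurable_ramp.
have /cvgrPdist_lt/(_ _ e2) C1 := cr _ _ t1t.
have /cvgrPdist_lt/(_ _ e2) C2 := cr _ _ tt2.
apply: filterS2 C1 C2 => i C1 C2.
have bnd (m : probability R R) s s' : m `]-oo, 0[%classic = 0%E -> s < s' ->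
    f m s <= \int[m]_(z in D) ramp (u s') (u s) (u z) <= f m s'.
  by move=> m0 ss'; have := ramp_bounds m0 ss'; rewrite !fE !lee_fin.
have /andP[_ i1] := bnd _ _ _ (mu_neg i) t1t.
have /andP[i2 _] := bnd _ _ _ (mu_neg i) tt2.
have /andP[n1 _] := bnd _ _ _ nu_neg t1t.
have /andP[_ n2] := bnd _ _ _ nu_neg tt2.
rewrite [ltRHS]splitr /= -/(f (mu i) t).
exact: (ltr_dist_sandwich n1 n2 i1 i2 C1 C2 H1 H2).
Qed.

End method_of_moments.

(** * Regions and farthest points *)

Section regions.
Context {R : realType} {d : nat}.
Notation E := (d.-tuple R).
Notation lambda := (lebesgue d).
Notation V := (@ball_vol R d).
Notation o := (@origin R d).
Local Open Scope ereal_scope.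

Lemma measurable_lt_set d1 (T : measurableType d1) (f g : T -> R) :
  measurable_fun setT f -> measurable_fun setT g ->
  measurable [set t | (f t < g t)%R].
Proof.
move=> mf mg.
rewrite (_ : [set _ | _] = (fun t => g t - f t)%R @^-1` `]0%R, +oo[%classic).
  by apply: measurable_preimage => //; exact: measurable_funB.
by apply/seteqP; split => t; rewrite /= in_itv/= subr_gt0 andbT.
Qed.

Lemma measurable_le_set d1 (T : measurableType d1) (f g : T -> R) :
  measurable_fun setT f -> measurable_fun setT g ->
  measurable [set t | (f t <= g t)%R].
Proof.
move=> mf mg; rewrite (_ : [set _ | _] = ~` [set t | (g t < f t)%R]).
  by apply: measurableC; exact: measurable_lt_set.
by apply/seteqP; split => t /=; rewrite leNgt => /negP.
Qed.

Lemma measurable_exists_ord d1 (T : measurableType d1) n (A : 'I_n -> set T) :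
  (forall j, measurable (A j)) -> measurable [set t | exists j, A j t].
Proof.
move=> mA; rewrite (_ : [set _ | _] = \bigcup_(j in [set: 'I_n]) A j).
  by apply: fin_bigcup_measurable => // j _; exact: mA.
by apply/seteqP; split => t /= [j]; [exists j|move=> _; exists j].
Qed.

Lemma measurable_forall_ord d1 (T : measurableType d1) n (A : 'I_n -> set T) :
  (forall j, measurable (A j)) -> measurable [set t | forall j, A j t].
Proof.
move=> mA; rewrite (_ : [set _ | _] = \bigcap_(j in [set: 'I_n]) A j).
  by apply: fin_bigcap_measurable => // j _; exact: mA.
by apply/seteqP; split => t /= At j; [move=> _|]; exact: At.
Qed.

Lemma measurable_edist_lt d1 (T : measurableType d1) (f g h k : T -> E) :
  measurable_fun setT f -> measurable_fun setT g ->
  measurable_fun setT h -> measurable_fun setT k ->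
  measurable [set t | (edist (f t) (g t) < edist (h t) (k t))%R].
Proof.
by move=> mf mg mh mk; apply: measurable_lt_set; exact: measurable_edist2.
Qed.

(* A point [v] prevents [q_i] from being the nearest one to [x] or to some
   [q_j] if and only if it belongs to [creg x i q]. *)
Definition creg n (x : E) (i : 'I_n) (q : n.-tuple E) : set E :=
  [set v | (edist x v < edist x (tnth q i))%R \/
     exists j, (edist (tnth q j) v < edist (tnth q j) (tnth q i))%R].

Lemma measurable_creg2 d1 (T : measurableType d1) n (x : E) (i : 'I_n)
    (f : T -> n.-tuple E) (g : T -> E) :
  measurable_fun setT f -> measurable_fun setT g ->
  measurable [set t | creg x i (f t) (g t)].
Proof.
move=> mf mg.
have mt j : measurable_fun setT (fun t => tnth (f t) j).
  exact: (measurableT_comp (measurable_tnth j)).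
apply: measurableU; first exact: measurable_edist_lt.
apply: (@measurable_exists_ord _ _ n (fun j => [set t |
  (edist (tnth (f t) j) (g t) < edist (tnth (f t) j) (tnth (f t) i))%R])) => j.
exact: measurable_edist_lt.
Qed.

Lemma measurable_creg n (x : E) (i : 'I_n) q : measurable (creg x i q).
Proof. exact: (@measurable_creg2 _ E n x i (cst q) id). Qed.

Lemma creg_sub_ball n (x : E) (i : 'I_n) q r :
  (forall j, edist x (tnth q j) < r)%R -> creg x i q `<=` eball x (3 * r)%R.
Proof.
move=> qr v [xv|[j jv]]; rewrite /eball/=.
  by have := qr i; have := edist_ge0 x (tnth q i); lra.
have := edist_triangle x (tnth q j) v.
have := edist_triangle (tnth q j) x (tnth q i); rewrite (edistC (tnth q j) x).
by have := qr i; have := qr j; lra.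
Qed.

Lemma creg_bounded n (x : E) (i : 'I_n) q :
  exists2 r : R, (0 < r)%R & creg x i q `<=` eball x r.
Proof.
pose r := (1 + \sum_(j < n) edist x (tnth q j))%R.
have r0 : (0 < r)%R by rewrite ltr_wpDr// sumr_ge0// => j _; exact: edist_ge0.
exists (3 * r)%R; first by rewrite mulr_gt0.
apply: creg_sub_ball => j; rewrite /r (bigD1 j)//= addrCA ltrDl ltr_wpDr//.
by rewrite sumr_ge0// => l _; exact: edist_ge0.
Qed.

Lemma lebesgue_bounded (A : set E) (x : E) (r : R) : measurable A ->
  A `<=` eball x r -> lambda A \is a fin_num.
Proof.
move=> mA Ar; rewrite ge0_fin_numE//.
apply: (@le_lt_trans _ _ (lambda (eball x (Num.max r 1)%R))).
  apply: le_measure; rewrite ?inE//; first exact: measurable_eball.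
  by move=> v /Ar; rewrite /eball/= lt_max => ->.
by rewrite lebesgue_ball ?ltry// lt_max ltr01 orbT.
Qed.

(** Volume in units of the unit ball, the normalization of [D_var]. An infinite volume gives 0, but
    the regions [creg] are bounded. *)
Definition rvol (A : set E) : R := (fine (lambda A) / V)%R.

Lemma rvol_ge0 A : (0 <= rvol A)%R.
Proof. by rewrite divr_ge0 ?fine_ge0// ltW// ball_vol_gt0. Qed.

Lemma rvolE (A : set E) x r : measurable A -> A `<=` eball x r ->
  lambda A = (V * rvol A)%:E.
Proof.
move=> mA Ar; rewrite /rvol mulrCA divff ?mulr1 ?fineK//.
  exact: lebesgue_bounded Ar.
by rewrite gt_eqF// ball_vol_gt0.
Qed.

Lemma le_rvol (A B : set E) x r : measurable A -> measurable B -> A `<=` B ->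
  B `<=` eball x r -> (rvol A <= rvol B)%R.
Proof.
move=> mA mB AB Br; rewrite ler_pM2r ?invr_gt0 ?ball_vol_gt0//.
apply: fine_le.
- by apply: (@lebesgue_bounded _ x r) => //; exact: subset_trans Br.
- exact: (@lebesgue_bounded _ x r).
- by apply: le_measure; rewrite ?inE.
Qed.

Lemma rvol_ball x r : (0 < r)%R -> rvol (eball x r) = (r ^+ d)%R.
Proof.
move=> r0; rewrite /rvol lebesgue_ball//= mulrAC divff ?mul1r//.
by rewrite gt_eqF// ball_vol_gt0.
Qed.

Lemma lebesgue_sim x r w (A : set E) : (0 < r)%R -> measurable A ->
  lambda A = (r ^+ d)%:E * lambda (sim x r w @^-1` A).
Proof.
move=> r0 mA.
have := @ge0_integral_lebesgue_sim R d x r w (EFin \o \1_A) r0.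
rewrite /= integral_indic// setIT => ->.
- under eq_integral do rewrite indic_preimage.
  rewrite integral_indic// ?setIT//; apply: measurable_preimage => //.
  exact: measurable_sim.
- by apply/measurable_EFinP; exact: measurable_indic.
- by move=> u; rewrite lee_fin.
Qed.

Lemma rvol_sim x r w (A : set E) : (0 < r)%R -> measurable A ->
  rvol A = (r ^+ d * rvol (sim x r w @^-1` A))%R.
Proof.
move=> r0 mA; rewrite /rvol (lebesgue_sim x w r0 mA) mulrA.
have [f|f] := boolP (lambda (sim x r w @^-1` A) \is a fin_num).
  by rewrite fineM.
(* For an infinite volume both sides are 0 by the default value of [fine]. *)
have -> : lambda (sim x r w @^-1` A) = +oo.
  by move: f; rewrite ge0_fin_numE// -leNgt leye_eq => /eqP.
by rewrite gt0_muley ?lte_fin ?exprn_gt0//= mulr0 mul0r.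
Qed.

(** The region is defined by comparing distances, and a similarity multiplies all of them by the
    same factor. *)
Lemma creg_sim n (x y : E) r w (i : 'I_n) q : (0 < r)%R ->
  sim y r w @^-1` creg (sim y r w x) i (map_tuple (sim y r w) q) = creg x i q.
Proof.
move=> r0; have r0' := ltW r0.
apply/seteqP; split => v; rewrite /creg/= !tnth_map !edist_sim// ltr_pM2l//.
  case=> [|[j]]; first by left.
  by rewrite !tnth_map !edist_sim// ltr_pM2l// => ?; right; exists j.
case=> [|[j jv]]; first by left.
by right; exists j; rewrite !tnth_map !edist_sim// ltr_pM2l.
Qed.

Lemma rvol_creg_sim n (x y : E) r w (i : 'I_n) q : (0 < r)%R ->
  rvol (creg (sim y r w x) i (map_tuple (sim y r w) q)) =
  (r ^+ d * rvol (creg x i q))%R.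
Proof.
by move=> r0; rewrite (rvol_sim y w r0) ?creg_sim//; exact: measurable_creg.
Qed.

Lemma creg_perm n (x : E) (i : 'I_n) q (s : 'S_n) :
  creg x i (tuple_perm s q) = creg x (s i) q.
Proof.
apply/seteqP; split => v; rewrite /creg/= tnth_mktuple => -[|[j]].
- by left.
- by rewrite tnth_mktuple; right; exists (s j).
- by left.
- by move=> jv; right; exists ((s^-1)%g j); rewrite tnth_mktuple permKV.
Qed.

Lemma measurable_fine_section d1 d2 (T : measurableType d1)
    (T' : measurableType d2) (m : {sigma_finite_measure set T' -> \bar R})
    (S : set (T * T')) : measurable S ->
  measurable_fun setT (fun t => fine (m [set v | S (t, v)])).
Proof.
move=> mS; have := measurable_fun_xsection m mS.
move=> /(measurableT_comp (@fine_measurable R setT measurableT)).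
by congr (measurable_fun _ _); apply/funext => t /=; rewrite xsectionE.
Qed.

Lemma measurable_rvol_section d1 (T : measurableType d1) (S : set (T * E)) :
  measurable S -> measurable_fun setT (fun t => rvol [set v | S (t, v)]).
Proof.
by move=> mS; apply: measurable_funM => //; exact: measurable_fine_section.
Qed.

Lemma measurable_rvol_creg n (x : E) (i : 'I_n) :
  measurable_fun setT (fun q => rvol (creg x i q)).
Proof.
have mS : measurable [set p : n.-tuple E * E | creg x i p.1 p.2].
  exact: measurable_creg2.
exact: measurable_rvol_section mS.
Qed.

(** A sphere of positive radius is contained in a larger concentric ball and disjoint from the open
    ball it bounds, so its measure is at most the difference of their volumes, which vanishes as the
    radii merge. For [r <= 0] it lies in arbitrarily small balls, of small volume because
    [d > 0]. *)
Lemma lebesgue_sphere0 (x : E) (r : R) : (0 < d)%N ->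
  lambda [set v | edist x v = r] = 0.
Proof.
move=> d0; set S := [set _ | _].
have mS : measurable S.
  rewrite (_ : S = edist x @^-1` [set r])//; apply: measurable_preimage => //.
  exact: measurable_edist.
have [r0|r0] := ltP 0%R r; last first.
  apply/eqP; rewrite eq_le measure_ge0 andbT.
  apply/lee_addgt0Pr => e e0; rewrite add0e.
  have [s s0 se] : exists2 s : R, (0 < s)%R & (V * s ^+ d <= e)%R.
    (* A radius at most 1 gives [s ^+ d <= s], as [d] is at least 1. *)
    exists (Num.min 1 (e / V))%R.
      by rewrite lt_min ltr01 divr_gt0// ball_vol_gt0.
    rewrite mulrC -ler_pdivlMr ?ball_vol_gt0//.
    have m0 : (0 <= Num.min 1 (e / V))%R.
      by rewrite le_min ler01 divr_ge0// ltW// ball_vol_gt0.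
    rewrite (@le_trans _ _ (Num.min 1 (e / V)))%R//; last by rewrite ge_min lexx orbT.
    by rewrite -[leRHS]expr1 ler_wiXn2l// ge_min lexx.
  rewrite (le_trans _ (_ : (V * s ^+ d)%:E <= e%:E))//.
  rewrite -(lebesgue_ball x s0); apply: le_measure; rewrite ?inE//.
    exact: measurable_eball.
  by move=> v /= xv; rewrite /eball/= xv (le_lt_trans r0).
have rS e : (0 < e <= 1)%R -> lambda S <= (V * r ^+ d * ((1 + e) ^+ d - 1))%:E.
  move=> /andP[e0 e1].
  have re0 : (0 < r * (1 + e))%R by rewrite mulr_gt0// addr_gt0.
  have mB s : measurable (eball x s) by exact: measurable_eball.
  have : lambda (eball x r) + lambda S <= lambda (eball x (r * (1 + e))%R).
    rewrite -measureU//; last first.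
      apply/seteqP; split => // v [/= ]; rewrite /eball/= => + vr.
      by rewrite vr ltxx.
    apply: le_measure; rewrite ?inE//; first exact: measurableU.
    have rr : (r < r * (1 + e))%R by rewrite ltr_pMr// ltrDl.
    move=> v [] /= xv; rewrite /eball/=; first exact: lt_trans xv rr.
    by rewrite xv.
  rewrite !lebesgue_ball// addeC -leeBrDr// -EFinB => /le_trans; apply.
  by rewrite lee_fin exprMn le_eqVlt; apply/orP; left; apply/eqP; ring.
apply/eqP; rewrite eq_le measure_ge0 andbT.
have cv : (fun e : R => V * r ^+ d * ((1 + e) ^+ d - 1))%R e @[e --> 0%R] --> 0%R.
  have := @continuous_horner R ((V * r ^+ d) *: ((1 + 'X) ^+ d - 1))%R 0%R.
  rewrite /continuous_at (_ : _.[0] = 0)%R; last first.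
    by rewrite hornerZ hornerD hornerN horner_exp !(hornerD, hornerX, hornerC) addr0 expr1n subrr mulr0.
  apply: cvg_trans; apply: near_eq_cvg; apply: nearW => e.
  by rewrite hornerZ hornerD hornerN horner_exp !(hornerD, hornerX, hornerC).
apply/lee_addgt0Pr => e e0; rewrite add0e.
have /cvgrPdist_lt/(_ _ e0)/nbhs_ballP[dl /= dl0 H] := cv.
pose e' := Num.min 1%R (dl / 2)%R.
have e'0 : (0 < e')%R by rewrite lt_min ltr01 divr_gt0.
have /rS : (0 < e' <= 1)%R by rewrite e'0 ge_min lexx.
move=> /le_trans; apply; rewrite lee_fin.
have := H e'; rewrite /ball/= !sub0r !normrN (ger0_norm (ltW e'0)) => {}H.
apply: (le_trans (ler_norm _)); apply/ltW/H.
by rewrite gt_min; apply/orP; right; rewrite ltr_pdivrMr// ltr_pMr// ltr1n.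
Qed.

End regions.

(** * The strict maximizer of a function over an i.i.d. sample *)

Section strict_argmax.
Context {dT} {T : measurableType dT} {R : realType}.
Variables (m : {sigma_finite_measure set T -> \bar R}) (kappa : T -> R).
Hypothesis m1 : m setT = 1%E.
Hypothesis mkappa : measurable_fun setT kappa.
Hypothesis level0 : forall r, m [set v | kappa v = r] = 0%E.
Local Open Scope ereal_scope.

Let mtnth n (i : 'I_n) : measurable_fun setT (fun t : n.-tuple T => kappa (tnth t i)).
Proof. exact: (measurableT_comp mkappa (measurable_tnth i)). Qed.

Definition ties n (i j : 'I_n) : set (n.-tuple T) :=
  [set t | kappa (tnth t i) = kappa (tnth t j)].

Lemma measurable_ties n (i j : 'I_n) : measurable (ties i j).
Proof.
pose D (t : n.-tuple T) := (kappa (tnth t i) - kappa (tnth t j))%R.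
have mD : measurable_fun setT D by apply: measurable_funB; exact: mtnth.
rewrite (_ : ties i j = D @^-1` [set 0%R]); first exact: measurable_preimage.
by apply/seteqP; split => t; rewrite /D/= => /eqP te; apply/eqP;
  rewrite ?subr_eq0// -subr_eq0.
Qed.

Lemma ties_null n (i j : 'I_n) : i != j -> tuple_product m n (ties i j) = 0.
Proof.
case: n i j => [[]//|n] i j ij.
have int_indic (A : set (n.+1.-tuple T)) : measurable A ->
    tuple_product m n.+1 A = \int[tuple_product m n.+1]_t (\1_A t)%:E.
  by move=> mA; rewrite integral_indic// setIT.
(* Swapping 0 and [i] reduces to a tie between index 0 and a later one. With the point at index 0
   fixed, the later point must lie on a null level set. *)
have [l ->] : exists l, j = tperm ord0 i (lift ord0 l).
  case: (unliftP ord0 (tperm ord0 i j)) => [l lE|j0].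
    by exists l; rewrite -lE tpermK.
  by move: ij; rewrite -(tpermK ord0 i j) j0 tpermL eqxx.
have -> : tuple_product m n.+1 (ties i (tperm ord0 i (lift ord0 l))) =
    tuple_product m n.+1 (ties ord0 (lift ord0 l)).
  rewrite !int_indic; try exact: measurable_ties.
  rewrite -[RHS](ge0_integral_tuple_perm (tperm ord0 i))//.
    apply: eq_integral => t _; congr EFin; apply: eq_indic.
    by rewrite /ties/= !tnth_mktuple tpermL.
  by apply/measurable_EFinP; apply: measurable_indic; exact: measurable_ties.
rewrite int_indic; last exact: measurable_ties.
rewrite ge0_integral_tuple_productS//; last first.
  by apply/measurable_EFinP; apply: measurable_indic; exact: measurable_ties.
apply: integral0_eq => a _.
pose B (k : 'I_n) := if k == l then [set v | kappa v = kappa a] else setT.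
have mB k : measurable (B k).
  rewrite /B; case: ifPn => // _.
  by rewrite (_ : [set _ | _] = kappa @^-1` [set kappa a])//; exact: measurable_preimage.
transitivity (\int[tuple_product m n]_t (\1_(tuple_box B) t)%:E).
  apply: eq_integral => t _; congr EFin; apply: eq_indic.
  rewrite /ties/= tnthS; split => [ta k|/(_ l)].
    by rewrite /B; case: ifPn => // /eqP ->.
  by rewrite /B eqxx.
rewrite integral_indic//; last exact: measurable_tuple_box.
rewrite setIT; transitivity (\prod_(k < n) m (B k)).
  exact: tuple_product_box.
by rewrite (bigD1 l)//= {1}/B eqxx level0 mul0e.
Qed.

(** Used with two functions: for [edist o] the maximizer is the farthest of the uniform points, for
    [negdist x] it is the nucleus. Strictness makes these sets disjoint, and [no_argmax_null] makes
    them cover almost everything. *)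
Definition argmax_set n (i : 'I_n) : set (n.-tuple T) :=
  [set t | forall j, j != i -> (kappa (tnth t j) < kappa (tnth t i))%R].

Lemma measurable_argmax_set n (i : 'I_n) : measurable (argmax_set i).
Proof.
apply: (@measurable_forall_ord _ _ n (fun j => [set t | j != i ->
  (kappa (tnth t j) < kappa (tnth t i))%R])) => j.
have [ji|ji] := eqVneq j i.
  by rewrite (_ : [set _ | _] = setT)//; apply/seteqP; split.
rewrite (_ : [set _ | _] = [set t | (kappa (tnth t j) < kappa (tnth t i))%R]).
  by apply: measurable_lt_set; exact: mtnth.
by apply/seteqP; split => t /=; [exact|].
Qed.

Lemma argmax_set_uniq n (i j : 'I_n) t :
  argmax_set i t -> argmax_set j t -> i = j.
Proof.
move=> it jt; apply/eqP/negPn/negP => ij.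
by have := lt_trans (jt _ ij) (it _ (_ : j != i)); rewrite eq_sym ij ltxx => /(_ isT).
Qed.

Definition no_argmax n : set (n.-tuple T) :=
  ~` [set t | exists i, argmax_set i t].

Lemma measurable_no_argmax n : measurable (@no_argmax n).
Proof.
apply: measurableC; apply: measurable_exists_ord => i.
exact: measurable_argmax_set.
Qed.

Lemma no_argmax_null n : tuple_product m n.+1 (@no_argmax n.+1) = 0.
Proof.
apply/eqP; rewrite eq_le measure_ge0 andbT.
apply: (@le_trans _ _ (tuple_product m n.+1
  (\bigcup_(p in [set p : 'I_n.+1 * 'I_n.+1 | p.1 != p.2]) ties p.1 p.2))).
  apply: le_measure; rewrite ?inE//; first exact: measurable_no_argmax.
    apply: fin_bigcup_measurable => // p _; exact: measurable_ties.
  move=> t /= tn; apply: contrapT => tties; apply: tn.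
  exists [arg max_(i > ord0) kappa (tnth t i)]%O.
  case: Order.TotalTheory.arg_maxP => // i _ imax j ji.
  have ji' : (kappa (tnth t j) <= kappa (tnth t i))%R by exact: imax.
  rewrite lt_neqAle ji' andbT; apply/negP => /eqP jiE; apply: tties.
  by exists (j, i).
set Dp := [set p | _].
have mt (p : 'I_n.+1 * 'I_n.+1) : Dp p -> measurable (ties p.1 p.2).
  by move=> _; exact: measurable_ties.
have mU : measurable (\bigcup_(p in Dp) ties p.1 p.2).
  exact: fin_bigcup_measurable.
have Dfin : finite_set Dp by exact: finite_finset.
have := @content_sub_fsum _ _ _ (tuple_product m n.+1) _ Dp _
  (fun p => ties p.1 p.2) Dfin mt mU (@subset_refl _ _).
by rewrite fsbig1// => p /= pn; exact: ties_null.
Qed.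

Lemma ge0_integral_argmax_set n (g : n.+1.-tuple T -> \bar R) :
  measurable_fun setT g -> (forall t, 0 <= g t) ->
  \int[tuple_product m n.+1]_t g t =
  \sum_(i < n.+1) \int[tuple_product m n.+1]_(t in argmax_set i) g t.
Proof.
move=> mg g0.
rewrite (ge0_negligible_integral (@measurable_no_argmax n.+1))//; last first.
  exact: no_argmax_null.
rewrite integral_mkcond; under [RHS]eq_bigr do rewrite integral_mkcond.
rewrite -ge0_integral_sum//.
- apply: eq_integral => t _; rewrite patchE.
  case: (pselect (exists i, argmax_set i t)) => [[i it]|nit].
    rewrite ifT; last by rewrite inE; split => //; apply; exists i.
    rewrite (bigD1 i)//= patchE mem_set// big1 ?adde0// => j ji.
    rewrite patchE memNset// => jt; move/negP : ji; apply; apply/eqP.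
    exact: argmax_set_uniq jt it.
  rewrite ifF; last by apply/negbTE; rewrite notin_setE => -[_]; exact.
  rewrite big1// => i _; rewrite patchE memNset// => it; apply: nit.
  by exists i.
- move=> i; apply/(measurable_restrictT g (measurable_argmax_set i)).
  exact: measurable_funTS.
- by move=> i t _; rewrite patchE; case: ifPn.
Qed.

Lemma argmax_set_perm n (i : 'I_n.+1) t :
  argmax_set ord0 (tuple_perm (tperm ord0 i) t) <-> argmax_set i t.
Proof.
split => H j ji.
  have := H (tperm ord0 i j); rewrite !tnth_mktuple tpermK tpermL; apply.
  apply: contra ji => /eqP e; apply/eqP/(@perm_inj _ (tperm ord0 i)).
  by rewrite e tpermR.
rewrite !tnth_mktuple tpermL; apply: H.
apply: contra ji => /eqP e; apply/eqP/(@perm_inj _ (tperm ord0 i)).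
by rewrite e tpermL.
Qed.

Lemma ge0_integral_argmax_set_perm n (i : 'I_n.+1) (g : n.+1.-tuple T -> \bar R) :
  measurable_fun setT g -> (forall t, 0 <= g t) ->
  \int[tuple_product m n.+1]_(t in argmax_set i) g t =
  \int[tuple_product m n.+1]_(t in argmax_set ord0)
     g (tuple_perm (tperm ord0 i) t).
Proof.
move=> mg g0.
have mp : measurable_fun setT (@tuple_perm _ T n.+1 (tperm ord0 i)).
  exact: measurable_tuple_perm.
have mgp : measurable_fun setT (fun t => g (tuple_perm (tperm ord0 i) t)).
  exact: (measurableT_comp mg mp).
rewrite [RHS]integral_mkcond -(ge0_integral_tuple_perm (tperm ord0 i))//.
- rewrite [LHS]integral_mkcond; apply: eq_integral => t _; rewrite !patchE.
  have -> : tuple_perm (tperm ord0 i) (tuple_perm (tperm ord0 i) t) = t.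
    by apply: eq_from_tnth => j; rewrite !tnth_mktuple tpermK.
  congr (if _ then _ else _); apply/idP/idP => /set_mem.
    by move=> /argmax_set_perm ?; rewrite inE.
  by rewrite inE => /argmax_set_perm.
- apply/(measurable_restrictT _ (measurable_argmax_set ord0)).
  exact: measurable_funTS.
- by move=> t; rewrite patchE; case: ifPn.
Qed.

End strict_argmax.

(** * Scaling limit of the Poisson moments *)

Section truncated_gamma.
Context {R : realType}.

(** The probability that a Poisson variable of mean [a] is at most [k], or that a Gamma variable of
    shape [k + 1] exceeds [a]. *)
Definition gamma_tail k (a : R) : R := expR (- a) * (exp_poly k.+1).[a].

Lemma integral_power_exp k (a : R) : 0 < a ->
  (\int[@lebesgue_measure R]_(s in `[0%R, 1%R]) (s ^+ k * expR (- (a * s)))%:E =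
   (k`!%:R / a ^+ k.+1 * (1 - gamma_tail k a))%:E)%E.
Proof.
move=> a0; have a0' : a != 0 by rewrite gt_eqF.
have kf : k`!%:R != 0 :> R by rewrite pnatr_eq0 -lt0n fact_gt0.
pose p : {poly R} := exp_poly k.+1 \Po (a *: 'X).
(* An antiderivative of the integrand: differentiating [p] gives [a * p] without its last term, so
   only that term survives next to the derivative of the exponential. *)
pose F (s : R) : R := - (k`!%:R / a ^+ k.+1) * (expR (- (a * s)) * p.[s]).
pose f (s : R) : R := s ^+ k * expR (- (a * s)).
have dE (s : R) : is_derive s 1 (fun s => expR (- (a * s))) (expR (- (a * s)) * - a).
  apply: (@is_derive1_comp _ expR (fun s => - (a * s))).
  have := is_deriveN (is_deriveZ a (is_derive_id s 1)).
  by rewrite /GRing.scale/= mulr1.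
have pE s : (p^`()).[s] = a * p.[s] - a ^+ k.+1 * s ^+ k / k`!%:R.
  rewrite /p deriv_comp deriv_exp_poly derivZ derivX alg_polyC hornerM hornerC.
  rewrite !horner_comp hornerZ hornerX mulrC.
  have -> : exp_poly k.+1 = exp_poly k + (k`!%:R)^-1 *: 'X^k :> {poly R}.
    by rewrite /exp_poly !poly_def big_ord_recr.
  rewrite hornerD hornerZ hornerXn exprMn exprS; field.
  exact: kf.
have dF (s : R) : is_derive s 1 F (f s).
  have := is_deriveZ (- (k`!%:R / a ^+ k.+1)) (is_deriveM (dE s) (is_derive_poly p s)).
  congr (is_derive s 1 _ _).
  rewrite pE /f /GRing.scale/=; field.
  by rewrite kf expf_neq0.
have cF : continuous F.
  by move=> s; apply: differentiable_continuous; apply/derivable1_diffP;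
    apply: ex_derive.
have cf : continuous f.
  move=> s; apply: cvgM; first exact: exprn_continuous.
  apply: (continuous_comp (f := fun s => - (a * s))); last exact: continuous_expR.
  by apply: cvgN; apply: cvgM; [exact: cvg_cst|exact: cvg_id].
rewrite (@continuous_FTC2 _ f F 0 1)//.
- rewrite /F mulr0 mulr1 oppr0 expR0 mul1r /p !horner_comp !hornerZ !hornerX.
  rewrite mulr1 mulr0 exp_poly0 -EFinB /gamma_tail; congr EFin; ring.
- exact: continuous_subspaceT.
- split.
  + by move=> s _; apply: ex_derive.
  + by apply: cvg_at_right_filter; exact: cF.
  + by apply: cvg_at_left_filter; exact: cF.
- by move=> s _; rewrite derive1E; apply: derive_val.
Qed.

Lemma gamma_tail_ge0 k (a : R) : 0 <= a -> 0 <= gamma_tail k a.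
Proof.
move=> a0; rewrite mulr_ge0 ?expR_ge0// horner_poly sumr_ge0// => l _.
by rewrite mulr_ge0 ?exprn_ge0.
Qed.

(** From [a ^+ l.+1 / l.+1! <= exp a], each of the [k + 1] terms is at most [(k + 1) / a]. Any bound
    that vanishes as [a] grows would do. *)
Lemma gamma_tail_le k (a : R) : 0 < a -> gamma_tail k a <= k.+1%:R ^+ 2 / a.
Proof.
move=> a0; rewrite /gamma_tail horner_poly mulr_sumr.
apply: (@le_trans _ _ (\sum_(l < k.+1) (k.+1%:R / a))); last first.
  by rewrite sumr_const card_ord -[leLHS]mulr_natl expr2 mulrA.
apply: ler_sum => l _.
have := expR_ge1Dxn l (ltW a0) => el.
rewrite expRN mulrC ler_pdivrMr ?expR_gt0//.
apply: (@le_trans _ _ (k.+1%:R / a * (a ^+ l.+1 / l.+1`!%:R))); last first.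
  rewrite ler_wpM2l ?divr_ge0 ?(ltW a0)//; apply: le_trans el.
  by rewrite lerDr.
have -> : k.+1%:R / a * (a ^+ l.+1 / l.+1`!%:R) =
    (k.+1%:R / l.+1%:R) * (l`!%:R^-1 * a ^+ l).
  rewrite factS natrM exprS; field.
  have lf : l`!%:R != 0 :> R by rewrite pnatr_eq0 -lt0n fact_gt0.
  by rewrite ?lf ?gt_eqF ?nat1r ?pnatr_eq0.
rewrite ler_peMl ?mulr_ge0 ?invr_ge0 ?exprn_ge0 ?(ltW a0)//.
by rewrite ler_pdivlMr// mul1r ler_nat.
Qed.

End truncated_gamma.

(* [R] and [measurableTypeR R] have different displays, so the two integrals
   are not convertible. *)
Lemma ge0_integral_lebesgueR (R : realType) (D : set R) (g : R -> \bar R) :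
  measurable D -> measurable_fun D g -> (forall s, 0 <= g s)%E ->
  (\int[lebesgueR]_(s in D) g s = \int[lebesgue_measure]_(s in D) g s)%E.
Proof.
move=> mD mg g0.
have mid : measurable_fun setT (id : measurableTypeR R -> R).
  by move=> _ A mA; rewrite setTI.
exact: (ge0_integral_pushforward mid lebesgue_measure mD mg (fun s _ => g0 s)).
Qed.

(** * The radius of a uniform point of the ball *)

Section unif_ball_radius.
Context {R : realType} {d : nat}.
Notation E := (d.-tuple R).
Notation U := (unif_ball d).
Notation o := (@origin R d).
Hypothesis d_gt0 : (0 < d)%N.
Local Open Scope ereal_scope.

Lemma unif_ball_setT : U setT = 1 :> \bar R.
Proof. exact: probability_setT. Qed.

Lemma unif_ball_ball (r : R) : (0 <= r <= 1)%R -> U (eball o r) = (r ^+ d)%:E.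
Proof.
move=> /andP[r0 r1]; rewrite unif_ballE setIidl; last first.
  by move=> u; rewrite /eball/= => /lt_le_trans; apply.
rewrite -/ball_vol; move: r0; rewrite le_eqVlt => /predU1P[<-|r0].
  rewrite expr0n gtn_eqF//= (_ : eball o 0 = set0) ?measure0 ?mul0e//.
  by apply/seteqP; split => // u; rewrite /eball/= ltNge edist_ge0.
rewrite lebesgue_ball// -EFinM mulrAC divff ?mul1r//.
by rewrite gt_eqF// ball_vol_gt0.
Qed.

Lemma eq_integral_unif_ball (g h : E -> \bar R) :
  measurable_fun setT g -> measurable_fun setT h ->
  (forall u, 0 <= g u) -> (forall u, 0 <= h u) ->
  (forall u, (edist o u < 1)%R -> g u = h u) ->
  \int[U]_u g u = \int[U]_u h u.
Proof.
move=> mg mh g0 h0 gh; apply: (pmuleI (@ball_vol_gt0 R d)).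
rewrite !ge0_integral_unif_ball//; apply: eq_integral => u /[!inE] uB.
exact: gh.
Qed.

(** The radius of a uniform point is below [r] with probability [r ^+ d], so its [d]-th power is
    uniform on [[0, 1]]; the two laws are compared on the rays []-oo, a[]. This takes the place of
    polar coordinates. *)
Lemma ge0_integral_unif_radius (g : R -> \bar R) :
  measurable_fun setT g -> (forall s, 0 <= g s) ->
  \int[U]_u g (edist o u ^+ d)%R = \int[lebesgue_measure]_(s in `[0%R, 1%R]) g s.
Proof.
move=> mg g0.
pose f (u : E) := (edist o u ^+ d)%R.
have mf : measurable_fun setT f by apply: measurable_funX; exact: measurable_edist.
pose I01 : set R := `[0%R, 1%R]%classic.
have mI : measurable I01 by exact: measurable_itv.
pose pm : {measure set R -> \bar R} := pushforward (U : {measure set E -> \bar R}) f.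
pose lm : {measure set R -> \bar R} := mrestr lebesgueR mI.
have pmE : forall A, measurable A -> pm mf A = lm A.
  apply: (measure_unique (@RGenInftyO.G R) (fun n => `]-oo, n%:R[%classic)).
  - exact: RGenInftyO.measurableE.
  - move=> _ _ [a ->] [b ->]; exists (Num.min a b).
    by apply/seteqP; split => z /=; rewrite !in_itv/= lt_min => /andP.
  - by move=> n; exists n%:R.
  - apply/seteqP; split => // z _; exists (Num.truncn z).+1 => //=.
    by rewrite in_itv/= truncnS_gt.
  - move=> _ [a ->].
    have lE : lm `]-oo, a[%classic = (Num.min 1 (Num.max 0 a))%:E.
      rewrite /lm/= /mrestr.
      have [a0|a0] := leP a 0%R.
        rewrite (_ : _ `&` _ = set0) ?measure0 ?(min_r ler01)//.
        apply/seteqP; split => // z [/=]; rewrite /I01/= !in_itv/= => za /andP[z0 _].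
        by have := lt_le_trans za a0; rewrite ltNge z0.
      have [a1|a1] := ltP 1%R a.
        rewrite (_ : _ `&` _ = `[0%R, 1%R]%classic).
          by rewrite /lebesgueR lebesgue_measure_itv/= lte_fin ltr01 sube0.
        apply/seteqP; split => z; rewrite /I01/=; first by case.
        by rewrite !in_itv/= => /andP[z0 z1]; rewrite z0 z1 (le_lt_trans z1).
      rewrite (_ : _ `&` _ = `[0%R, a[%classic).
        by rewrite /lebesgueR lebesgue_measure_itv/= lte_fin a0 sube0.
      apply/seteqP; split => z; rewrite /I01/= !in_itv/=.
        by move=> [-> /andP[->]].
      by move=> /andP[z0 za]; rewrite z0 za ltW// (lt_le_trans za).
    rewrite lE; rewrite /pm/= /pushforward.
    have [a0|a0] := leP a 0%R.
      rewrite (_ : _ @^-1` _ = set0) ?measure0 ?(min_r ler01)//.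
      apply/seteqP; split => // u /=; rewrite in_itv/= => fa.
      have := lt_le_trans fa a0; rewrite ltNge exprn_ge0//.
      exact: edist_ge0.
    pose r := (a `^ (d%:R^-1))%R.
    have r0 : (0 < r)%R by exact: powR_gt0.
    have rd : (r ^+ d = a)%R.
      rewrite -powR_mulrn ?(ltW r0)// /r -powRrM mulVf ?powRr1 ?(ltW a0)//.
      by rewrite pnatr_eq0 -lt0n.
    have -> : f @^-1` `]-oo, a[%classic = eball o r.
      apply/seteqP; split => u; rewrite /eball/= in_itv/= /f -rd.
        by rewrite ltr_pXn2r ?nnegrE ?edist_ge0// ltW.
      by rewrite ltr_pXn2r ?nnegrE ?edist_ge0// ltW.
    have [a1|a1] := leP a 1%R.
      rewrite unif_ball_ball ?rd//.
      rewrite (ltW r0)/= -(@ler_pXn2r _ d)// ?nnegrE ?(ltW r0)//.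
      by rewrite rd expr1n.
    apply/eqP; rewrite eq_le probability_le1/=.
      rewrite -[X in X <= _](_ : U (eball o 1%R) = 1).
        apply: le_measure; rewrite ?inE; try exact: measurable_eball.
        move=> u; rewrite /eball/= => /lt_le_trans; apply.
        rewrite -(@ler_pXn2r _ d)// ?nnegrE ?(ltW r0)// rd expr1n; exact: ltW.
      by rewrite unif_ball_ball ?expr1n// ler01 lexx.
    exact: measurable_eball.
  - move=> n; rewrite (le_lt_trans _ (ltry 1%R))//.
    by rewrite /pm/= /pushforward probability_le1//; apply: measurable_preimage.
transitivity (\int[lm]_s g s).
  have := ge0_integral_pushforward mf U measurableT mg (fun a _ => g0 a).
  rewrite preimage_setT => <-.
  by apply: eq_measure_integral => A mA _; exact: pmE.
rewrite (ge0_integral_density (m := lebesgueR) (f := \1_I01))//.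
- rewrite -ge0_integral_lebesgueR//; last exact: measurable_funTS.
  rewrite [RHS]integral_mkcond; apply: eq_integral => s _.
  by rewrite patchE indicE; case: ifPn => _; rewrite ?mule1 ?mule0.
- move=> A mA; rewrite integral_indic//.
  by rewrite /lm/= /mrestr setIC.
Qed.

End unif_ball_radius.

Section scaling_limit.
Context {R : realType} {d : nat}.
Notation E := (d.-tuple R).
Notation U := (unif_ball d).
Notation o := (@origin R d).
Notation e1 := (@e1 R d).
Hypothesis d_gt0 : (0 < d)%N.
Local Open Scope ereal_scope.

Lemma unif_ball_sphere0 (r : R) : U [set v | edist o v = r] = 0 :> \bar R.
Proof.
rewrite unif_ballE; apply/eqP; rewrite mule_eq0; apply/orP; left.
rewrite -measure_le0 -(@lebesgue_sphere0 R d o r d_gt0).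
have mS : measurable [set v | edist o v = r].
  rewrite (_ : [set _ | _] = edist o @^-1` [set r])//.
  by apply: measurable_preimage => //; exact: measurable_edist.
have mB : measurable (eball o 1%R) by exact: measurable_eball.
by apply: le_measure; rewrite ?inE//; exact: measurableI.
Qed.

(** The normalized configuration: the farthest point is [e1], at index 0, and the nucleus has index
    [i]. Thus [i = 0] is the case [W = 0]. *)
Definition creg_e1 k (i : 'I_k.+1) (u : k.-tuple E) : set E :=
  creg o i (tcons (e1, u)).

Lemma measurable_rvol_creg_e1 k (i : 'I_k.+1) :
  measurable_fun setT (fun u => rvol (creg_e1 i u)).
Proof.
apply: (measurableT_comp (@measurable_rvol_creg R d k.+1 o i)).
exact: (measurable_fun_tcons (f := cst e1) (g := id)).
Qed.

(** The origin and [e1] are at distance 1, so the nucleus is at distance at least 1/2 from one of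
    them, and the region contains the ball around that one reaching to the nucleus. All uniform
    bounds on inverse moments come from here. *)
Lemma rvol_creg_e1_ge k (i : 'I_k.+1) u : (2 ^- d <= rvol (creg_e1 i u))%R.
Proof.
have [r _ cr] := creg_bounded o i (tcons (e1, u)).
have mc := measurable_creg o i (tcons (e1, u)).
have ball_le x s : (2^-1 <= s)%R -> eball x s `<=` creg_e1 i u ->
    (2 ^- d <= rvol (creg_e1 i u))%R.
  move=> s2 xs; have s0 : (0 < s)%R by apply: lt_le_trans s2; rewrite invr_gt0.
  apply: (@le_trans _ _ (rvol (eball x s))).
    by rewrite rvol_ball// -exprVn lerXn2r// nnegrE ltW// invr_gt0.
  by apply: le_rvol cr => //; exact: measurable_eball.
set y := tnth (tcons (e1, u)) i.
have [y2|y2] := leP 2^-1%R (edist o y).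
  by apply: (ball_le o _ y2) => v ov; left.
apply: (ball_le e1 (edist e1 y)).
  have := edist_triangle o y e1; rewrite edist_e1// (edistC y e1) => ?.
  by move: y2; lra.
by move=> v ev; right; exists ord0.
Qed.

Lemma rvol_creg_e1_gt0 k (i : 'I_k.+1) u : (0 < rvol (creg_e1 i u))%R.
Proof.
by apply: lt_le_trans (rvol_creg_e1_ge i u); rewrite invr_gt0 exprn_gt0.
Qed.

Lemma map_tuple_tcons (phi : E -> E) k (a : E) (u : k.-tuple E) :
  tcons (phi a, tuple_mapi (fun=> phi) u) = map_tuple phi (tcons (a, u)).
Proof.
apply: eq_from_tnth => j; rewrite tnth_map.
by case: (unliftP ord0 j) => [l|] -> //; rewrite !tnthS tnth_mktuple.
Qed.

(* Conditionally on the farthest point being [a], the other points are uniform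
   in the ball of radius [|a|], and a similarity maps [e1] to [a]. *)
Lemma integral_farthest k (i : 'I_k.+1) (c : R) : (0 < k)%N -> (0 <= c)%R ->
  \int[tuple_product U k.+1]_(q in argmax_set (edist o) ord0)
     (expR (- (c * rvol (creg o i q))))%:E =
  \int[tuple_product U k]_u \int[lebesgue_measure]_(s in `[0%R, 1%R])
     (s ^+ k * expR (- (c * rvol (creg_e1 i u) * s)))%:E.
Proof.
move=> k0 c0.
pose g q : \bar R := (expR (- (c * rvol (creg o i q))))%:E.
have mo : measurable_fun setT (edist o) by exact: measurable_edist.
have mexp d1 (T : measurableType d1) (h : T -> R) : measurable_fun setT h ->
    measurable_fun setT (fun t => (expR (- h t))%:E).
  move=> mh; apply/measurable_EFinP; apply: measurableT_comp => //.
  exact: measurable_funN.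
have mg : measurable_fun setT g.
  by apply: mexp; apply: measurable_funM => //; exact: measurable_rvol_creg.
have g0 q : 0 <= g q by rewrite lee_fin expR_ge0.
have mA : measurable (@argmax_set _ _ R (edist o) k.+1 ord0).
  exact: measurable_argmax_set.
have mgA : measurable_fun setT (g \_ (argmax_set (edist o) ord0)).
  by apply/(measurable_restrictT g mA); exact: measurable_funTS.
have gA0 q : 0 <= (g \_ (argmax_set (edist o) ord0)) q.
  by rewrite patchE; case: ifPn.
pose h (p : E * k.-tuple E) : R := ((edist o p.1 ^+ d) ^+ k *
  expR (- (c * rvol (creg_e1 i p.2) * edist o p.1 ^+ d)))%R.
have mh : measurable_fun setT (fun p => (h p)%:E).
  apply/measurable_EFinP; apply: measurable_funM.
    by do 2 apply: measurable_funX; exact: measurableT_comp.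
  apply: measurableT_comp => //; apply: measurable_funN.
  apply: measurable_funM; last by apply: measurable_funX; exact: measurableT_comp.
  apply: measurable_funM => //.
  exact: (measurableT_comp (measurable_rvol_creg_e1 i) measurable_snd).
have h0 p : 0 <= (h p)%:E.
  by rewrite lee_fin mulr_ge0 ?expR_ge0// !exprn_ge0// edist_ge0.
transitivity (\int[U]_a \int[tuple_product U k]_u (h (a, u))%:E).
  rewrite integral_mkcond (ge0_integral_tuple_productS U mgA gA0).
  apply: eq_integral_unif_ball.
  - exact: measurable_tuple_productS.
  - exact: (@measurable_fun_fubini_tonelli_F _ _ _ _ R (tuple_product U k) _ mh h0).
  - by move=> a; apply: integral_ge0.
  - by move=> a; apply: integral_ge0.
  move=> a a1.
  have mB : measurable (eball o (edist o a)) by exact: measurable_eball.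
  transitivity (\int[tuple_product U k]_(t in tuple_box
      (fun=> eball o (edist o a))) g (tcons (a, t))).
    rewrite [RHS]integral_mkcond; apply: eq_integral => t _; rewrite !patchE.
    congr (if _ then _ else _); apply/idP/idP => /set_mem H; rewrite inE => j.
      by have := H (lift ord0 j); rewrite tnthS; exact.
    by case: (unliftP ord0 j) => [l|] ->; rewrite ?eqxx// tnthS => _; exact: H.
  have := edist_ge0 o a; rewrite le_eqVlt => /predU1P[a0|a0].
    (* The farthest point is the origin: the ball of radius 0 is empty, hence so is the box since
       [k > 0], and the other side contains a positive power of 0. *)
    rewrite -a0 (_ : tuple_box _ = set0) ?integral_set0.
      apply/esym/integral0_eq => u _.
      by rewrite /h/= -a0 !expr0n !gtn_eqF//= expr0n gtn_eqF// mul0r.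
    apply/seteqP; split => // t /(_ (Ordinal k0)).
    by rewrite /eball/= ltNge edist_ge0.
  have [w wE] := sim_e1 d_gt0 (lt0r_neq0 a0).
  have r01 : (0 < edist o a <= 1)%R by rewrite a0 ltW.
  pose phi := sim o (edist o a) w.
  have mga : measurable_fun setT (fun t : k.-tuple E => g (tcons (a, t))).
    apply: (measurableT_comp mg).
    exact: (measurable_fun_tcons (f := cst a) (g := id)).
  rewrite (@ge0_integral_tuple_mapi _ _ R U U k (eball o (edist o a))
    (edist o a ^+ d)%R (fun=> phi))//.
  - pose gphi (u : k.-tuple E) : \bar R := g (tcons (a, tuple_mapi (fun=> phi) u)).
    have mgphi : measurable_fun setT gphi.
      apply: (measurableT_comp mga); apply: measurable_tuple_mapi => _.
      exact: measurable_sim.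
    have gphi0 u : setT u -> 0 <= gphi u by move=> _; exact: g0.
    have ak0 : (0 <= (edist o a ^+ d) ^+ k)%R by rewrite !exprn_ge0// ltW.
    transitivity (\int[tuple_product U k]_u (((edist o a ^+ d) ^+ k)%:E * gphi u)).
      by apply/esym/ge0_integralZl; rewrite ?lee_fin.
    apply: eq_integral => u _; rewrite /h/= /gphi /g -EFinM.
    congr (_ * expR (- _))%:E.
    rewrite -{1}wE map_tuple_tcons -{1}(sim_origin o (edist o a) w).
    by rewrite rvol_creg_sim//; ring.
  - by rewrite exprn_ge0// ltW.
  - by move=> _; exact: measurable_sim.
  - by move=> _ f mf f0; exact: ge0_integral_unif_ball_sim.
rewrite (fubini_tonelli (fun p => (h p)%:E))//.
apply: eq_integral => u _.
have ms : measurable_fun setT (fun s : R =>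
    (s ^+ k * expR (- (c * rvol (creg_e1 i u) * s)))%:E).
  apply/measurable_EFinP; apply: measurable_funM; first exact: measurable_funX.
  by apply: measurableT_comp => //; apply: measurable_funN; exact: measurable_funM.
(* The absolute value makes the integrand nonnegative on the whole line, as
   [ge0_integral_unif_radius] requires, and changes nothing on [[0, 1]]. *)
pose gs (s : R) : \bar R := (`|s| ^+ k * expR (- (c * rvol (creg_e1 i u) * s)))%:E.
transitivity (\int[U]_a gs (edist o a ^+ d)%R).
  by apply: eq_integral => a _; rewrite /gs /h ger0_norm// exprn_ge0// edist_ge0.
rewrite ge0_integral_unif_radius//.
- apply: eq_integral => s /[!inE]; rewrite /= in_itv/= => /andP[s0 _].
  by rewrite /gs ger0_norm.
- apply/measurable_EFinP; apply: measurable_funM.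
    by apply: measurable_funX; exact: normr_measurable.
  by apply: measurableT_comp => //; apply: measurable_funN; exact: measurable_funM.
- by move=> s; rewrite lee_fin mulr_ge0 ?expR_ge0// exprn_ge0.
Qed.

(** By the Mecke formula, this is the moment of order [k] of [T] for a Poisson process with [c]
    expected points in the unit ball: one factor [c] counts the nucleus, the others are the scale of
    [T]. *)
Definition poisson_moment k (c : R) : \bar R :=
  (c ^+ k.+1)%:E * \int[tuple_product U k.+1]_q
     (expR (- (c * rvol (creg o ord0 q))))%:E.

Definition inv_moment k (i : 'I_k.+1) : \bar R :=
  \int[tuple_product U k]_u (k`!%:R / rvol (creg_e1 i u) ^+ k.+1)%:E.

Lemma measurable_invr d1 (T : measurableType d1) (f : T -> R) :
  measurable_fun setT f -> (forall t, (0 < f t)%R) ->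
  measurable_fun setT (fun t => (f t)^-1)%R.
Proof.
move=> mf f0; apply: (eq_measurable_fun (fun t => expR (- ln (f t)))).
  by move=> t _; rewrite -lnV ?posrE// lnK// posrE invr_gt0.
apply: measurableT_comp => //; apply: measurable_funN.
exact: (measurableT_comp (@measurable_ln R) mf).
Qed.

Lemma measurable_inv_moment k (i : 'I_k.+1) :
  measurable_fun setT (fun u => k`!%:R / rvol (creg_e1 i u) ^+ k.+1)%R.
Proof.
apply: measurable_funM => //; apply: measurable_invr.
  by apply: measurable_funX; exact: measurable_rvol_creg_e1.
by move=> u; rewrite exprn_gt0// rvol_creg_e1_gt0.
Qed.

Lemma measurable_gamma_tail d1 (T : measurableType d1) k (f : T -> R) :
  measurable_fun setT f -> measurable_fun setT (fun t => gamma_tail k (f t)).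
Proof.
move=> mf; apply: measurable_funM.
  by apply: measurableT_comp => //; exact: measurable_funN.
apply: (measurableT_comp _ mf); apply: continuous_measurable_fun.
exact: continuous_horner.
Qed.

Lemma poisson_momentE k (c : R) : (0 < k)%N -> (0 < c)%R ->
  poisson_moment k c = \sum_(i < k.+1) \int[tuple_product U k]_u
    (k`!%:R / rvol (creg_e1 i u) ^+ k.+1 *
     (1 - gamma_tail k (c * rvol (creg_e1 i u))))%:E.
Proof.
move=> k0 c0; rewrite /poisson_moment.
have mexp n (i : 'I_n) : measurable_fun setT (fun q : n.-tuple E =>
    (expR (- (c * rvol (creg o i q))))%:E).
  apply/measurable_EFinP; apply: measurableT_comp => //.
  apply: measurable_funN; apply: measurable_funM => //.
  exact: measurable_rvol_creg.
have exp0 n (i : 'I_n) (q : n.-tuple E) :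
    0 <= (expR (- (c * rvol (creg o i q))))%:E by rewrite lee_fin expR_ge0.
have mo : measurable_fun setT (edist o) by exact: measurable_edist.
rewrite (ge0_integral_argmax_set unif_ball_setT mo unif_ball_sphere0 (mexp _ _)
  (exp0 _ _)).
rewrite ge0_sume_distrr; last by move=> i _; exact: integral_ge0.
apply: eq_bigr => i _.
rewrite (ge0_integral_argmax_set_perm unif_ball_setT mo i (mexp _ _) (exp0 _ _)).
under eq_integral do rewrite creg_perm tpermL.
rewrite integral_farthest// ?(ltW c0)//.
have cR0 u : (0 < c * rvol (creg_e1 i u))%R by rewrite mulr_gt0// rvol_creg_e1_gt0.
under eq_integral do rewrite integral_power_exp//.
rewrite -ge0_integralZl//.
- apply: eq_integral => u _; rewrite -EFinM; congr EFin.
  have Rn0 : (rvol (creg_e1 i u) ^+ k.+1 != 0)%R.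
    by rewrite expf_neq0// gt_eqF// rvol_creg_e1_gt0.
  have cn0 : (c ^+ k.+1 != 0)%R by rewrite expf_neq0// gt_eqF.
  by rewrite exprMn; field; rewrite ?Rn0 ?cn0.
- apply/measurable_EFinP; apply: measurable_funM.
    apply: measurable_funM => //; apply: measurable_invr.
      apply: measurable_funX; apply: measurable_funM => //.
      exact: measurable_rvol_creg_e1.
    by move=> u; rewrite exprn_gt0.
  apply: measurable_funB => //; apply: measurable_gamma_tail.
  by apply: measurable_funM => //; exact: measurable_rvol_creg_e1.
- move=> u _; rewrite -integral_power_exp//; apply: integral_ge0 => s.
  rewrite /= in_itv/= => /andP[s0 _].
  by rewrite lee_fin mulr_ge0 ?expR_ge0// exprn_ge0.
- by rewrite lee_fin exprn_ge0// ltW.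
Qed.

Lemma inv_moment_bound k (i : 'I_k.+1) u :
  (0 <= k`!%:R / rvol (creg_e1 i u) ^+ k.+1 <= k`!%:R * (2 ^+ d) ^+ k.+1)%R.
Proof.
have R0 := rvol_creg_e1_gt0 i u.
rewrite divr_ge0 ?exprn_ge0 ?(ltW R0)//= ler_wpM2l//.
rewrite -exprVn lerXn2r ?nnegrE ?invr_ge0 ?(ltW R0) ?exprn_ge0//.
rewrite -[leRHS]invrK lef_pV2 ?posrE ?invr_gt0 ?exprn_gt0//.
exact: rvol_creg_e1_ge.
Qed.

Lemma inv_moment_fin k (i : 'I_k.+1) :
  0 <= inv_moment i <= (k`!%:R * (2 ^+ d) ^+ k.+1)%:E.
Proof.
apply/andP; split.
  by apply: integral_ge0 => u _; rewrite lee_fin; case/andP : (inv_moment_bound i u).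
have B0 : (0 <= k`!%:R * (2 ^+ d) ^+ k.+1 :> R)%R by rewrite mulr_ge0// !exprn_ge0.
apply: (@le_trans _ _ (\int[tuple_product U k]_u (k`!%:R * (2 ^+ d) ^+ k.+1)%:E)).
  apply: ge0_le_integral => //.
  - by move=> u _; rewrite lee_fin; case/andP : (inv_moment_bound i u).
  - by apply/measurable_EFinP; exact: measurable_inv_moment.
  - by move=> u _; rewrite lee_fin; case/andP : (inv_moment_bound i u).
rewrite integral_cst//.
rewrite [X in _ * X](_ : _ = 1) ?mule1//.
exact: (tuple_productT unif_ball_setT k).
Qed.

(** The lower bound on the regions makes every [gamma_tail] at most [(k + 1)^2 * 2^d / c], uniformly
    in the configuration, so the limit in [c] follows by squeezing. *)
Lemma poisson_moment_sandwich k (c : R) : (0 < k)%N -> (0 < c)%R ->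
  (k.+1%:R ^+ 2 * 2 ^+ d <= c)%R ->
  (1 - k.+1%:R ^+ 2 * 2 ^+ d / c)%:E * (\sum_(i < k.+1) inv_moment i) <=
  poisson_moment k c <= \sum_(i < k.+1) inv_moment i.
Proof.
move=> k0 c0 ck; set e := (_ / c)%R.
have e1 : (e <= 1)%R by rewrite ler_pdivrMr// mul1r.
rewrite poisson_momentE// ge0_sume_distrr; last first.
  by move=> i _; case/andP : (inv_moment_fin i).
have mI (i : 'I_k.+1) :
    measurable_fun setT (fun u => (k`!%:R / rvol (creg_e1 i u) ^+ k.+1)%:E).
  by apply/measurable_EFinP; exact: measurable_inv_moment.
have mG (i : 'I_k.+1) : measurable_fun setT (fun u =>
    (k`!%:R / rvol (creg_e1 i u) ^+ k.+1 *
     (1 - gamma_tail k (c * rvol (creg_e1 i u))))%:E).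
  apply/measurable_EFinP; apply: measurable_funM.
    exact: measurable_inv_moment.
  apply: measurable_funB => //; apply: measurable_gamma_tail.
  by apply: measurable_funM => //; exact: measurable_rvol_creg_e1.
have tail (i : 'I_k.+1) u :
    (0 <= gamma_tail k (c * rvol (creg_e1 i u)) <= e)%R.
  have R0 := rvol_creg_e1_gt0 i u.
  have cR0 : (0 < c * rvol (creg_e1 i u))%R by rewrite mulr_gt0.
  rewrite gamma_tail_ge0 ?(ltW cR0)//=.
  apply: (le_trans (gamma_tail_le k cR0)).
  rewrite /e -mulrA ler_wpM2l ?exprn_ge0//.
  rewrite invfM mulrC ler_wpM2r ?invr_ge0 ?(ltW c0)//.
  rewrite -[leRHS]invrK lef_pV2 ?posrE ?invr_gt0 ?exprn_gt0//.
  exact: rvol_creg_e1_ge.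
apply/andP; split; apply: lee_sum => i _.
  rewrite -ge0_integralZl//.
  - apply: ge0_le_integral => //.
    + move=> u _; rewrite mule_ge0// lee_fin ?subr_ge0//.
      by case/andP : (inv_moment_bound i u).
    + by apply: emeasurable_funM.
    + move=> u _; have /andP[_ te] := tail i u.
      rewrite -EFinM lee_fin mulrC ler_wpM2l//.
        by case/andP : (inv_moment_bound i u).
      by rewrite lerD2l lerN2.
  - by move=> u _; rewrite lee_fin; case/andP : (inv_moment_bound i u).
  - by rewrite lee_fin subr_ge0.
apply: ge0_le_integral => //.
- move=> u _; have /andP[_ te] := tail i u.
  rewrite lee_fin mulr_ge0 ?subr_ge0 ?(le_trans te)//.
  by case/andP : (inv_moment_bound i u).
- move=> u _; have /andP[t0 _] := tail i u.
  rewrite lee_fin ler_piMr ?gerBl//.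
  by case/andP : (inv_moment_bound i u).
Qed.

Lemma sum_inv_moment_fin k : \sum_(i < k.+1) @inv_moment k i \is a fin_num.
Proof.
apply/sum_fin_numP => i _ _; have /andP[i0 i1] := inv_moment_fin i.
by rewrite ge0_fin_numE// (le_lt_trans i1)// ltry.
Qed.

Lemma poisson_moment_cvg k : (0 < k)%N ->
  poisson_moment k n%:R @[n --> \oo] --> \sum_(i < k.+1) @inv_moment k i.
Proof.
move=> k0; set S := \sum_(i < _) _.
have Sf : S \is a fin_num by exact: sum_inv_moment_fin.
pose K : R := (k.+1%:R ^+ 2 * 2 ^+ d)%R.
apply: (@squeeze_cvge _ _ _ _ (fun n => (1 - K / n%:R)%:E * S) _ (fun=> S)).
- near=> n; have n0 : (0 < n%:R :> R)%R by rewrite ltr0n; near: n; exact: nbhs_infty_gt.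
  apply: poisson_moment_sandwich => //.
  by near: n; exact: nbhs_infty_ger.
- rewrite -[X in _ --> X]mul1e; apply: cvgeZr => //.
  apply: cvg_EFin; first exact: nearW.
  rewrite -[X in _ --> X]subr0; apply: cvgB; first exact: cvg_cst.
  rewrite -[X in _ --> X](mulr0 K); apply: cvgM; first exact: cvg_cst.
  by apply/gtr0_cvgV0; [near=> n; rewrite ltr0n; near: n; exact: nbhs_infty_gt|
    exact: cvgr_idn].
- exact: cvg_cst.
Unshelve. all: by end_near. Qed.

End scaling_limit.

(** * The moments of the limit law *)

Section D_moments.
Context {R : realType} {d : nat}.
Notation E := (d.-tuple R).
Notation U := (unif_ball d).
Notation o := (@origin R d).
Notation e1 := (@e1 R d).
Hypothesis d_gt0 : (0 < d)%N.
Local Open Scope ereal_scope.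

Lemma creg_e1_perm k (i : 'I_k.+1) (u : k.+1.-tuple E) :
  creg_e1 (lift ord0 ord0) (tuple_perm (tperm ord0 i) u) =
  creg_e1 (lift ord0 i) u.
Proof.
rewrite /creg_e1 /creg !tnthS tnth_mktuple tpermL.
apply/seteqP; split => v /= [|[j jv]]; try by left.
  right; move: jv; case: (unliftP ord0 j) => [l|] -> jv; last by exists ord0.
  exists (lift ord0 (tperm ord0 i l)).
  by move: jv; rewrite !tnthS tnth_mktuple.
right; move: jv; case: (unliftP ord0 j) => [l|] -> jv; last by exists ord0.
exists (lift ord0 (tperm ord0 i l)).
by move: jv; rewrite !tnthS tnth_mktuple tpermK.
Qed.

(** The uniform points are exchangeable, so it does not matter which of them is the nucleus. *)
Lemma inv_moment_lift k (i : 'I_k.+1) :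
  @inv_moment R d k.+1 (lift ord0 i) = @inv_moment R d k.+1 (lift ord0 ord0).
Proof.
pose g (u : k.+1.-tuple E) : \bar R :=
  (k.+1`!%:R / rvol (creg_e1 (lift ord0 ord0) u) ^+ k.+2)%:E.
have mg : measurable_fun setT g.
  by apply/measurable_EFinP; exact: measurable_inv_moment.
have g0 u : 0 <= g u.
  by rewrite lee_fin; case/andP : (inv_moment_bound d_gt0 (lift ord0 ord0) u).
rewrite -[RHS]/(\int[tuple_product U k.+1]_u g u).
rewrite -(ge0_integral_tuple_perm (tperm ord0 i) unif_ball_setT mg g0).
by apply: eq_integral => u _; rewrite /g creg_e1_perm.
Qed.

Lemma D_var_false k (u : k.-tuple E) :
  D_var false u = rvol (creg_e1 (ord0 : 'I_k.+1) u).
Proof.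
rewrite /D_var/= mulr1 mulr0 addr0 /rvol /ball_vol; congr (fine (lebesgue d _) / _)%R.
rewrite /creg_e1 /creg; apply/seteqP; split => v /=.
  case=> [[w /= /tnthP[j ->] jv]|ov]; last by left; rewrite edist_e1.
  by right; exists (lift ord0 j); rewrite tnthS (edistC _ e1).
rewrite edist_e1//; case=> [|[j]]; first by right.
case: (unliftP ord0 j) => [l|] ->.
  rewrite tnthS (edistC _ e1) => lv; left; exists (tnth u l) => //=.
  exact: mem_tnth.
by move=> /=; rewrite edistxx ltNge edist_ge0.
Qed.

Lemma D_var_true k (u : k.+1.-tuple E) :
  D_var true u = rvol (creg_e1 (lift ord0 ord0 : 'I_k.+2) u).
Proof.
rewrite /D_var/= mulr1 mulr0 add0r /rvol /ball_vol; congr (fine (lebesgue d _) / _)%R.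
have -> : head o u = tnth u ord0 by rewrite (tnth_nth o) nth0.
rewrite /creg_e1 /creg tnthS; set y := tnth u ord0.
apply/seteqP; split => v /=.
  case=> [[ev|[w /= wu wv]]|ov]; last by left.
    by right; exists ord0.
  have /tnthP[j wE] : w \in u by exact: mem_behead.
  by right; exists (lift ord0 j); rewrite tnthS -wE (edistC w y).
case=> [|[j]]; first by right.
case: (unliftP ord0 j) => [l|] ->; last by left; left.
rewrite tnthS; case: (unliftP ord0 l) => [l'|] -> lv.
  left; right; exists (tnth u (lift ord0 l')) => /=; last by rewrite (edistC y).
  by rewrite (tnth_nth o) lift0 -nth_behead mem_nth// size_behead size_tuple.
by move: lv; rewrite edistxx ltNge edist_ge0.
Qed.

(** The weight [1 / (k + 1)] of [W = 0] turns [(k + 1)!] into the factor [k!] of index 0. The weight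
    [k / (k + 1)] gives [k * k!], shared equally by the [k] other indices. *)
Lemma D_momentE k : (0 < k)%N ->
  @D_moment R d k = \sum_(i < k.+1) @inv_moment R d k i.
Proof.
case: k => // k _; rewrite /D_moment.
pose f0 (u : k.+1.-tuple E) : R := (k.+2`!%:R / rvol (creg_e1 (ord0 : 'I_k.+2) u) ^+ k.+2)%R.
pose f1 (u : k.+1.-tuple E) : R :=
  (k.+2`!%:R / rvol (creg_e1 (lift ord0 ord0 : 'I_k.+2) u) ^+ k.+2)%R.
have mf (i : 'I_k.+2) : measurable_fun setT (fun u : k.+1.-tuple E =>
    (k.+2`!%:R / rvol (creg_e1 i u) ^+ k.+2)%R).
  apply: measurable_funM => //; apply: measurable_invr.
    by apply: measurable_funX; exact: measurable_rvol_creg_e1.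
  by move=> u; rewrite exprn_gt0// rvol_creg_e1_gt0.
have f_ge0 (i : 'I_k.+2) (u : k.+1.-tuple E) :
    (0 <= k.+2`!%:R / rvol (creg_e1 i u) ^+ k.+2)%R.
  by rewrite divr_ge0 ?exprn_ge0// ltW// rvol_creg_e1_gt0.
have DE (p : bool * k.+1.-tuple E) :
    (k.+2`!%:R / D_var p.1 p.2 ^+ k.+2)%R = if p.1 then f1 p.2 else f0 p.2.
  by case: p => -[] u /=; rewrite ?D_var_true ?D_var_false.
under eq_integral do rewrite DE.
pose F (p : bool * k.+1.-tuple E) : \bar R := (if p.1 then f1 p.2 else f0 p.2)%:E.
have mF : measurable_fun setT F.
  apply/measurable_EFinP; apply: measurable_fun_ifT => //=.
  - exact: (measurableT_comp (mf (lift ord0 ord0)) measurable_snd).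
  - exact: (measurableT_comp (mf ord0) measurable_snd).
have F0 p : 0 <= F p by rewrite lee_fin; case: ifP => _; exact: f_ge0.
rewrite (fubini_tonelli1 F mF F0) /fubini_F.
have p01 : (0 <= (k.+1%:R / k.+2%:R : R) <= 1)%R.
  by rewrite divr_ge0//= ler_pdivrMr// mul1r ler_nat.
rewrite (@integral_bernoulli_prob R _ p01 _
  (fun w => integral_ge0 _ (fun u _ => F0 (w, u)))).
rewrite big_ord_recl addeC; congr (_ + _).
  rewrite /F/= -ge0_integralZl//.
  - apply: eq_integral => u _; rewrite -EFinM; congr EFin.
    rewrite /f0 mulrA; congr (_ / _)%R.
    rewrite /unstable.onem factS natrM; field.
    by rewrite ?nat1r ?pnatr_eq0.
  - by apply/measurable_EFinP; exact: mf.
  - by move=> u _; rewrite lee_fin; exact: f_ge0.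
  - by rewrite lee_fin subr_ge0; case/andP : p01.
have /andP[I0 I1] := @inv_moment_fin R d d_gt0 k.+1 (lift ord0 ord0).
have If : @inv_moment R d k.+1 (lift ord0 ord0) \is a fin_num.
  by rewrite ge0_fin_numE// (le_lt_trans I1)// ltry.
rewrite (eq_bigr (fun=> @inv_moment R d k.+1 (lift ord0 ord0))); last first.
  by move=> i _; rewrite inv_moment_lift.
have -> : \int[tuple_product U k.+1]_u F (true, u) =
    k.+2%:R%:E * @inv_moment R d k.+1 (lift ord0 ord0).
  rewrite -ge0_integralZl//.
  - apply: eq_integral => u _; rewrite /F/= -EFinM /f1 mulrA; congr (_ / _)%:E.
    by rewrite [in LHS]factS natrM.
  - by apply/measurable_EFinP; exact: measurable_inv_moment.
  - by move=> u _; rewrite lee_fin; case/andP : (inv_moment_bound d_gt0 (lift ord0 ord0) u).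
rewrite -(fineK If) sumEFin -!EFinM sumr_const card_ord -[in RHS]mulr_natl.
by congr EFin; field; rewrite ?nat1r ?pnatr_eq0.
Qed.

Lemma D_moment_le k : (0 < k)%N ->
  @D_moment R d k <= (k.+1`!%:R * (2 ^+ d) ^+ k.+1)%:E.
Proof.
move=> k0; rewrite D_momentE//.
apply: (@le_trans _ _ (\sum_(i < k.+1) (k`!%:R * (2 ^+ d) ^+ k.+1)%:E)).
  by apply: lee_sum => i _; case/andP : (@inv_moment_fin R d d_gt0 k i).
rewrite sumEFin lee_fin sumr_const card_ord -[leLHS]mulr_natl mulrA.
by rewrite factS natrM.
Qed.

Lemma D_moment_cvg k : (0 < k)%N ->
  @poisson_moment R d k n%:R @[n --> \oo] --> @D_moment R d k.
Proof. by move=> k0; rewrite D_momentE//; exact: poisson_moment_cvg. Qed.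

End D_moments.

(** * Local behaviour at a Lebesgue point *)

Section exp_limit.
Context {R : realType}.

(** Squeeze: [1 + t <= exp t] at [t = - a] bounds the power above by [exp (- m a)], and at
    [t = a / (1 - a)] it bounds it below by [exp (- m a / (1 - a))]. *)
Lemma cvg_onem_exp (a : nat -> R) (m : nat -> nat) (b : R) :
  (forall n, 0 <= a n <= 1) -> a n @[n --> \oo] --> 0 ->
  (m n)%:R * a n @[n --> \oo] --> b ->
  (1 - a n) ^+ m n @[n --> \oo] --> expR (- b).
Proof.
move=> a01 a0 mab.
have cexp (u : nat -> R) (l : R) : u n @[n --> \oo] --> l ->
    expR (- u n) @[n --> \oo] --> expR (- l).
  have ce : continuous (fun z : R => expR (- z)).
    move=> z; apply: (continuous_comp (f := fun z : R => - z)).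
      exact: opp_continuous.
    exact: continuous_expR.
  by move=> ul; exact: (cvg_comp _ _ ul (ce l)).
apply: (@squeeze_cvgr _ _ _ _ (fun n => expR (- ((m n)%:R * (a n / (1 - a n)))))
  (fun n => expR (- ((m n)%:R * a n)))).
- have : \forall n \near \oo, a n < 1 by apply: (cvgr_lt _ a0); exact: ltr01.
  apply: filterS => n a1; have /andP[an0 _] := a01 n.
  have a1' : 0 < 1 - a n by rewrite subr_gt0.
  apply/andP; split.
    rewrite -mulrN expRM_natl lerXn2r ?nnegrE ?expR_ge0 ?(ltW a1')//.
    rewrite expRN -[leRHS]invrK lef_pV2 ?posrE ?expR_gt0 ?invr_gt0//.
    have := expR_ge1Dx (a n / (1 - a n)); apply: le_trans.
    by rewrite le_eqVlt; apply/orP; left; apply/eqP; field; rewrite gt_eqF.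
  rewrite -mulrN expRM_natl lerXn2r ?nnegrE ?expR_ge0 ?(ltW a1')//.
  exact: expR_ge1Dx.
- apply: cexp; under eq_fun do rewrite mulrA.
  have : (m n)%:R * a n / (1 - a n) @[n --> \oo] --> b / (1 - 0).
    apply: cvgM => //; apply: cvgV; first by rewrite subr0 oner_neq0.
    by apply: cvgB => //; exact: cvg_cst.
  by rewrite subr0 divr1.
- exact: cexp.
Qed.

End exp_limit.

Section local_density.
Context {R : realType} {d : nat}.
Notation E := (d.-tuple R).
Notation lambda := (lebesgue d).
Notation V := (@ball_vol R d).
Notation U := (unif_ball d).
Notation o := (@origin R d).
Hypothesis d_gt0 : (0 < d)%N.
Variables (f : E -> R) (x : E) (mu : probability E R).
Hypothesis mf : measurable_fun setT f.
Hypothesis f_ge0 : forall u, 0 <= f u.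
Hypothesis muE : forall A, measurable A ->
  mu A = (\int[lambda]_(u in A) (f u)%:E)%E.
Hypothesis x_leb : lebesgue_point f x.
Hypothesis fx_gt0 : 0 < f x.
Local Open Scope ereal_scope.

Definition osc (r : R) : \bar R :=
  \int[U]_u (`|f (aff x r u) - f x|)%:E.

Let mfr (r : R) : measurable_fun setT (fun u => f (aff x r u)).
Proof. exact: (measurableT_comp mf (measurable_aff x r)). Qed.

Let mosc (r : R) : measurable_fun setT (fun u => (`|f (aff x r u) - f x|)%:E).
Proof.
apply/measurable_EFinP; apply: measurableT_comp; first exact: normr_measurable.
by apply: measurable_funB => //; exact: mfr.
Qed.

Lemma osc_ge0 r : 0 <= osc r.
Proof. by apply: integral_ge0 => u _; rewrite lee_fin. Qed.

Lemma osc_cvg : osc r @[r --> (0 : R)%R^'+] --> 0.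
Proof.
apply: cvg_trans x_leb; apply: near_eq_cvg; near=> r.
have r0 : (0 < r)%R by near: r; exact: nbhs_right_gt.
have V0 : (0 < V * r ^+ d)%R by rewrite mulr_gt0 ?ball_vol_gt0 ?exprn_gt0.
rewrite lebesgue_ball//.
have := @ge0_integral_ball_sim R d x r o (fun u => (`|f u - f x|)%:E) r0.
under eq_integral do rewrite /=.
move=> H; transitivity ((V * r ^+ d)%:E^-1 * ((V * r ^+ d)%:E * osc r)); last first.
  rewrite muleA inver gt_eqF// -EFinM mulVf ?mul1e//.
  by rewrite gt_eqF.
congr (_ * _); transitivity (\int[lambda]_(u in eball x r) (`|f u - f x|)%:E).
  by apply: eq_integral => u _.
rewrite H//.
  by congr (_ * _); apply: eq_integral => u _; rewrite sim0.
apply/measurable_EFinP; apply: measurableT_comp; first exact: normr_measurable.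
exact: measurable_funB.
Unshelve. all: by end_near. Qed.

Lemma mu_sphere0 (y : E) r : mu [set v | edist y v = r] = 0.
Proof.
have mS : measurable [set v | edist y v = r].
  rewrite (_ : [set _ | _] = edist y @^-1` [set r])//.
  by apply: measurable_preimage => //; exact: measurable_edist.
rewrite muE// null_set_integral//; last exact: lebesgue_sphere0.
by apply/measurable_EFinP; exact: measurable_funTS.
Qed.

(** Applies to sets of any shape: the error is the oscillation of [f] over a whole ball of radius
    [r * K] around [x], of volume comparable to that of the rescaled problem. The two bounds are
    kept as sums because the integrals are extended reals. *)
Lemma mu_approx r K (B : set E) : (0 < r)%R -> (0 < K)%R -> measurable B ->
  aff x r @^-1` B `<=` eball o K ->
  mu B <= (r ^+ d * (V * f x) * rvol (aff x r @^-1` B))%:E +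
          (r ^+ d * (V * K ^+ d))%:E * osc (r * K) /\
  (r ^+ d * (V * f x) * rvol (aff x r @^-1` B))%:E <=
    mu B + (r ^+ d * (V * K ^+ d))%:E * osc (r * K).
Proof.
move=> r0 K0 mB; set A := aff x r @^-1` B => AK.
have mA : measurable A by apply: measurable_preimage => //; exact: measurable_aff.
have mfA D : measurable_fun D (fun u => (f (aff x r u))%:E).
  by apply/measurable_EFinP; exact: (measurable_funTS (mfr r)).
have mcst D : measurable_fun D (cst (f x)%:E : E -> \bar R).
  exact: measurable_cst.
have mo D : measurable_fun D (fun u => (`|f (aff x r u) - f x|)%:E).
  exact: measurable_funTS.
have muBE : mu B = (r ^+ d)%:E * \int[lambda]_(u in A) (f (aff x r u))%:E.
  have mfB : measurable_fun setT ((EFin \o f) \_ B).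
    apply/(measurable_restrictT (EFin \o f) mB).
    by apply/measurable_EFinP; exact: measurable_funTS.
  have fB0 u : 0 <= ((EFin \o f) \_ B) u.
    by rewrite patchE; case: ifPn => // _; rewrite lee_fin.
  rewrite muE// integral_mkcond (ge0_integral_lebesgue_aff x r0 mfB fB0).
  rewrite [in RHS]integral_mkcond; congr (_ * _).
have rvE : (r ^+ d * (V * f x) * rvol A)%:E =
    (r ^+ d)%:E * \int[lambda]_(u in A) (f x)%:E.
  transitivity ((r ^+ d)%:E * ((f x)%:E * lambda A)).
    by rewrite (rvolE mA AK) -!EFinM; congr EFin; ring.
  by rewrite integral_cst.
have oE : \int[lambda]_(u in A) (`|f (aff x r u) - f x|)%:E <=
    (V * K ^+ d)%:E * osc (r * K).
  apply: (@le_trans _ _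
      (\int[lambda]_(u in eball o K) (`|f (aff x r u) - f x|)%:E)).
    apply: ge0_subset_integral => //; first exact: measurable_eball.
  rewrite (@ge0_integral_ball_sim R d o K o
    (fun u => (`|f (aff x r u) - f x|)%:E) K0 (mosc r))//.
  rewrite /osc le_eqVlt; apply/orP; left; apply/eqP; congr (_ * _).
  apply: eq_integral => u _; rewrite sim0; congr (`|f _ - _|)%:E.
  by apply: eq_from_tnth => i; rewrite !tnth_aff tnth_mktuple add0r mulrA.
have rd0 : 0 <= (r ^+ d)%:E by rewrite lee_fin exprn_ge0// ltW.
have norm_le (a b : R) : (a <= b + `|a - b|)%R.
  by have := ler_norm (a - b); lra.
split.
  rewrite rvE muBE [X in _ + X](_ : _ = (r ^+ d)%:E * ((V * K ^+ d)%:E * osc (r * K))); last first.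
    by rewrite muleA -EFinM.
  rewrite -ge0_muleDr ?mule_ge0 ?osc_ge0 ?lee_fin ?mulr_ge0 ?exprn_ge0 ?(ltW K0) ?(ltW (@ball_vol_gt0 R d))//; last first.
    by apply: integral_ge0 => u _; rewrite lee_fin.
  rewrite lee_wpmul2l//.
  apply: (@le_trans _ _ (\int[lambda]_(u in A) (f x)%:E +
      \int[lambda]_(u in A) (`|f (aff x r u) - f x|)%:E)); last exact: leeD2l.
  rewrite -ge0_integralD//.
  - apply: ge0_le_integral => //.
    + by move=> u _; rewrite lee_fin.
    + exact: emeasurable_funD.
    + by move=> u _; rewrite -EFinD lee_fin.
  - by move=> u _; rewrite lee_fin ltW.
rewrite rvE muBE [X in _ + X](_ : _ = (r ^+ d)%:E * ((V * K ^+ d)%:E * osc (r * K))); last first.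
  by rewrite muleA -EFinM.
rewrite -ge0_muleDr ?mule_ge0 ?osc_ge0 ?lee_fin ?mulr_ge0 ?exprn_ge0 ?(ltW K0) ?(ltW (@ball_vol_gt0 R d))//; last first.
  by apply: integral_ge0 => u _; rewrite lee_fin.
rewrite lee_wpmul2l//.
apply: (@le_trans _ _ (\int[lambda]_(u in A) (f (aff x r u))%:E +
    \int[lambda]_(u in A) (`|f (aff x r u) - f x|)%:E)); last exact: leeD2l.
rewrite -ge0_integralD//.
- apply: ge0_le_integral => //.
  + by move=> u _; rewrite lee_fin ltW.
  + exact: emeasurable_funD.
  + by move=> u _; rewrite -EFinD lee_fin distrC.
- by move=> u _; rewrite lee_fin.
Qed.

(* The radius for which the ball [B(x, r)] has [c] expected data points among
   [n] if the density were constantly [f x]. *)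
Definition rad (c : R) (n : nat) : R := ((c / (V * f x * n%:R)) `^ d%:R^-1)%R.

Lemma rad_gt0 c n : (0 < c)%R -> (0 < n)%N -> (0 < rad c n)%R.
Proof.
move=> c0 n0; apply: powR_gt0; rewrite divr_gt0// !mulr_gt0 ?ltr0n//.
exact: ball_vol_gt0.
Qed.

Lemma radX c n : (0 < c)%R -> (0 < n)%N ->
  (rad c n ^+ d = c / (V * f x * n%:R))%R.
Proof.
move=> c0 n0; have r0 := rad_gt0 c0 n0.
have V0 := @ball_vol_gt0 R d.
rewrite -powR_mulrn ?(ltW r0)// /rad -powRrM mulVf ?pnatr_eq0 -?lt0n//.
by rewrite powRr1// divr_ge0 ?(ltW c0)// !mulr_ge0 ?(ltW V0) ?(ltW fx_gt0).
Qed.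

Lemma rad_cvg c : (0 < c)%R -> rad c n @[n --> \oo] --> (0 : R)%R^'+.
Proof.
move=> c0; have V0 := @ball_vol_gt0 R d.
have r0 : \forall n \near \oo, (0 < rad c n)%R.
  by near=> n; apply: rad_gt0 => //; near: n; exact: nbhs_infty_gt.
move=> A [e /= e0 eA].
have e0' : (0 < V * f x * e ^+ d)%R by rewrite !mulr_gt0// exprn_gt0.
have n1 : \forall n \near \oo, (c / (V * f x * e ^+ d) < n%:R)%R.
  exact: nbhs_infty_gtr.
have n0 : \forall n \near \oo, (0 < n)%N by exact: nbhs_infty_gt.
change (\forall n \near \oo, A (rad c n)).
near=> n; have n0n : (0 < n)%N by near: n.
have r0n := rad_gt0 c0 n0n.
apply: eA => //=; rewrite sub0r normrN gtr0_norm//.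
rewrite -(@ltr_pXn2r _ d)// ?nnegrE ?ltW// radX//.
have : (c / (V * f x * e ^+ d) < n%:R)%R by near: n.
rewrite ltr_pdivrMr// => H.
by rewrite ltr_pdivrMr ?mulr_gt0 ?ltr0n//; apply: (lt_le_trans H);
  rewrite le_eqVlt; apply/orP; left; apply/eqP; ring.
Unshelve. all: by end_near. Qed.

Lemma osc_rad_cvg c K : (0 < c)%R -> (0 < K)%R ->
  osc (rad c n * K) @[n --> \oo] --> 0.
Proof.
move=> c0 K0; apply: (cvg_comp _ _ _ osc_cvg) => A [e /= e0 eA].
have := rad_cvg c0; move=> /(_ [set r | (0 < r < e / K)%R]) H.
have {}H : \forall n \near \oo, (0 < rad c n < e / K)%R.
  apply: H; exists (e / K)%R; first by rewrite /= divr_gt0.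
  by move=> r /=; rewrite sub0r normrN => + r0; rewrite gtr0_norm// r0.
apply: filterS H => n /andP[r0 r1]; apply: eA => /=; last by rewrite mulr_gt0.
by rewrite sub0r normrN gtr0_norm ?mulr_gt0// -ltr_pdivlMr.
Qed.

(** Rescaling must give one and the same bounded set for all [n]. The case [n = 0] is left out
    because [rad c 0] is 0. *)
Lemma scaled_mu_cvg c K (B : nat -> set E) (A : set E) :
  (0 < c)%R -> (0 < K)%R -> (forall n, measurable (B n)) ->
  (forall n, (0 < n)%N -> aff x (rad c n) @^-1` B n = A) -> A `<=` eball o K ->
  (n%:R * fine (mu (B n)))%R @[n --> \oo] --> (c * rvol A)%R.
Proof.
move=> c0 K0 mB BA AK; have V0 := @ball_vol_gt0 R d.
have /fine_cvgP[oscf osc0] := osc_rad_cvg c0 K0.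
(* [n] times the coefficient [r ^+ d * (V * K ^+ d)] of the oscillation in [mu_approx], for
   [r = rad c n]. *)
pose C : R := (c / f x * K ^+ d)%R.
apply/cvgrPdist_le => e e0.
have C0 : (0 < C)%R by rewrite mulr_gt0 ?divr_gt0// exprn_gt0.
have eC : (0 < e / C)%R by rewrite divr_gt0.
have /cvgrPdist_le/(_ _ eC) H := osc0.
have n0 : \forall n \near \oo, (0 < n)%N by exact: nbhs_infty_gt.
near=> n; have n0n : (0 < n)%N by near: n.
have r0 := rad_gt0 c0 n0n.
have on : osc (rad c n * K) \is a fin_num by near: n.
have on2 : (`|0 - fine (osc (rad c n * K))| <= e / C)%R by near: n.
have [] := mu_approx r0 K0 (mB n) (_ : aff x (rad c n) @^-1` B n `<=` eball o K).
  by rewrite BA.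
rewrite BA// radX// -(fineK on) -[mu (B n)]fineK ?fin_num_measure//.
set m := fine (mu _); set os := fine (osc _).
have os0 : (0 <= os)%R by rewrite fine_ge0// osc_ge0.
have -> : (c / (V * f x * n%:R) * (V * f x) * rvol A = c * rvol A / n%:R)%R.
  by field; rewrite ?pnatr_eq0 -?lt0n ?n0n ?gt_eqF.
have -> : (c / (V * f x * n%:R) * (V * K ^+ d) = C / n%:R)%R.
  by rewrite /C; field; rewrite ?pnatr_eq0 -?lt0n ?n0n ?gt_eqF.
rewrite -!EFinM -!EFinD !lee_fin.
have nR : (0 < n%:R :> R)%R by rewrite ltr0n.
have -> : (c * rvol A / n%:R + C / n%:R * os = (c * rvol A + C * os) / n%:R)%R.
  by field; rewrite gt_eqF.
rewrite ler_pdivlMr// => H1.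
have -> : (m + C / n%:R * os = (n%:R * m + C * os) / n%:R)%R.
  by field; rewrite gt_eqF.
rewrite ler_pM2r ?invr_gt0// => H2.
have oe : (C * os <= e)%R.
  by rewrite -ler_pdivlMl// mulrC; move: on2; rewrite sub0r normrN ger0_norm.
move: H1 H2 oe; rewrite (mulrC m).
set p := (n%:R * m)%R; set q := (c * rvol A)%R; set s := (C * os)%R => H1 H2 oe.
by rewrite ler_norml; apply/andP; split; lra.
Unshelve. all: by end_near. Qed.

Lemma mu_small c K (B : nat -> set E) (A : set E) :
  (0 < c)%R -> (0 < K)%R -> (forall n, measurable (B n)) ->
  (forall n, (0 < n)%N -> aff x (rad c n) @^-1` B n = A) -> A `<=` eball o K ->
  fine (mu (B n)) @[n --> \oo] --> 0%R.
Proof.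
move=> c0 K0 mB BA AK; have H := scaled_mu_cvg c0 K0 mB BA AK.
have invn : (n%:R^-1 : R)%R @[n --> \oo] --> 0%R.
  apply/gtr0_cvgV0; last exact: cvgr_idn.
  by near=> n; rewrite ltr0n; near: n; exact: nbhs_infty_gt.
have G : (n%:R^-1 * (n%:R * fine (mu (B n))))%R @[n --> \oo] --> 0%R.
  by rewrite -(mul0r (c * rvol A)%R); exact: cvgM.
apply: cvg_trans G; apply: near_eq_cvg.
near=> n; rewrite /= mulrA mulVf ?mul1r// pnatr_eq0 -lt0n.
by near: n; exact: nbhs_infty_gt.
Unshelve. all: by end_near. Qed.

Lemma fine_mu01 (B : set E) : measurable B -> (0 <= fine (mu B) <= 1)%R.
Proof.
move=> mB; rewrite fine_ge0//= -lee_fin fineK ?fin_num_measure//.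
exact: probability_le1.
Qed.

(** Both exponents occur: all [n] points must miss a covering ball, whereas only the [n - 1] points
    other than the nucleus must avoid a region [creg]. *)
Lemma void_cvg c K (B : nat -> set E) (A : set E) :
  (0 < c)%R -> (0 < K)%R -> (forall n, measurable (B n)) ->
  (forall n, (0 < n)%N -> aff x (rad c n) @^-1` B n = A) -> A `<=` eball o K ->
  ((1 - fine (mu (B n))) ^+ n)%R @[n --> \oo] --> expR (- (c * rvol A)) /\
  ((1 - fine (mu (B n))) ^+ n.-1)%R @[n --> \oo] --> expR (- (c * rvol A)).
Proof.
move=> c0 K0 mB BA AK.
have H := scaled_mu_cvg c0 K0 mB BA AK.
have H0 := mu_small c0 K0 mB BA AK.
have m01 n := fine_mu01 (mB n).
split; apply: cvg_onem_exp => //.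
have G : (n%:R * fine (mu (B n)) - fine (mu (B n)))%R @[n --> \oo] -->
    (c * rvol A)%R.
  by rewrite -[(c * rvol A)%R]subr0; exact: cvgB.
apply: cvg_trans G; apply: near_eq_cvg.
near=> n; have n0 : (0 < n)%N by near: n; exact: nbhs_infty_gt.
have -> : (n%:R = n.-1%:R + 1 :> R)%R by rewrite natr1 prednK.
ring.
Unshelve. all: by end_near. Qed.

End local_density.

(** * Moments of the truncated cell *)

Section truncated_cell_moments.
Context {R : realType} {d : nat}.
Notation E := (d.-tuple R).
Notation lambda := (lebesgue d).
Notation V := (@ball_vol R d).
Notation U := (unif_ball d).
Notation o := (@origin R d).
Hypothesis d_gt0 : (0 < d)%N.
Variables (f : E -> R) (x : E) (mu : probability E R).
Hypothesis mf : measurable_fun setT f.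
Hypothesis f_ge0 : forall u, 0 <= f u.
Hypothesis muE : forall A, measurable A ->
  mu A = (\int[lambda]_(u in A) (f u)%:E)%E.
Local Open Scope ereal_scope.

Definition affs k (r : R) (q : k.-tuple E) : k.-tuple E :=
  tuple_mapi (fun=> aff x r) q.

Lemma measurable_affs k r : measurable_fun setT (@affs k r).
Proof. by apply: measurable_tuple_mapi => _; exact: measurable_aff. Qed.

Lemma affs_tcons k r a (q : k.-tuple E) :
  affs r (tcons (a, q)) = tcons (aff x r a, affs r q).
Proof. by rewrite /affs tuple_mapi_tcons. Qed.

Lemma aff_creg k r (i : 'I_k) q : (0 < r)%R ->
  aff x r @^-1` creg x i (affs r q) = creg o i q.
Proof.
move=> r0; have := creg_sim o x o i q r0; rewrite sim_origin => <-.
have simE : sim x r o = aff x r by apply/funext => u; rewrite sim0.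
rewrite simE; congr (_ @^-1` creg _ _ _).
by apply: eq_from_tnth => j; rewrite tnth_mktuple tnth_map.
Qed.

Lemma measurable_voronoi d1 (T : measurableType d1) n (i : 'I_n)
    (X : T -> n.-tuple E) (p : T -> E) :
  measurable_fun setT X -> measurable_fun setT p ->
  measurable [set t | voronoi_cell (tnth (X t)) i (p t)].
Proof.
move=> mX mp.
have mt j : measurable_fun setT (fun t => tnth (X t) j).
  exact: (measurableT_comp (measurable_tnth j)).
apply: (@measurable_forall_ord _ _ n (fun j => [set t | j != i ->
  (edist (p t) (tnth (X t) i) <= edist (p t) (tnth (X t) j))%R])) => j.
have [ji|ji] := eqVneq j i.
  by rewrite (_ : [set _ | _] = setT)//; apply/seteqP; split.
rewrite (_ : [set _ | _] = [set t |
    (edist (p t) (tnth (X t) i) <= edist (p t) (tnth (X t) j))%R]).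
  by apply: measurable_le_set; exact: measurable_edist2.
by apply/seteqP; split => t /=; [exact|].
Qed.

Definition scaled_cell n (r : R) (i : 'I_n) (X : n.-tuple E) : set E :=
  [set q | voronoi_cell (tnth X) i (aff x r q)].

Lemma measurable_scaled_cell n r (i : 'I_n) X : measurable (scaled_cell r i X).
Proof.
apply: (@measurable_voronoi _ E n i (cst X) (aff x r)) => //.
exact: measurable_aff.
Qed.

Lemma scaled_cell_perm n r (i : 'I_n) (s : 'S_n) X :
  scaled_cell r i (tuple_perm s X) = scaled_cell r (s i) X.
Proof.
apply/seteqP; split => q H j ji.
  have := H ((s^-1)%g j); rewrite !tnth_mktuple permKV; apply.
  by apply: contra ji => /eqP <-; rewrite permKV.
rewrite !tnth_mktuple; apply: H.
by apply: contra ji => /eqP/perm_inj ->.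
Qed.

(** The covered fraction is written as a probability under [U], so that its [k]-th power is the
    probability that [k] independent uniform points fall in the cell. *)
Definition cell_frac n (r : R) (i : 'I_n) (X : n.-tuple E) : R :=
  if (edist x (tnth X i) < r)%R then fine (U (scaled_cell r i X)) else 0%R.

Lemma cell_frac01 n r (i : 'I_n) X : (0 <= cell_frac r i X <= 1)%R.
Proof.
rewrite /cell_frac; case: ifP => _; last by rewrite lexx ler01.
rewrite fine_ge0//= -lee_fin fineK ?fin_num_measure//; last first.
  exact: measurable_scaled_cell.
by apply: probability_le1; exact: measurable_scaled_cell.
Qed.

Lemma measurable_cell_frac n r (i : 'I_n) : measurable_fun setT (cell_frac r i).
Proof.
have mt : measurable_fun setT (fun X : n.-tuple E => tnth X i).
  exact: measurable_tnth.
apply: measurable_fun_ifT => //.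
  apply: measurable_fun_ltr => //.
  exact: (measurableT_comp (measurable_edist x) mt).
have mS : measurable
    [set p : n.-tuple E * E | voronoi_cell (tnth p.1) i (aff x r p.2)].
  apply: measurable_voronoi => //.
  exact: (measurableT_comp (measurable_aff x r) measurable_snd).
exact: (measurable_fine_section U mS).
Qed.

Definition negdist (v : E) : R := (- edist x v)%R.

Lemma measurable_negdist : measurable_fun setT negdist.
Proof. by apply: measurable_funN; exact: measurable_edist. Qed.

Lemma negdist_null r : mu [set v | negdist v = r] = 0.
Proof.
rewrite (_ : [set _ | _] = [set v | edist x v = (- r)%R]).
  exact: (mu_sphere0 d_gt0 mf muE).
by apply/seteqP; split => v /= vr; rewrite /negdist in vr *;
  rewrite -?vr ?opprK// vr opprK.
Qed.

(* [c] times the fraction of the ball [B(x, r)] covered by the cell containing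
   [x], or [0] if that cell is ambiguous or has its nucleus outside the ball. *)
Definition trunc_cell n (c r : R) (X : n.-tuple E) : R :=
  (\sum_(i < n) c * cell_frac r i X * \1_(argmax_set negdist i) X)%R.

Lemma trunc_cellE n c r (i : 'I_n) X : argmax_set negdist i X ->
  trunc_cell c r X = (c * cell_frac r i X)%R.
Proof.
move=> iX; rewrite /trunc_cell (bigD1 i)//= indicE mem_set// mulr1 big1 ?addr0//.
move=> j ji; rewrite indicE memNset ?mulr0// => jX.
by move/eqP : ji; apply; exact: argmax_set_uniq jX iX.
Qed.

Lemma trunc_cell_ge0 n (c : R) r (X : n.-tuple E) : (0 <= c)%R ->
  (0 <= trunc_cell c r X)%R.
Proof.
move=> c0; apply: sumr_ge0 => i _; rewrite !mulr_ge0//.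
by have /andP[] := cell_frac01 r i X.
Qed.

Lemma trunc_cell_le n (c : R) r (X : n.-tuple E) : (0 <= c)%R ->
  (trunc_cell c r X <= c)%R.
Proof.
move=> c0; have [[i iX]|nX] := pselect (exists i, argmax_set negdist i X).
  rewrite (trunc_cellE c r iX) ler_piMr//.
  by have /andP[] := cell_frac01 r i X.
rewrite /trunc_cell big1// => i _; rewrite indicE memNset ?mulr0// => iX.
by apply: nX; exists i.
Qed.

Lemma measurable_trunc_cell n c r : measurable_fun setT (@trunc_cell n c r).
Proof.
apply: (@measurable_sum _ _ _ setT _ _
  (fun i X => c * cell_frac r i X * \1_(argmax_set negdist i) X)%R) => i.
apply: measurable_funM.
  by apply: measurable_funM => //; exact: measurable_cell_frac.
by apply: measurable_indic; apply: measurable_argmax_set; exact: measurable_negdist.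
Qed.

Definition void_prob k n (q : k.+1.-tuple E) : R :=
  ((1 - fine (mu (creg x ord0 q))) ^+ n)%R.

Lemma void_prob01 k n (q : k.+1.-tuple E) : (0 <= void_prob n q <= 1)%R.
Proof.
have /andP[m0 m1] := fine_mu01 mu (measurable_creg x ord0 q).
by rewrite exprn_ge0 ?subr_ge0//= exprn_ile1 ?subr_ge0// gerBl.
Qed.

Lemma measurable_void_prob k n : measurable_fun setT (@void_prob k n).
Proof.
apply: measurable_funX; apply: measurable_funB => //.
have mS : measurable [set p : k.+1.-tuple E * E | creg x ord0 p.1 p.2].
  by apply: measurable_creg2 => //; exact: measurable_fst.
exact: (measurable_fine_section mu mS).
Qed.

(** The set is the complement of the region up to the sphere around [x] through [y], which is null.
    The comparison at [x] is strict because the nucleus is a strict maximizer of [negdist], the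
    others are weak because Voronoi cells are closed. *)
Lemma mu_void k y (q : k.-tuple E) :
  fine (mu [set v | (edist x y < edist x v)%R /\
     forall l, (edist (tnth q l) y <= edist (tnth q l) v)%R]) =
  (1 - fine (mu (creg x ord0 (tcons (y, q)))))%R.
Proof.
set G := [set v | _]; set C := creg _ _ _.
have mC : measurable C by exact: measurable_creg.
have mG : measurable G.
  apply: measurableI.
    by apply: measurable_edist_lt => //; exact: measurable_id.
  apply: measurable_forall_ord => l.
  by apply: measurable_le_set; apply: measurable_edist2 => //.
pose S := [set v | edist x v = edist x y].
have mS : measurable S.
  rewrite (_ : S = edist x @^-1` [set edist x y])//.
  by apply: measurable_preimage => //; exact: measurable_edist.
have CE v : C v <-> (edist x v < edist x y)%R \/
    exists l, (edist (tnth q l) v < edist (tnth q l) y)%R.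
  rewrite /C /creg/=; split.
    case=> [|[j]]; first by left.
    case: (unliftP ord0 j) => [l|] ->; last by rewrite edistxx ltNge edist_ge0.
    by rewrite tnthS; right; exists l.
  case=> [|[l lv]]; first by left.
  by right; exists (lift ord0 l); rewrite tnthS.
have : mu (~` C) = mu G.
  apply/eqP; rewrite eq_le; apply/andP; split; last first.
    apply: le_measure; rewrite ?inE//; first exact: measurableC.
    move=> v [xv qv] /CE[|[l]]; first by rewrite ltNge ltW.
    by rewrite ltNge qv.
  apply: (@le_trans _ _ (mu (G `|` S))).
    apply: le_measure; rewrite ?inE//; first exact: measurableC.
      exact: measurableU.
    move=> v vC; have qv l : (edist (tnth q l) y <= edist (tnth q l) v)%R.
      by rewrite leNgt; apply/negP => lv; apply: vC; apply/CE; right; exists l.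
    have [xv|xv|xv] := ltgtP (edist x v) (edist x y).
    - by exfalso; apply: vC; apply/CE; left.
    - by left.
    - by right.
  apply: (le_trans (measureU2 _ mG mS)).
  rewrite [X in _ + X](_ : _ = 0) ?adde0//.
  exact: (mu_sphere0 d_gt0 mf muE).
rewrite probability_setC// => <-.
by rewrite fineB// fin_num_measure.
Qed.

(** Tonelli exchanges the sample with the [k] uniform points. For fixed uniform points the condition
    splits into one identical condition on each of the [n] other data points, which gives an [n]-th
    power. *)
Lemma moment_at_nucleus n k r y :
  \int[tuple_product mu n]_t
    ((fine (U (scaled_cell r ord0 (tcons (y, t)))) ^+ k)%:E *
     (\1_(argmax_set negdist ord0) (tcons (y, t)))%:E) =
  \int[tuple_product U k]_q (void_prob n (tcons (y, affs r q)))%:E.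
Proof.
pose H := [set p : n.-tuple E * k.-tuple E |
  (forall j, (edist x y < edist x (tnth p.1 j))%R) /\
  forall l j, (edist (aff x r (tnth p.2 l)) y <=
               edist (aff x r (tnth p.2 l)) (tnth p.1 j))%R].
have m1 j : measurable_fun setT (fun p : n.-tuple E * k.-tuple E => tnth p.1 j).
  exact: (measurableT_comp (measurable_tnth j) measurable_fst).
have m2 l : measurable_fun setT (fun p : n.-tuple E * k.-tuple E =>
    aff x r (tnth p.2 l)).
  apply: (measurableT_comp (measurable_aff x r)).
  exact: (measurableT_comp (measurable_tnth l) measurable_snd).
have mH : measurable H.
  apply: measurableI.
    by apply: measurable_forall_ord => j; exact: measurable_edist_lt.
  apply: measurable_forall_ord => l; apply: measurable_forall_ord => j.
  by apply: measurable_le_set; exact: measurable_edist2.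
have mHE : measurable_fun setT (fun p => (\1_H p)%:E : \bar R).
  by apply/measurable_EFinP; exact: measurable_indic.
have H0 p : 0 <= (\1_H p)%:E :> \bar R by rewrite lee_fin.
transitivity (\int[tuple_product mu n]_t \int[tuple_product U k]_q (\1_H (t, q))%:E).
  apply: eq_integral => t _.
  have mS := measurable_scaled_cell r ord0 (tcons (y, t)).
  set S := scaled_cell _ _ _ in mS *.
  have -> : (fine (U S) ^+ k)%:E = \int[tuple_product U k]_q (\1_(tuple_box (fun=> S)) q)%:E.
    rewrite integral_indic// ?setIT; last exact: measurable_tuple_box.
    transitivity (\prod_(l < k) U S : \bar R); last first.
      by rewrite -(@tuple_product_box _ _ R U k (fun=> S)).
    rewrite -(@fineK _ (U S)) ?fin_num_measure//.
    by rewrite -(big_morph EFin EFinM erefl) prodr_const card_ord.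
  rewrite indicE; case: (boolP (_ \in _)) => [/set_mem at_|at_].
    rewrite mule1; apply: eq_integral => q _; congr EFin; apply: eq_indic.
    rewrite /H/=; split => [qS|[_ qH] l j ji].
      split=> [j|l j].
        have := at_ (lift ord0 j) isT; rewrite /negdist tnthS.
        by rewrite ltrN2.
      by have := qS l (lift ord0 j) isT; rewrite tnthS.
    move: ji; case: (unliftP ord0 j) => [j'|] -> //= _.
    by rewrite tnthS; exact: qH.
  rewrite mule0 integral0_eq// => q _; rewrite indicE memNset// => -[qt _].
  move/negP : at_; apply; rewrite inE => j.
  case: (unliftP ord0 j) => [j'|] -> //= _.
  by rewrite /negdist tnthS ltrN2; exact: qt.
rewrite (fubini_tonelli (fun p => (\1_H p)%:E))//.
apply: eq_integral => q _.
pose G := [set v | (edist x y < edist x v)%R /\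
   forall l, (edist (tnth (affs r q) l) y <= edist (tnth (affs r q) l) v)%R].
have mG : measurable G.
  apply: measurableI.
    by apply: measurable_edist_lt => //; exact: measurable_id.
  apply: measurable_forall_ord => l.
  by apply: measurable_le_set; apply: measurable_edist2 => //.
transitivity (\int[tuple_product mu n]_t (\1_(tuple_box (fun=> G)) t)%:E).
  apply: eq_integral => t _; congr EFin; apply: eq_indic; rewrite /H/=; split.
    move=> [t1 t2] j; split; first exact: t1.
    by move=> l; rewrite tnth_mktuple; exact: t2.
  move=> tG; split=> [j|l j]; first by have [] := tG j.
  by have [_ /(_ l)] := tG j; rewrite tnth_mktuple.
rewrite integral_indic// ?setIT; last exact: measurable_tuple_box.
transitivity (\prod_(j < n) mu G : \bar R).
  exact: (@tuple_product_box _ _ R mu n (fun=> G)).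
rewrite -(@fineK _ (mu G)) ?fin_num_measure//.
by rewrite -(big_morph EFin EFinM erefl) prodr_const card_ord /G mu_void.
Qed.

Lemma cell_frac_perm n r (i : 'I_n.+1) X :
  cell_frac r ord0 (tuple_perm (tperm ord0 i) X) = cell_frac r i X.
Proof. by rewrite /cell_frac scaled_cell_perm tnth_mktuple tpermL. Qed.

Lemma measurable_void_affs n k r : measurable_fun setT
  (fun p : E * k.-tuple E => (void_prob n (tcons (p.1, affs r p.2)))%:E).
Proof.
apply/measurable_EFinP; apply: (measurableT_comp (@measurable_void_prob k n)).
apply: (measurable_fun_tcons (f := fst) (g := fun p => affs r p.2)) => //.
exact: (measurableT_comp (@measurable_affs k r) measurable_snd).
Qed.

(** The factor [n + 1] counts the choices of the nucleus, alike by exchangeability. Only the nucleus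
    has density [f], the [k] points being uniform, so [f] appears once; [V * r ^+ d] normalizes its
    integral over the ball. *)
Lemma trunc_cell_moment n k (c r : R) : (0 < k)%N -> (0 <= c)%R -> (0 < r)%R ->
  \int[tuple_product mu n.+1]_X (trunc_cell c r X ^+ k)%:E =
  (n.+1%:R * c ^+ k * (V * r ^+ d))%:E * \int[tuple_product U k.+1]_q
    (f (aff x r (tnth q ord0)) * void_prob n (affs r q))%:E.
Proof.
move=> k0 c0 r0.
have m1 : mu setT = 1 by exact: probability_setT.
have mneg := measurable_negdist.
have mT : measurable_fun setT (fun X => (@trunc_cell n.+1 c r X ^+ k)%:E).
  apply/measurable_EFinP; apply: measurable_funX; exact: measurable_trunc_cell.
have T0 (X : n.+1.-tuple E) : 0 <= (trunc_cell c r X ^+ k)%:E.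
  by rewrite lee_fin exprn_ge0// trunc_cell_ge0.
have mA i : measurable (@argmax_set _ _ R negdist n.+1 i).
  exact: measurable_argmax_set.
pose W (i : 'I_n.+1) (X : n.+1.-tuple E) : \bar R := ((c * cell_frac r i X) ^+ k)%:E.
have mW i : measurable_fun setT (W i).
  apply/measurable_EFinP; apply: measurable_funX; apply: measurable_funM => //.
  exact: measurable_cell_frac.
have W0 i X : 0 <= W i X.
  by rewrite lee_fin exprn_ge0// mulr_ge0//; have /andP[] := cell_frac01 r i X.
rewrite (ge0_integral_argmax_set m1 mneg negdist_null mT T0).
transitivity (\sum_(i < n.+1)
    \int[tuple_product mu n.+1]_(X in argmax_set negdist ord0) W ord0 X).
  apply: eq_bigr => i _.
  transitivity (\int[tuple_product mu n.+1]_(X in argmax_set negdist i) W i X).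
    by apply: eq_integral => X /[!inE] iX; rewrite (trunc_cellE c r iX).
  rewrite (ge0_integral_argmax_set_perm m1 mneg i (mW i) (W0 i)).
  apply: eq_integral => X _; rewrite /W -cell_frac_perm.
  congr ((_ * cell_frac _ _ _) ^+ _)%:E.
  by apply: eq_from_tnth => j; rewrite !tnth_mktuple tpermK.
pose G (y : E) := \int[tuple_product U k]_q (void_prob n (tcons (y, affs r q)))%:E.
have av0 (p : E * k.-tuple E) : 0 <= (void_prob n (tcons (p.1, affs r p.2)))%:E.
  by rewrite lee_fin; have /andP[] := void_prob01 n (tcons (p.1, affs r p.2)).
have mG : measurable_fun setT G.
  have H := @measurable_fun_fubini_tonelli_F _ _ _ _ R (tuple_product U k)
    (fun p : E * k.-tuple E => (void_prob n (tcons (p.1, affs r p.2)))%:E)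
    (@measurable_void_affs n k r) av0.
  exact: H.
have G0 y : 0 <= G y.
  by apply: integral_ge0 => q _; exact: (av0 (y, q)).
have mB : measurable (eball x r) by exact: measurable_eball.
have WE : \int[tuple_product mu n.+1]_(X in argmax_set negdist ord0) W ord0 X =
    (c ^+ k)%:E * \int[mu]_(y in eball x r) G y.
  rewrite integral_mkcond ge0_integral_tuple_productS; last 2 first.
  - by apply/(measurable_restrictT (W ord0) (mA ord0)); exact: measurable_funTS.
  - by move=> X; rewrite patchE; case: ifPn.
  rewrite -ge0_integralZl//; last 2 first.
  - exact: measurable_funTS.
  - by rewrite lee_fin exprn_ge0.
  rewrite [RHS]integral_mkcond; apply: eq_integral => y _.
  rewrite patchE; case: ifPn => yB; last first.
    (* Nucleus outside the ball: the fraction is 0, and so is its [k]-th power because [k > 0]. *)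
    rewrite integral0_eq// => t _; rewrite patchE /W /cell_frac /=.
    move: yB; rewrite notin_setE /eball/= => /negP/negbTE ->.
    by rewrite mulr0 expr0n gtn_eqF//; case: ifP.
  move/set_mem : yB => yB; rewrite /G -moment_at_nucleus -ge0_integralZl//.
  - apply: eq_integral => t _; rewrite patchE indicE /W /cell_frac/= yB exprMn.
    by case: ifPn => _; rewrite ?mule1 ?mule0 ?EFinM.
  - apply: emeasurable_funM; apply/measurable_EFinP.
      have mcf := measurableT_comp (@measurable_cell_frac n.+1 r ord0)
        (@measurable_fun_tcons _ E _ (n.-tuple E) n (cst y) id (measurable_cst _)
         (@measurable_id _ _ _)).
      apply: measurable_funX; apply: eq_measurable_fun mcf => t _.
      by rewrite /= /cell_frac/= yB.
    apply: (measurableT_comp (measurable_indic (mA ord0))).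
    exact: (@measurable_fun_tcons _ E _ (n.-tuple E) n (cst y) id).
  - by move=> t _; rewrite mule_ge0// lee_fin exprn_ge0// fine_ge0.
  - by rewrite lee_fin exprn_ge0.
rewrite WE.
have mfG : measurable_fun setT (fun y => G y * (f y)%:E).
  by apply: emeasurable_funM => //; exact/measurable_EFinP.
have fG0 y : 0 <= G y * (f y)%:E by rewrite mule_ge0// lee_fin.
have -> : \int[mu]_(y in eball x r) G y = (V * r ^+ d)%:E *
    \int[U]_u (G (aff x r u) * (f (aff x r u))%:E).
  rewrite integral_mkcond (ge0_integral_density mf f_ge0 muE); last 2 first.
  - by apply/(measurable_restrictT G mB); exact: measurable_funTS.
  - by move=> y; rewrite patchE; case: ifPn.
  transitivity (\int[lambda]_(y in eball x r) (G y * (f y)%:E)).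
    rewrite [RHS]integral_mkcond; apply: eq_integral => y _; rewrite !patchE.
    by case: ifPn => _ //; rewrite mul0e.
  rewrite (ge0_integral_ball_sim x o r0 mfG fG0); congr (_ * _).
  by apply: eq_integral => u _; rewrite sim0.
pose F (q : k.+1.-tuple E) : \bar R :=
  (f (aff x r (tnth q ord0)) * void_prob n (affs r q))%:E.
have mF : measurable_fun setT F.
  apply/measurable_EFinP; apply: measurable_funM.
    apply: (measurableT_comp mf).
    exact: (measurableT_comp (measurable_aff x r) (measurable_tnth ord0)).
  exact: (measurableT_comp (@measurable_void_prob k n) (@measurable_affs k.+1 r)).
have F0 q : 0 <= F q.
  by rewrite lee_fin mulr_ge0//; have /andP[] := void_prob01 n (affs r q).
have -> : \int[U]_u (G (aff x r u) * (f (aff x r u))%:E) =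
    \int[tuple_product U k.+1]_q F q.
  rewrite ge0_integral_tuple_productS//; apply: eq_integral => u _.
  have mvoid : measurable_fun setT
      (fun q : k.-tuple E => (void_prob n (tcons (aff x r u, affs r q)))%:E).
    apply/measurable_EFinP; apply: (measurableT_comp (@measurable_void_prob k n)).
    apply: (measurable_fun_tcons (f := cst (aff x r u)) (g := @affs k r)) => //.
    exact: measurable_affs.
  have void0 (q : k.-tuple E) : setT q -> 0 <= (void_prob n (tcons (aff x r u, affs r q)))%:E.
    by move=> _; exact: (av0 (aff x r u, q)).
  transitivity (\int[tuple_product U k]_q
      ((f (aff x r u))%:E * (void_prob n (tcons (aff x r u, affs r q)))%:E)).
    by rewrite muleC; apply/esym/ge0_integralZl => //; rewrite lee_fin.
  by apply: eq_integral => q _; rewrite /F affs_tcons.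
have IF0 : 0 <= \int[tuple_product U k.+1]_q F q by exact: integral_ge0.
rewrite !muleA -EFinM -ge0_sume_distrl; last first.
  by move=> i _; rewrite lee_fin !mulr_ge0 ?exprn_ge0 ?(ltW r0)// ltW// ball_vol_gt0.
congr (_ * _); rewrite sumEFin sumr_const card_ord -[in LHS]mulr_natl.
by congr EFin; ring.
Qed.

End truncated_cell_moments.

(** * The covering event *)

Section net.
Context {R : realType} {d : nat}.
Notation E := (d.-tuple R).
Notation o := (@origin R d).
Hypothesis d_gt0 : (0 < d)%N.

Lemma sphere_net : exists N, exists g : 'I_N -> E, forall u, edist o u = 1 ->
  exists i, edist u (g i) <= 4^-1.
Proof.
(* A grid of mesh [1 / m] on the cube [[-1, 1]^d] approximates a point within [sqrt d / (4 * d)],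
   which is at most 1/4. *)
pose m := (4 * d)%N; have m0 : 0 < m%:R :> R by rewrite ltr0n muln_gt0.
pose p (h : {ffun 'I_d -> 'I_(2 * m).+1}) : E := [tuple (h i)%:R / m%:R - 1 | i < d].
exists #|{ffun 'I_d -> 'I_(2 * m).+1}|, (fun i => p (enum_val i)) => u u1.
have u01 i : 0 <= tnth u i + 1 <= 2.
  have : `|tnth u i| <= 1.
    rewrite -u1 -sqrtr_sqr ler_wsqrtr// (bigD1 i)//= tnth_mktuple sub0r sqrrN.
    by rewrite lerDl sumr_ge0// => j _; exact: sqr_ge0.
  by rewrite ler_norml => /andP[? ?]; apply/andP; split; lra.
pose h := [ffun i : 'I_d => inord (Num.truncn ((tnth u i + 1) * m%:R)) : 'I_(2 * m).+1].
exists (enum_rank h); rewrite enum_rankK.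
have hi i : ((h i)%:R <= (tnth u i + 1) * m%:R < (h i).+1%:R :> bool).
  have /andP[a0 a1] := u01 i.
  have um0 : 0 <= (tnth u i + 1) * m%:R by rewrite mulr_ge0// ltW.
  have /andP[t0 t1] := truncn_itv um0.
  rewrite ffunE inordK ?t0// ltnS -(ler_nat R) (le_trans t0)//.
  by rewrite natrM ler_pM2r.
rewrite -[leRHS]ger0_norm// -sqrtr_sqr ler_wsqrtr//.
apply: (@le_trans _ _ (\sum_(i < d) m%:R^-1 ^+ 2)).
  apply: ler_sum => i _; rewrite tnth_mktuple.
  have /andP[h0 h1] := hi i.
  have -> : tnth u i - ((h i)%:R / m%:R - 1) = ((tnth u i + 1) * m%:R - (h i)%:R) / m%:R.
    by field; rewrite gt_eqF.
  rewrite exprMn ler_piMl ?sqr_ge0// expr_le1// ?subr_ge0//.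
  by rewrite lerBlDl natr1 ltW.
rewrite sumr_const card_ord -[leLHS]mulr_natl /m natrM.
have d1 : 1 <= d%:R :> R by rewrite ler1n.
have d0 : 0 < d%:R :> R by rewrite ltr0n.
have -> : d%:R * (4 * d%:R)^-1 ^+ 2 = d%:R^-1 * 4^-1 ^+ 2 :> R.
  by field; rewrite gt_eqF.
by rewrite ler_piMl ?sqr_ge0// invf_le1.
Qed.

Lemma edist_aff_radius x r r' u :
  edist (aff x r u) (aff x r' u) = `|r - r'| * edist o u.
Proof.
rewrite /edist -[X in X * _]sqrtr_sqr -sqrtrM ?sqr_ge0//; congr Num.sqrt.
rewrite mulr_sumr; apply: eq_bigr => i _; rewrite !tnth_mktuple; ring.
Qed.

(* For [g] a net of the unit sphere: every point far from [x] then has some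
   generator closer to it than the generator nearest to [x]. *)
Definition well_covered x N (g : 'I_N -> E) n (r : R) (X : n.-tuple E) : Prop :=
  (exists j, edist x (tnth X j) < r / 2) /\
  forall i, exists j, edist (aff x r (g i)) (tnth X j) < r / 4.

Lemma well_covered_nucleus x N (g : 'I_N -> E) n r (X : n.-tuple E) i :
  well_covered x g r X -> voronoi_cell (tnth X) i x -> edist x (tnth X i) < r / 2.
Proof.
move=> [[j xj] _] xi; have [->//|ji] := eqVneq i j.
by apply: le_lt_trans xj; apply: xi; rewrite eq_sym.
Qed.

Lemma well_covered_cell x N (g : 'I_N -> E) n r (X : n.-tuple E) i : 0 < r ->
  (forall u, edist o u = 1 -> exists i, edist u (g i) <= 4^-1) ->
  well_covered x g r X -> voronoi_cell (tnth X) i x ->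
  voronoi_cell (tnth X) i `<=` eball x r.
Proof.
move=> r0 gnet good xi p pi; rewrite /eball/= ltNge; apply/negP => rt.
have xir := well_covered_nucleus good xi.
set t := edist x p in rt; have t0 : 0 < t by exact: lt_le_trans rt.
pose u := aff (aff o (- t^-1) x) t^-1 p.
have pE : p = aff x t u by rewrite affK// gt_eqF.
have u1 : edist o u = 1.
  apply: (mulfI (lt0r_neq0 t0)); rewrite mulr1 -(edist_aff x _ _ (ltW t0)).
  by rewrite aff_origin -pE.
have [h uh] := gnet _ u1; have [_ /(_ h)[j hj]] := good.
(* The path from [p] goes radially to the sphere ([t - r]), then to the net (at most [r / 4]), then
   to a data point (less than [r / 4]). The nucleus, closer than [r / 2] to [x], is farther than
   [t - r / 2] from [p]. *)
have pj : edist p (tnth X j) < t - r / 2.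
  have := edist_triangle p (aff x r u) (tnth X j).
  have := edist_triangle (aff x r u) (aff x r (g h)) (tnth X j).
  rewrite {2}pE edist_aff_radius u1 mulr1 ger0_norm ?subr_ge0// (edist_aff _ _ _ (ltW r0)).
  have : r * edist u (g h) <= r * 4^-1 by rewrite ler_pM2l.
  by lra.
have : edist p (tnth X i) <= edist p (tnth X j).
  by have [->//|ji] := eqVneq j i; exact: pi.
by have := edist_triangle x (tnth X i) p; rewrite -/t (edistC (tnth X i) p); lra.
Qed.

Lemma measurable_well_covered x N (g : 'I_N -> E) n r :
  measurable [set X : n.-tuple E | well_covered x g r X].
Proof.
have H y a : measurable [set X : n.-tuple E | exists j, edist y (tnth X j) < a].
  apply: measurable_exists_ord => j.
  apply: measurable_lt_set => //.
  exact: (measurableT_comp (measurable_edist y) (measurable_tnth j)).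
apply: measurableI; first exact: H.
by apply: measurable_forall_ord => i; exact: H.
Qed.

End net.

(** * Iterated limits and samples *)

Section iterated_limit.

(** Large [M], then [n] large depending on [M]: successive limits become a single limit, without any
    uniformity in [M]. *)
Definition iterated_near : set_system (nat * nat) :=
  [set A | \forall M \near \oo, \forall n \near \oo, A (M, n)].

#[global] Instance iterated_near_filter : Filter iterated_near.
Proof.
split.
- by apply: nearW => M; exact: nearW.
- move=> A B; rewrite /iterated_near/=; apply: filterS2 => M.
  by apply: filterS2 => n.
- move=> A B AB; rewrite /iterated_near/=; apply: filterS => M; apply: filterS => n; exact: AB.
Qed.

Lemma iterated_cvg (T : topologicalType) (u : nat -> nat -> T) (v : nat -> T) (l : T) :
  (forall M, u M n @[n --> \oo] --> v M) -> v M @[M --> \oo] --> l ->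
  u i.1 i.2 @[i --> iterated_near] --> l.
Proof.
move=> uv vl A lA; rewrite /= /nbhs/= /iterated_near/=.
(* The interior makes [A] a neighborhood of [v M] itself, as the inner limit requires. *)
have vA : \forall M \near \oo, interior A (v M) by exact: vl _ (nbhs_interior lA).
by apply: filterS vA => M AM; exact: (uv M A AM).
Qed.

End iterated_limit.

Section iid_law.
Context {R : realType} {dO dT : measure_display} {O : measurableType dO}.
Context {T : measurableType dT} (P : probability O R).
Local Open Scope ereal_scope.

Lemma measurable_mktuple n (X : 'I_n -> {RV P >-> T}) :
  measurable_fun setT (fun w => [tuple X i w | i < n]).
Proof.
apply/measurable_fun_tnthP => i.
rewrite (_ : _ \o _ = X i); first exact: measurable_funP.
by apply/funext => w; rewrite /= tnth_mktuple.
Qed.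

Lemma iid_law (m : probability T R) n (X : 'I_n -> {RV P >-> T}) :
  mutually_independent X ->
  (forall i A, measurable A -> P (X i @^-1` A) = m A) ->
  forall A, measurable A ->
    P ((fun w => [tuple X i w | i < n]) @^-1` A) = tuple_product m n A.
Proof.
move=> indX lawX A mA.
have mX := measurable_mktuple X.
pose m' := pushforward (P : {measure set O -> \bar R})
  (fun w => [tuple X i w | i < n]).
apply: (tuple_product_unique (m' := m')) => //.
  exact: probability_setT.
move=> B mB; rewrite /m' /= /pushforward.
have := indX [set: 'I_n]%SET B mB.
under [RHS]eq_bigr do rewrite lawX//.
rewrite (eq_bigl xpredT) => [<-|i]; last by rewrite inE.
congr (P _); apply/seteqP; split => w /= H i.
  by move=> _; have := H i; rewrite tnth_mktuple.
by rewrite tnth_mktuple; apply: H; rewrite /= inE.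
Qed.

End iid_law.

(** * The volume of the cell *)

Section volume_of_the_cell.
Context {R : realType} {d : nat}.
Notation E := (d.-tuple R).
Notation lambda := (lebesgue d).
Notation V := (@ball_vol R d).
Notation U := (unif_ball d).
Notation o := (@origin R d).
Hypothesis d_gt0 : (0 < d)%N.
Variables (f : E -> R) (x : E) (mu : probability E R).
Hypothesis mf : measurable_fun setT f.
Hypothesis f_ge0 : forall u, 0 <= f u.
Hypothesis muE : forall A, measurable A ->
  mu A = (\int[lambda]_(u in A) (f u)%:E)%E.
Hypothesis x_leb : lebesgue_point f x.
Hypothesis fx_gt0 : 0 < f x.
Local Open Scope ereal_scope.

Notation Uk k := (tuple_product U k).
Notation rad := (rad f x).

Notation void_at n r q := (void_prob x mu n (affs x r q)).

Lemma measurable_void k n r :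
  measurable_fun setT (fun q : k.+1.-tuple E => void_at n r q).
Proof.
exact: (measurableT_comp (measurable_void_prob x mu n) (@measurable_affs _ _ x k.+1 r)).
Qed.

Lemma integral_Uk_le1 k (g : k.-tuple E -> R) : measurable_fun setT g ->
  (forall q, (0 <= g q <= 1)%R) -> 0 <= \int[Uk k]_q (g q)%:E <= 1.
Proof.
move=> mg g01; apply/andP; split.
  by apply: integral_ge0 => q _; rewrite lee_fin; case/andP : (g01 q).
apply: (@le_trans _ _ (\int[Uk k]_q 1%:E)).
  apply: ge0_le_integral => //.
  - by move=> q _; rewrite lee_fin; case/andP : (g01 q).
  - exact/measurable_EFinP.
  - by move=> q _; rewrite lee_fin; case/andP : (g01 q).
rewrite integral_cst// mul1e [leLHS](_ : _ = 1)//.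
exact: (tuple_productT unif_ball_setT k).
Qed.

Lemma void_prob_cvg k (c : R) (q : k.+1.-tuple E) : (0 < c)%R ->
  void_at n.-1 (rad c n) q @[n --> \oo] --> expR (- (c * rvol (creg o ord0 q))).
Proof.
move=> c0; have [K K0 qK] := creg_bounded o ord0 q.
have [] := @void_cvg _ _ d_gt0 _ _ _ mf f_ge0 muE x_leb fx_gt0 c K
  (fun n => creg x ord0 (affs x (rad c n) q)) (creg o ord0 q) c0 K0 _ _ qK => //.
- by move=> n; exact: measurable_creg.
- by move=> n n0; rewrite aff_creg//; exact: rad_gt0.
Qed.

Lemma integral_void_prob_cvg k (c : R) : (0 < c)%R ->
  \int[Uk k.+1]_q (void_at n.-1 (rad c n) q)%:E @[n --> \oo] -->
  \int[Uk k.+1]_q (expR (- (c * rvol (creg o ord0 q))))%:E.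
Proof.
move=> c0.
have m1 n : measurable_fun setT
    (fun q : k.+1.-tuple E => (void_at n.-1 (rad c n) q)%:E).
  by apply/measurable_EFinP; exact: measurable_void.
have m2 : measurable_fun setT
    (fun q : k.+1.-tuple E => (expR (- (c * rvol (creg o ord0 q))))%:E).
  apply/measurable_EFinP; apply: measurableT_comp => //.
  apply: measurable_funN; apply: measurable_funM => //.
  exact: measurable_rvol_creg.
have int1 : (Uk k.+1).-integrable setT (cst 1%:E : k.+1.-tuple E -> \bar R).
  apply/integrableP; split; first exact: measurable_cst.
  under eq_integral do rewrite /= normr1.
  rewrite integral_cst// mul1e [ltLHS](_ : _ = 1) ?ltry//.
  exact: (tuple_productT unif_ball_setT k.+1).
have [] := @dominated_convergence _ _ _ (Uk k.+1) setT measurableT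
  (fun n q => (void_at n.-1 (rad c n) q)%:E) _ _ m1 m2 _ int1 _ => //.
- apply: aeW => q _; apply: cvg_EFin; first exact: nearW.
  exact: void_prob_cvg.
- apply: aeW => q n _; rewrite lee_fin.
  by have /andP[v0 v1] := void_prob01 x mu n.-1 (affs x (rad c n) q); rewrite ger0_norm.
Qed.

Lemma osc_tuple k r : \int[Uk k.+1]_q (`|f (aff x r (tnth q ord0)) - f x|)%:E =
  osc f x r.
Proof.
have mo : measurable_fun setT (fun u => (`|f (aff x r u) - f x|)%:E).
  apply/measurable_EFinP; apply: measurableT_comp; first exact: normr_measurable.
  by apply: measurable_funB => //; exact: (measurableT_comp mf (measurable_aff x r)).
rewrite ge0_integral_tuple_productS//; last first.
  exact: (measurableT_comp mo (measurable_tnth ord0)).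
apply: eq_integral => u _.
transitivity (\int[Uk k]_t (cst (`|f (aff x r u) - f x|)%:E t)) => //.
rewrite integral_cst// [X in _ * X](_ : _ = 1) ?mule1//.
exact: (tuple_productT unif_ball_setT k).
Qed.

(** [f] is not assumed bounded near [x], so dominated convergence is applied to the void probability
    alone. As that is at most 1, replacing [f] by [f x] costs at most the mean oscillation. *)
Lemma weighted_void_cvg k (c : R) : (0 < c)%R ->
  \int[Uk k.+1]_q (f (aff x (rad c n) (tnth q ord0)) *
     void_at n.-1 (rad c n) q)%:E @[n --> \oo] -->
  (f x)%:E * \int[Uk k.+1]_q (expR (- (c * rvol (creg o ord0 q))))%:E.
Proof.
move=> c0; set L := \int[_]_q _.
pose J n := \int[Uk k.+1]_q (void_at n.-1 (rad c n) q)%:E.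
pose I n := \int[Uk k.+1]_q (f (aff x (rad c n) (tnth q ord0)) *
     void_at n.-1 (rad c n) q)%:E.
have JL : J n @[n --> \oo] --> L by exact: integral_void_prob_cvg.
have osc0 : osc f x (rad c n) @[n --> \oo] --> 0.
  have := @osc_rad_cvg _ _ d_gt0 _ _ mf x_leb fx_gt0 c 1%R c0 ltr01.
  by under eq_fun do rewrite mulr1.
have fxJL : (f x)%:E * J n @[n --> \oo] --> (f x)%:E * L by exact: cvgeZl.
have mv n : measurable_fun setT (fun q : k.+1.-tuple E => void_at n.-1 (rad c n) q).
  exact: measurable_void.
have mff n : measurable_fun setT
    (fun q : k.+1.-tuple E => f (aff x (rad c n) (tnth q ord0))).
  apply: (measurableT_comp mf).
  exact: (measurableT_comp (measurable_aff x _) (measurable_tnth ord0)).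
have mI n : measurable_fun setT (fun q : k.+1.-tuple E =>
    (f (aff x (rad c n) (tnth q ord0)) * void_at n.-1 (rad c n) q)%:E).
  by apply/measurable_EFinP; exact: measurable_funM.
have mJ n : measurable_fun setT
    (fun q : k.+1.-tuple E => (f x)%:E * (void_at n.-1 (rad c n) q)%:E).
  by apply/measurable_EFinP; exact: measurable_funM.
have mo n : measurable_fun setT (fun q : k.+1.-tuple E =>
    (`|f (aff x (rad c n) (tnth q ord0)) - f x|)%:E).
  apply/measurable_EFinP; apply: measurableT_comp; first exact: normr_measurable.
  exact: measurable_funB.
have v01 n q : (0 <= void_at n.-1 (rad c n) (q : k.+1.-tuple E) <= 1)%R by exact: void_prob01.
have v0 n q : (0 <= void_at n.-1 (rad c n) (q : k.+1.-tuple E))%R by case/andP : (v01 n q).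
have v1 n q : (void_at n.-1 (rad c n) (q : k.+1.-tuple E) <= 1)%R by case/andP : (v01 n q).
have fxJE n : (f x)%:E * J n =
    \int[Uk k.+1]_q ((f x)%:E * (void_at n.-1 (rad c n) q)%:E).
  rewrite ge0_integralZl//.
  - exact/measurable_EFinP.
  - by move=> q _; rewrite lee_fin.
  - by rewrite lee_fin ltW.
have bound (a b v : R) : (0 <= v <= 1 -> a * v <= b * v + `|a - b|)%R.
  move=> /andP[w0 w1]; have := ler_norm (a - b).
  have : (0 <= `|a - b| * (1 - v))%R by rewrite mulr_ge0// subr_ge0.
  by have := ler_wpM2r w0 (ler_norm (a - b)); lra.
have h0 n q : 0 <= (f x)%:E * (void_at n.-1 (rad c n) (q : k.+1.-tuple E))%:E.
  by rewrite mule_ge0// lee_fin// ltW.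
have h1 n (q : k.+1.-tuple E) : 0 <= (f (aff x (rad c n) (tnth q ord0)) *
    void_at n.-1 (rad c n) q)%:E.
  by rewrite lee_fin mulr_ge0.
have up n : I n <= (f x)%:E * J n + osc f x (rad c n).
  rewrite fxJE -(osc_tuple k) -ge0_integralD//.
  apply: ge0_le_integral => //; first exact: emeasurable_funD.
  by move=> q _; rewrite -EFinM -EFinD lee_fin bound.
have lo n : (f x)%:E * J n <= I n + osc f x (rad c n).
  rewrite fxJE -(osc_tuple k) -ge0_integralD//.
  apply: ge0_le_integral => //; first exact: emeasurable_funD.
  by move=> q _; rewrite -EFinM -EFinD lee_fin distrC bound.
have Lf : (f x)%:E * L \is a fin_num.
  rewrite fin_numM// ge0_fin_numE; last first.
    by apply: integral_ge0 => q _; rewrite lee_fin expR_ge0.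
  apply: (@le_lt_trans _ _ 1); last exact: ltry.
  have mL : measurable_fun setT
      (fun q : k.+1.-tuple E => expR (- (c * rvol (creg o ord0 q)))).
    apply: measurableT_comp => //.
    apply: measurable_funN; apply: measurable_funM => //.
    exact: measurable_rvol_creg.
  have L01 (q : k.+1.-tuple E) : (0 <= expR (- (c * rvol (creg o ord0 q))) <= 1)%R.
    rewrite expR_ge0/= expR_le1 oppr_le0 mulr_ge0 ?(ltW c0)//.
    exact: rvol_ge0.
  by have /andP[] := integral_Uk_le1 mL L01.
have /fine_cvgP[oscf _] := osc0.
apply: (@squeeze_cvge _ _ _ _ (fun n => (f x)%:E * J n - osc f x (rad c n))
  _ (fun n => (f x)%:E * J n + osc f x (rad c n))).
- near=> n; rewrite up andbT leeBlDr; first exact: lo.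
  by near: n.
- rewrite -[X in _ --> X]sube0; apply: cvgeB => //.
  by rewrite fin_num_adde_defl.
- rewrite -[X in _ --> X]adde0; apply: cvgeD => //.
  by rewrite fin_num_adde_defl.
Unshelve. all: by end_near. Qed.

Lemma trunc_moment_cvg k (c : R) : (0 < k)%N -> (0 < c)%R ->
  \int[tuple_product mu n]_X (trunc_cell x c (rad c n) X ^+ k)%:E @[n --> \oo] -->
  @poisson_moment R d k c.
Proof.
move=> k0 c0.
(* [c ^+ k.+1 / f x] is the value of [n * c ^+ k * (V * r ^+ d)] for [r = rad c n]. *)
have H : (c ^+ k.+1 / f x)%:E * \int[Uk k.+1]_q (f (aff x (rad c n) (tnth q ord0)) *
     void_at n.-1 (rad c n) q)%:E @[n --> \oo] --> @poisson_moment R d k c.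
  have -> : @poisson_moment R d k c = (c ^+ k.+1 / f x)%:E * ((f x)%:E *
      \int[Uk k.+1]_q (expR (- (c * rvol (creg o ord0 q))))%:E).
    rewrite muleA -EFinM divfK//; exact: lt0r_neq0.
  by apply: cvgeZl => //; exact: weighted_void_cvg.
apply: cvg_trans H; apply: near_eq_cvg; near=> n.
have n0 : (0 < n)%N by near: n; exact: nbhs_infty_gt.
have rE := radX d_gt0 fx_gt0 c0 n0.
have r0 := rad_gt0 fx_gt0 c0 n0.
move: rE r0; rewrite -(prednK n0) => rE r0.
rewrite (trunc_cell_moment d_gt0 x mf f_ge0 muE _ k0 (ltW c0) r0).
rewrite rE; congr (_%:E * _).
have V0 : (V != 0)%R by rewrite gt_eqF// ball_vol_gt0.
have N0 : (n.-1.+1%:R != 0 :> R)%R by rewrite pnatr_eq0.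
have f0 : (f x != 0)%R by rewrite gt_eqF.
by rewrite exprS; move: V (f x) n.-1.+1%:R V0 f0 N0 => v y N v0 y0 N0; field; rewrite v0 y0 N0.
Unshelve. all: by end_near. Qed.

Definition scaled_volume n (X : n.-tuple E) : \bar R :=
  (n%:R * f x)%:E * lambda (cell_at (tnth X) x).

Lemma measurable_cell_volume n (i : 'I_n) :
  measurable_fun setT (fun X : n.-tuple E => lambda (voronoi_cell (tnth X) i)).
Proof.
pose S := [set p : n.-tuple E * E | voronoi_cell (tnth p.1) i p.2].
have mS : measurable S by exact: measurable_voronoi.
have := measurable_fun_xsection lambda mS.
by congr (measurable_fun _ _); apply/funext => t /=; rewrite xsectionE.
Qed.

(** The samples are split according to which cells contain [x], a pattern [b] among finitely many.
    On each piece [pick] returns a fixed index. *)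
Lemma measurable_scaled_volume n (t : R) :
  measurable [set X : n.-tuple E | scaled_volume X <= t%:E].
Proof.
pose B (b : {ffun 'I_n -> bool}) := [set X : n.-tuple E |
  forall i, [set X : n.-tuple E |
    b i = (x \in voronoi_cell (tnth X) i)] X].
pose C (b : {ffun 'I_n -> bool}) := [set X : n.-tuple E |
  (n%:R * f x)%:E * lambda (if [pick i | b i] is Some i
     then voronoi_cell (tnth X) i else set0) <= t%:E].
rewrite (_ : [set _ | _] =
    \bigcup_(b in [set: {ffun 'I_n -> bool}]) (B b `&` C b)); last first.
  apply/seteqP; split => [X Xt|X [b _ [bX]]].
    exists [ffun i => x \in voronoi_cell (tnth X) i] => //; split.
      by move=> i; rewrite /= ffunE.
    move: Xt; rewrite /C /scaled_volume /cell_at /=.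
    by under [in X in _ -> X]eq_pick do rewrite ffunE.
  rewrite /C /scaled_volume /cell_at /=.
  by under eq_pick do rewrite bX.
apply: fin_bigcup_measurable => // b _; apply: measurableI.
  apply: measurable_forall_ord => i.
  have mS : measurable [set X : n.-tuple E | voronoi_cell (tnth X) i x].
    exact: (@measurable_voronoi _ _ _ _ _ i id (cst x)).
  case bi : (b i).
    rewrite (_ : [set _ | _] = [set X : n.-tuple E | voronoi_cell (tnth X) i x])//.
    by apply/seteqP; split => X /=; [move=> /esym/set_mem|move/mem_set ->].
  rewrite (_ : [set _ | _] = ~` [set X : n.-tuple E | voronoi_cell (tnth X) i x]).
    exact: measurableC.
  apply/seteqP; split => X /=; first by move=> /esym/negbT; rewrite notin_setE.
  by move=> nX; rewrite memNset.
rewrite /C; case: pickP => [i _|_]; last first.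
  by case: (boolP ((n%:R * f x)%:E * lambda set0 <= t%:E)) => H;
    [rewrite (_ : [set _ | _] = setT)|rewrite (_ : [set _ | _] = set0)] => //;
    apply/seteqP; split => // X /=; rewrite ?H// (negbTE H).
rewrite -[X in measurable X]setTI; apply: emeasurable_fun_infty_c => //.
by apply: measurable_funeM; exact: measurable_cell_volume.
Qed.

Lemma scaled_volumeE N (g : 'I_N -> E) n c (X : n.-tuple E) :
  (forall u, edist o u = 1%R -> exists i, (edist u (g i) <= 4^-1)%R) ->
  (0 < n)%N -> (0 < c)%R -> ~ no_argmax (negdist x) X ->
  well_covered x g (rad c n) X ->
  scaled_volume X = (trunc_cell x c (rad c n) X)%:E.
Proof.
move=> gnet n0 c0 /contrapT[i iX] good.
have r0 := rad_gt0 fx_gt0 c0 n0; set r := rad c n in r0 good *.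
have xi : voronoi_cell (tnth X) i x.
  by move=> j ji; have := iX j ji; rewrite /negdist ltrN2 => /ltW.
have cellE : cell_at (tnth X) x = voronoi_cell (tnth X) i.
  rewrite /cell_at; case: pickP => [j /set_mem xj|/(_ i)]; last by rewrite mem_set.
  have [->//|ji] := eqVneq j i.
  by have := xj i; rewrite eq_sym => /(_ ji); have := iX j ji;
    rewrite /negdist ltrN2 ltNge => /negbTE ->.
have cell_ball : voronoi_cell (tnth X) i `<=` eball x r.
  exact: well_covered_cell good xi.
have xir : (edist x (tnth X i) < r)%R.
  apply: lt_trans (well_covered_nucleus good xi) _.
  by rewrite ltr_pdivrMr// ltr_pMr// ltr1n.
have mcell : measurable (voronoi_cell (tnth X) i).
  exact: (@measurable_voronoi _ _ _ E n i (cst X) id).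
have S1 : scaled_cell x r i X `<=` eball o 1.
  move=> q /cell_ball; rewrite /eball/= -{1}(aff_origin x r).
  by rewrite edist_aff ?ltW// gtr_pMr.
have mS := measurable_scaled_cell x r i X.
rewrite /scaled_volume cellE (lebesgue_aff x r0 mcell).
rewrite (trunc_cellE c r iX) /cell_frac xir unif_ballE.
rewrite (setIidl S1).
have -> : aff x r @^-1` voronoi_cell (tnth X) i = scaled_cell x r i X by [].
have Sfin : lambda (scaled_cell x r i X) \is a fin_num.
  exact: (lebesgue_bounded mS S1).
rewrite -[in LHS](fineK Sfin) fineM//= -!EFinM (radX d_gt0 fx_gt0 c0 n0).
congr EFin.
have V0 : (V != 0)%R by rewrite gt_eqF// ball_vol_gt0.
have N0 : (n%:R != 0 :> R)%R by rewrite pnatr_eq0 -lt0n.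
have f0 : (f x != 0)%R by rewrite gt_eqF.
rewrite -/(@ball_vol R d).
by move: V (f x) (n%:R : R)%R V0 f0 N0 => v y N' v0 y0 N0; field; rewrite v0 y0 N0.
Qed.

(** * Probability that the covering fails *)

Section covering_probability.
Variables (N : nat) (g : 'I_N -> E).

Lemma void_tuple_product n (B : set E) : measurable B ->
  tuple_product mu n [set X | forall j, (~` B) (tnth X j)] =
  ((1 - fine (mu B)) ^+ n)%:E.
Proof.
move=> mB; rewrite (@tuple_product_box _ _ R mu n (fun=> ~` B)); last first.
  by move=> _; exact: measurableC.
rewrite (eq_bigr (fun=> (1 - fine (mu B))%:E)) => [|j _]; last first.
  by rewrite /= probability_setC// EFinB fineK// fin_num_measure.
by rewrite -(big_morph EFin EFinM erefl) prodr_const card_ord.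
Qed.

Lemma measure_exists_ord_le d1 (T : measurableType d1)
    (m : {measure set T -> \bar R}) n (A : 'I_n -> set T) :
  (forall i, measurable (A i)) ->
  m [set t | exists i, A i t] <= \sum_(i < n) m (A i).
Proof.
move=> mA; have <- : \big[setU/set0]_(i < n) A i = [set t | exists i, A i t].
  rewrite -bigcup_seq; apply/seteqP; split => t /= [i]; first by exists i.
  by exists i => //=; rewrite mem_index_enum.
suff [] : measurable (\big[setU/set0]_(i < n) A i) /\
    m (\big[setU/set0]_(i < n) A i) <= \sum_(i < n) m (A i) by [].
apply: (big_ind2 (fun S s => measurable S /\ m S <= s)) => //.
  by rewrite measure0.
move=> S s S' s' [mS Ss] [mS' Ss']; split; first exact: measurableU.
by apply: (le_trans (measureU2 _ mS mS')); exact: leeD.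
Qed.

Definition uncovered_bound (r : R) n : R :=
  ((1 - fine (mu (eball x (r / 2)))) ^+ n +
   \sum_(i < N) (1 - fine (mu (eball (aff x r (g i)) (r / 4)))) ^+ n)%R.

Lemma uncovered_le n (r : R) :
  tuple_product mu n (~` [set X | well_covered x g r X]) <=
  (uncovered_bound r n)%:E.
Proof.
pose A y s := [set X : n.-tuple E | forall j, (~` eball y s) (tnth X j)].
have mA y s : measurable (A y s).
  apply: (@measurable_tuple_box _ E n (fun=> ~` eball y s)) => _.
  by apply: measurableC; exact: measurable_eball.
have AE y s : tuple_product mu n (A y s) = ((1 - fine (mu (eball y s))) ^+ n)%:E.
  by apply: void_tuple_product; exact: measurable_eball.
pose B := [set X | exists i, A (aff x r (g i)) (r / 4)%R X].
have mB : measurable B by exact: measurable_exists_ord.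
apply: (@le_trans _ _ (tuple_product mu n (A x (r / 2)%R `|` B))).
  apply: le_measure; rewrite ?inE.
  - by apply: measurableC; exact: measurable_well_covered.
  - exact: measurableU.
  move=> X /= nX; apply: contrapT => /not_orP[X1 X2]; apply: nX; split.
    by apply: contrapT => nX; apply: X1 => j Xj; apply: nX; exists j.
  move=> i; apply: contrapT => nX; apply: X2; exists i => j Xj.
  by apply: nX; exists j.
apply: (le_trans (measureU2 _ (mA _ _) mB)).
rewrite /uncovered_bound EFinD; apply: leeD; first by rewrite -AE.
apply: le_trans (measure_exists_ord_le _ _) _ => //.
by rewrite -sumEFin; apply: lee_sum => i _; rewrite -AE.
Qed.

Definition uncovered_limit (c : R) : R :=
  (expR (- (c * 2^-1 ^+ d)) + N%:R * expR (- (c * 4^-1 ^+ d)))%R.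

(** Most of these balls are not centered at [x], but rescaled they are fixed bounded sets, so
    [void_cvg] applies to each of the finitely many terms. *)
Lemma uncovered_cvg c : (0 < c)%R ->
  uncovered_bound (rad c n) n @[n --> \oo] -->
  uncovered_limit c.
Proof.
move=> c0.
have H y s : (0 < s)%R ->
    ((1 - fine (mu (eball (aff x (rad c n) y) (rad c n * s)))) ^+ n)%R
      @[n --> \oo] --> expR (- (c * s ^+ d)).
  move=> s0; have [K K0 yK] : exists2 K : R, (0 < K)%R & eball y s `<=` eball o K.
    exists (edist o y + s)%R; first by rewrite ltr_wpDl ?edist_ge0.
    move=> q; rewrite /eball/= => yq.
    by apply: (le_lt_trans (edist_triangle _ y _)); rewrite ltrD2l.
  have [] := @void_cvg _ _ d_gt0 _ _ _ mf f_ge0 muE x_leb fx_gt0 c K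
    (fun n => eball (aff x (rad c n) y) (rad c n * s)) _ c0 K0 _ _ yK.
  - by move=> n; exact: measurable_eball.
  - by move=> n n0; rewrite preimage_aff_ball//; exact: rad_gt0.
  - by rewrite rvol_ball.
rewrite /uncovered_bound /uncovered_limit; apply: cvgD.
  have := H o 2^-1%R; rewrite invr_gt0 ltr0n => /(_ isT).
  by under eq_fun do rewrite aff_origin.
rewrite -[X in (X%:R * _)%R](card_ord N) mulr_natl -sumr_const.
apply: cvg_big => //; first exact: add_continuous.
by move=> i _; apply: H; rewrite invr_gt0.
Qed.

Lemma uncovered_limit_cvg : uncovered_limit M.+1%:R @[M --> \oo] --> 0%R.
Proof.
have H (s : R) : (0 < s)%R -> expR (- (M.+1%:R * s))%R @[M --> \oo] --> (0 : R)%R.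
  move=> s0; rewrite (cvg_shiftS (fun M => expR (- (M%:R * s))%R)).
  apply: (cvg_comp (fun M => M%:R) (fun y => expR (- (y * s))%R)).
    exact: cvgr_idn.
  apply: (cvg_comp (fun y => (y * s)%R) (fun y => expR (- y)%R)).
    by apply: gt0_cvgMly => //; exact: cvg_id.
  exact: cvgr_expR.
rewrite -[X in _ --> X]addr0; apply: cvgD; first exact: H.
rewrite -[X in _ --> X](mulr0 N%:R); apply: cvgMr; exact: H.
Qed.

End covering_probability.

(** A name to which the probability structure is attached, so that [distribution] can be used. *)
Definition tuple_prob n : set (n.-tuple E) -> \bar R := tuple_product mu n.

HB.instance Definition _ n := Measure.on (@tuple_prob n).

Let tuple_probT n : @tuple_prob n setT = 1.
Proof. exact: (tuple_productT (probability_setT mu) n). Qed.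

HB.instance Definition _ n :=
  Measure_isProbability.Build _ _ _ (@tuple_prob n) (@tuple_probT n).

Definition trunc_rv (c : R) n : n.-tuple E -> R := trunc_cell x c (rad c n).

Let measurable_trunc_rv c n : measurable_fun setT (@trunc_rv c n).
Proof. exact: measurable_trunc_cell. Qed.

HB.instance Definition _ c n :=
  isMeasurableFun.Build _ _ _ _ (@trunc_rv c n) (@measurable_trunc_rv c n).

Definition trunc_law c n : probability R R :=
  distribution (@tuple_prob n) (@trunc_rv c n).

Lemma trunc_law_moment c n k : (0 <= c)%R ->
  \int[trunc_law c n]_(z in `[0%R, +oo[) (z ^+ k)%:E =
  \int[tuple_product mu n]_X (trunc_cell x c (rad c n) X ^+ k)%:E.
Proof.
move=> c0; rewrite /trunc_law /distribution ge0_integral_pushforward//.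
- rewrite (_ : _ @^-1` _ = setT)//; apply/seteqP; split => // X _ /=.
  by rewrite in_itv/= andbT trunc_cell_ge0.
- by apply/measurable_EFinP; exact: measurable_funX.
- by move=> z; rewrite inE/= in_itv/= andbT => z0; rewrite lee_fin exprn_ge0.
Qed.

Lemma trunc_law_neg c n : (0 <= c)%R -> trunc_law c n `]-oo, 0%R[%classic = 0.
Proof.
move=> c0; rewrite -[RHS](measure0 (@tuple_prob n)); congr (tuple_prob _).
apply/seteqP; split => // X /=.
by rewrite in_itv/= ltNge trunc_cell_ge0.
Qed.

Lemma trunc_law_moment_fin c n k : (0 <= c)%R ->
  \int[trunc_law c n]_(z in `[0%R, +oo[) (z ^+ k)%:E < +oo.
Proof.
move=> c0; rewrite trunc_law_moment//.
apply: (@le_lt_trans _ _ (\int[tuple_product mu n]_X (cst (c ^+ k)%:E X))).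
  apply: ge0_le_integral => //.
  - by move=> X _; rewrite lee_fin exprn_ge0// trunc_cell_ge0.
  - apply/measurable_EFinP; apply: measurable_funX; exact: measurable_trunc_cell.
  - by move=> X _; rewrite lee_fin lerXn2r// ?nnegrE ?trunc_cell_ge0// trunc_cell_le.
rewrite integral_cst// [X in _ * X](_ : _ = 1) ?mule1 ?ltry//.
exact: (tuple_productT (probability_setT mu) n).
Qed.

(** The two events can differ only if a covering ball misses the sample or the nearest point is not
    unique, and the latter has probability 0. *)
Lemma cell_law_dist N (g : 'I_N -> E) (t c : R) n :
  (forall u, edist o u = 1%R -> exists i, (edist u (g i) <= 4^-1)%R) ->
  (0 < n)%N -> (0 < c)%R ->
  (`|fine (trunc_law c n `]-oo, t]%classic) -
     fine (tuple_product mu n [set X | (scaled_volume X <= t%:E)%E])| <=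
   uncovered_bound g (rad c n) n)%R.
Proof.
move=> gnet n0 c0.
pose S := [set X : n.-tuple E | scaled_volume X <= t%:E]; rewrite -/S.
have mS : measurable S by exact: measurable_scaled_volume.
pose T := @trunc_rv c n @^-1` `]-oo, t]%classic.
have mT : measurable T.
  by rewrite -[X in measurable X]setTI; exact: measurable_trunc_rv.
pose A := ~` [set X : n.-tuple E | well_covered x g (rad c n) X].
have mA : measurable A by apply: measurableC; exact: measurable_well_covered.
pose B := @no_argmax _ _ R (negdist x) n.
have mB : measurable B.
  by apply: measurable_no_argmax; exact: measurable_negdist.
pose m : probability (n.-tuple E) R := @tuple_prob n.
have ST X : ~ (A `|` B) X -> S X <-> T X.
  move=> /not_orP[/contrapT XA XB].
  rewrite /S/= (scaled_volumeE gnet n0 c0 XB XA) lee_fin /T/=.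
  by rewrite in_itv.
have B0 : m B = 0.
  rewrite /m /B -(prednK n0).
  exact: (no_argmax_null (probability_setT mu) (measurable_negdist x)
    (negdist_null d_gt0 x mf muE)).
have mAB : measurable (A `|` B) by exact: measurableU.
have AB : m (A `|` B) <= (uncovered_bound g (rad c n) n)%:E.
  apply: (le_trans (measureU2 _ mA mB)).
  rewrite [X in _ + X](_ : _ = 0) ?adde0; last exact: B0.
  exact: uncovered_le.
have le (C D : set (n.-tuple E)) : measurable C -> measurable D ->
    (forall X, ~ (A `|` B) X -> C X -> D X) ->
    (fine (m C) - fine (m D) <= uncovered_bound g (rad c n) n)%R.
  move=> mC mD CD; rewrite lerBlDl -lee_fin EFinD !fineK ?fin_num_measure//.
  apply: le_trans (leeD2l _ AB); apply: le_trans (measureU2 _ mD mAB).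
  apply: le_measure; rewrite ?inE//; first exact: measurableU.
  by move=> X CX; have [|nX] := pselect ((A `|` B) X); [right|left; exact: CD].
rewrite ler_norml lerNl opprB; apply/andP; split.
  by apply: (le S T) => // X /ST[].
by apply: (le T S) => // X /ST[].
Qed.

Lemma cell_law_cvg (nu : probability R R) (t : R) : is_scrD d nu ->
  {for t, continuous (fun s => nu `]-oo, s]%classic)} ->
  tuple_product mu n [set X | scaled_volume X <= t%:E] @[n --> \oo] -->
  nu `]-oo, t]%classic.
Proof.
move=> [nu_neg nu_mom] nut.
have nu0 : nu `]-oo, 0%R[%classic = 0.
  by rewrite -nu_neg; congr (nu _); apply/seteqP; split => z /=; rewrite in_itv.
have D0 k (z : R) : `[0%R, +oo[%classic z -> 0 <= (z ^+ k)%:E.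
  by rewrite /= in_itv/= andbT => z0; rewrite lee_fin exprn_ge0.
have nu_nneg : nu `[0%R, +oo[%classic = 1.
  by rewrite -setCitvl probability_setC// nu0 sube0.
have nuE k : (0 < k)%N ->
    \int[nu]_(z in `[0%R, +oo[) (z ^+ k)%:E = @D_moment R d k.
  move=> k0; rewrite -nu_mom// integral_mkcond.
  have mz : measurable_fun setT (fun z : R => (z ^+ k)%:E).
    by apply/measurable_EFinP; exact: measurable_funX.
  apply: ae_eq_integral => //.
    by apply/(measurable_restrictT _ (measurable_itv `[0%R, +oo[)); exact: measurable_funTS.
  exists `]-oo, 0%R[%classic; split => // z /= zN; rewrite in_itv/= ltNge.
  apply/negP => z0; apply: zN => _; rewrite patchE mem_set//=.
  by rewrite in_itv/= z0.
have nu_int0 : \int[nu]_(z in `[0%R, +oo[) (z ^+ 0)%:E = 1.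
  transitivity (\int[nu]_(z in `[0%R, +oo[) (cst 1 z)) => //.
  by rewrite integral_cst// mul1e.
(* The successor keeps [c] positive for every [M]. *)
pose law (i : nat * nat) := trunc_law i.1.+1%:R i.2.
have mom k : \int[law i]_(z in `[0%R, +oo[) (z ^+ k)%:E @[i --> iterated_near]
    --> \int[nu]_(z in `[0%R, +oo[) (z ^+ k)%:E.
  (* [is_scrD] prescribes the positive orders; order 0 is the total mass. *)
  case: k => [|k].
    rewrite nu_int0; apply: cvg_near_cst; apply: nearW => i.
    rewrite /law trunc_law_moment//.
    transitivity (\int[tuple_product mu i.2]_X (cst 1 X)) => //.
    rewrite integral_cst// mul1e.
    exact: (tuple_productT (probability_setT mu)).
  rewrite nuE//.
  apply: (@iterated_cvg _ (fun M n => \int[law (M, n)]_(z in `[0%R, +oo[) (z ^+ k.+1)%:E)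
    (fun M => @poisson_moment R d k.+1 M.+1%:R)).
    move=> M; under eq_fun do rewrite /law/= trunc_law_moment//.
    exact: trunc_moment_cvg.
  rewrite (cvg_shiftS (fun M => @poisson_moment R d k.+1 M%:R)).
  exact: D_moment_cvg.
have lawt : law i `]-oo, t]%classic @[i --> iterated_near] --> nu `]-oo, t]%classic.
  apply: (@method_of_moments R _ iterated_near _ law nu (2 ^+ d)) => //.
  - by move=> i; exact: trunc_law_neg.
  - by move=> i k; exact: trunc_law_moment_fin.
  - by rewrite exprn_ege1// ler1n.
  - case=> [|k]; last by rewrite nuE//; exact: D_moment_le.
    by rewrite nu_int0 lee_fin mul1r expr1 exprn_ege1// ler1n.
have [N [g gnet]] := @sphere_net R d d_gt0.
pose b (i : nat * nat) : R := uncovered_bound g (rad i.1.+1%:R i.2) i.2.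
have b0 : b i @[i --> iterated_near] --> 0%R.
  apply: (@iterated_cvg _ (fun M n => b (M, n))
    (fun M => @uncovered_limit N M.+1%:R)).
    move=> M; rewrite /b/=.
    exact: (uncovered_cvg g (ltr0Sn R M)).
  exact: uncovered_limit_cvg.
have nut_fin : nu `]-oo, t]%classic \is a fin_num by exact: fin_num_measure.
move: lawt; rewrite -(fineK nut_fin) => /fine_cvgP[_ lawt].
apply/fine_cvgP; split.
  apply: nearW => n; apply: (@fin_num_measure _ _ _ (@tuple_prob n)).
  exact: measurable_scaled_volume.
apply/cvgrPdist_le => e e0.
have e20 : (0 < e / 2)%R by rewrite divr_gt0.
have near_law : \forall i \near iterated_near,
    (`|fine (nu `]-oo, t]%classic) - fine (law i `]-oo, t]%classic)| <= e / 2)%R.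
  by move/cvgrPdist_le : lawt; exact.
have near_b : \forall i \near iterated_near, (b i <= e / 2)%R.
  move/cvgrPdist_le : b0 => /(_ _ e20); apply: filterS => i.
  by rewrite sub0r normrN; exact: le_trans (ler_norm _).
have : iterated_near [set i |
    (`|fine (nu `]-oo, t]%classic) - fine (law i `]-oo, t]%classic)| <= e / 2)%R /\
    (b i <= e / 2)%R].
  exact: filterI near_law near_b.
(* One [M] for which both estimates hold for all large [n] is enough: the volume of the cell does
   not depend on [M], so the remaining limit is in [n] alone. *)
rewrite /iterated_near/= => /filter_ex[M HM].
near=> n.
have n0 : (0 < n)%N by near: n; exact: nbhs_infty_gt.
have [law_n b_n] : (`|fine (nu `]-oo, t]%classic) - fine (law (M, n) `]-oo, t]%classic)| <= e / 2)%R
    /\ (b (M, n) <= e / 2)%R by near: n.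
rewrite [leRHS]splitr; apply: le_trans (ler_distD (fine (law (M, n) `]-oo, t]%classic)) _ _) _.
apply: lerD => //; apply: le_trans b_n.
exact: cell_law_dist.
Unshelve. all: by end_near. Qed.

End volume_of_the_cell.

Theorem theorem1p5 (R : realType) (d : nat) (d_ge1 : (1 <= d)%N)
    (f : d.-tuple R -> R) (f_density : is_density f)
    (x : d.-tuple R) (x_lebesgue : lebesgue_point f x) (fx_gt0 : 0 < f x)
    (dQ : measure_display) (O' : measurableType dQ) (Q : probability O' R)
    (Z : {RV Q >-> R}) (Z_scrD : is_scrD d (distribution Q Z))
    (dO : nat -> measure_display) (O : forall n, measurableType (dO n))
    (P : forall n, probability (O n) R)
    (X : forall n, 'I_n -> {RV (P n) >-> d.-tuple R})
    (X_iid : forall n, iid_density f (X n)) :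
  cvg_in_distribution P
    (fun n w => (n%:R * f x)%:E * lebesgue d (cell_at (fun i => X n i w) x))%E
    Z.
Proof.
move=> t Zt.
have [mf f_ge0 _] := f_density.
(* The law of the single variable in the sample of size 1 supplies the probability measure with
   density [f]. *)
pose mu : probability (d.-tuple R) R := distribution (P 1%N) (X 1%N ord0).
have muE A : measurable A -> mu A = (\int[lebesgue d]_(u in A) (f u)%:E)%E.
  exact: (X_iid 1%N).2 ord0 A.
have H := @cell_law_cvg _ _ d_ge1 _ _ mu mf f_ge0 muE x_lebesgue fx_gt0
  _ _ Z_scrD Zt.
apply: cvg_trans H; apply: near_eq_cvg; apply: nearW => n.
have [indX lawX] := X_iid n.
rewrite -(@iid_law _ _ _ _ _ (P n) mu n (X n)) => //.
- congr (P n _); apply/seteqP.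
  have yE w : tnth [tuple X n i w | i < n] = fun i => X n i w.
    by apply/funext => i; rewrite tnth_mktuple.
  by split => w; rewrite /= /scaled_volume yE.
- by move=> i A mA; rewrite muE// -(lawX i A mA).
- exact: measurable_scaled_volume.
Qed.
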